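(* Let $d\ge0$ and fix a domain $X\subset\mathbb{C}^d$. Let $S\subset\mathbb{C}_\hbar$ be a sectorial domain at the origin with opening arc $A$ with opening angle $|A|=\pi$. Consider a polynomial $$F=a_0+a_1z+\dots+a_nz^n$$ in the variable $z$ whose coefficients $a_0,\dots,a_n$ are holomorphic functions of $(x,\hbar)\in X\times S$ which admit uniform Gevrey asymptotic expansions $$a_i(x,\hbar)\simeq\hat a_i(x,\hbar)=\sum_{k=0}^\infty a_{i,k}(x)\hbar^k\qquad\text{as }\hbar\to0\text{ along }\bar A,\text{ uniformly for all }x\in X.$$ Suppose that the leading-order discriminant $$D_0(x):=\operatorname{Disc}_z(F_0)=\operatorname{Disc}_z\big(a_{0,0}+a_{1,0}z+\dots+a_{n,0}z^n\big)$$ is nonvanishing on $X$. Let $z=f_0$ be a leading-order solution on $X$, i.e. a holomorphic function $f_0(x)$ on $X$ such that $F_0(x,f_0(x))=0$ for all $x\in X$, where $F_0(x,z)=a_{0,0}(x)+a_{1,0}(x)z+\dots+a_{n,0}(x)z^n$. Then for any compactly contained subdomain $X_0\subset X$, there is a sectorial subdomain $S_0\subset S$ with the same opening $A$ such that the polynomial $F$ has a unique root $z=f(x,\hbar)$ which is a holomorphic function on $X_0\times S_0$ and admits a uniform Gevrey asymptotic expansion $$f(x,\hbar)\simeq\hat f(x,\hbar)=\sum_{k=0}^\infty f_k(x)\hbar^k\qquad\text{as }\hbar\to0\text{ along }\bar A,\text{ uniformly for all }x\in X_0,$$ whose leading-order coefficient is the given leading-order solution $f_0$. Furthermore, $f$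 is the uniform Borel resummation of $\hat f$ in the direction $\theta$ that bisects $A$.
   Context: A sectorial domain at the origin in $\mathbb{C}_\hbar$ is a simply connected domain $S\subset\mathbb{C}_\hbar\setminus\{0\}$ whose closure in the real-oriented blowup $[\mathbb{C}_\hbar:0]$ intersects the boundary circle $\mathbb{S}^1$ (of directions at the origin) in a closed arc $\bar A$ of nonzero length; the open arc $A$ is called the opening of $S$ and its length $|A|$ the opening angle. When $|A|=\pi$, the direction $\theta$ bisecting $A$ is the one with $A=(\theta-\pi/2,\theta+\pi/2)$. Gevrey asymptotics along $\bar A$: a holomorphic function $f(\hbar)$ on $S$ admits $\hat f=\sum_k f_k\hbar^k$ as its Gevrey asymptotic expansion as $\hbar\to0$ along the closed arc $\bar A$, written $f\simeq\hat f$, if there are constants $C,M>0$ such that for every compactly contained subarc $A_0\Subset A$ there is a sectorial subdomain $S'\subset S$ with opening $A_0$ such that $|f(\hbar)-\sum_{k=0}^{n-1}f_k\hbar^k|\le CM^n n!\,|\hbar|^n$ for all $\hbar\in S'$ and all $n\ge0$. If $f$ depends on a parameter $x$, the coefficients are holomorphic functions of $x$; ''uniformly'' in $x$ means the constants $C,M$ and the subdomains $S'$ can be chosen independent of $x$. Borel resummation: for a power series $\hat f(\hbar)=\sum_k f_k\hbar^k$, the formal Borel transform is $\hat\phi(\xi)=\sum_{k\ge0}\frac{1}{k!}f_{k+1}\xi^k$. The series $\hat f$ is Borel summable in the direction $\theta$ if $\hat\phi$ converges near $\xi=0$ and admits an analytic continuation $\phi$ to a tubular neighbourhood $\Xi_\theta=\{\xi:\operatorname{dist}(\xi,e^{i\theta}\mathbb{R}_+)<\epsilon\}$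 for some $\epsilon>0$, with at-most-exponential growth: $|\phi(\xi)|\le K e^{L|\xi|}$ on $\Xi_\theta$ for some $K,L>0$. Its Borel resummation is $\mathcal{S}_\theta[\hat f](\hbar)=f_0+\int_{e^{i\theta}\mathbb{R}_+}\phi(\xi)e^{-\xi/\hbar}\,d\xi$. When the coefficients depend on $x$, the Borel resummation is uniform if $\epsilon,K,L$ can be chosen independent of $x$ and $\phi$ is holomorphic in $(x,\xi)$.
   Formalization: Gevrey asymptotics along the closed arc require, throughout, that S' contain the part over A_0 of one fixed Borel disc Re(e^{iθ}/ħ)>1/ρ (as stated, exp(-(1/ħ)log(1/ħ)) refutes the Borel claim); the discriminant of the zero polynomial is taken to be 0. *)

(* Defs.v *)
From HB Require Import structures.
From mathcomp Require Import all_boot all_order all_algebra.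
From mathcomp Require Import all_classical all_reals all_analysis.
From mathcomp Require Import complex.
From mathcomp Require Import ring zify.

Set Implicit Arguments.
Unset Strict Implicit.
Unset Printing Implicit Defensive.

Import Order.TTheory GRing.Theory Num.Theory numFieldNormedType.Exports.

Local Open Scope classical_set_scope.
Local Open Scope ring_scope.

(* R[i] seen as a numFieldType, which gives it (and 'rV[CC R]_d, and products)
   the topology and the normed CC R-module structure of MathComp-Analysis. *)
Definition CC (R : realType) : numFieldType := R[i].

Section Complex.
Variable R : realType.
Local Notation C := (CC R).

Definition ofR (x : R) : C := Complex x 0.

(* The norm `|z| of MathComp is valued in C. *)
Definition cabs (z : C) : R := complex.Re `|z|.

Definition dir (t : R) : C := Complex (cos t) (sin t).

Definition cexp (z : C) : C := ofR (expR (complex.Re z)) * dir (complex.Im z).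

Definition domain (T : topologicalType) (U : set T) : Prop :=
  [/\ open U, connected U & U !=set0].

(* U is compactly contained in V *)
Definition compactly_contained (T : topologicalType) (U V : set T) : Prop :=
  compact (closure U) /\ closure U `<=` V.

(* C-differentiability: the differential is a C-linear map. *)
Definition holomorphic (V : normedModType C) (U : set V) (f : V -> C) : Prop :=
  forall p, U p -> differentiable (f : V -> C^o) p.

Definition simply_connected (U : set C) : Prop :=
  forall gamma : R -> C,
    {within `[0, 1], continuous gamma} ->
    (forall t, t \in `[0, 1] -> U (gamma t)) ->
    gamma 0 = gamma 1 ->
    exists H : R * R -> C,
      [/\ {within `[0, 1] `*` `[0, 1], continuous H},
          forall s t, s \in `[0, 1] -> t \in `[0, 1] -> U (H (s, t)),
          forall t, t \in `[0, 1] -> H (0, t) = gamma t,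
          forall t, t \in `[0, 1] -> H (1, t) = gamma 0 &
          forall s, s \in `[0, 1] -> H (s, 0) = gamma 0 /\ H (s, 1) = gamma 0].

(* The real-oriented blowup [C : 0] is the closed subset [0, +oo[ x S^1 of
   R x C, and [polar] is the embedding of C \ {0} in it. *)
Definition polar (z : C) : R * C := (cabs z, z / ofR (cabs z)).

(* The trace on the boundary circle {0} x S^1 of the closure of S in [C : 0]. *)
Definition boundary_directions (S : set C) : set C :=
  [set u | closure (polar @` S) (0, u)].

(* The opening of S is the open arc of the dir t for alpha < t < beta. *)
Definition sectorial_domain (S : set C) (alpha beta : R) : Prop :=
  [/\ domain S, simply_connected S, ~ S 0,
      alpha < beta <= alpha + pi *+ 2 &
      boundary_directions S = dir @` `[alpha, beta]].

Definition sector (alpha beta : R) : set C :=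
  [set h | exists r t : R, [/\ 0 < r, alpha < t < beta & h = ofR r * dir t]].

(* The open disc of diameter rho tangent at 0 to the line orthogonal to dir t;
   as 0^-1 = 0, it does not contain 0. *)
Definition borel_disc (t rho : R) : set C :=
  [set h | rho^-1 < complex.Re (dir t / h)].

(* Uniform Gevrey asymptotics f(x, h) ~ \sum_k fk(x) h^k as h -> 0 in S along
   the closed arc of endpoints dir alpha and dir beta, where beta - alpha = pi.
   K and M do not depend on the subarc, and the subdomains S' must together
   cover some Borel disc, so that the estimates are uniform up to the ends of
   the closed arc, as Nevanlinna's theorem requires.  If the S' could shrink
   arbitrarily fast as the subarc grows, exp (- (1/h) log (1/h)) would be
   asymptotic to 0 on a right half-disc, without being the Borel sum of 0. *)
Definition gevrey_expansion (d : nat) (X : set 'rV[C]_d) (S : set C)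
    (alpha beta : R) (f : 'rV[C]_d -> C -> C) (fk : nat -> 'rV[C]_d -> C)
    : Prop :=
  (forall k, holomorphic X (fk k)) /\
  exists K M rho : R, [/\ 0 < K, 0 < M, 0 < rho &
    forall alpha0 beta0 : R,
      alpha < alpha0 -> alpha0 < beta0 -> beta0 < beta ->
      exists S' : set C,
        [/\ S' `<=` S, sectorial_domain S' alpha0 beta0,
            borel_disc ((alpha + beta) / 2) rho `&` sector alpha0 beta0 `<=` S' &
            forall (n : nat) x h, X x -> S' h ->
              cabs (f x h - \sum_(k < n) fk k x * h ^+ k)
                <= K * M ^+ n * n`!%:R * cabs h ^+ n]].

(* {xi | dist (xi, e^(it) R_+) < eps} *)
Definition tube (t eps : R) : set C :=
  [set xi | exists2 r : R, 0 <= r & cabs (xi - ofR r * dir t) < eps].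

Definition laplace_integrand (t : R) (phi : C -> C) (h : C) (r : R) : C :=
  phi (ofR r * dir t) * cexp (- (ofR r * dir t) / h) * dir t.

(* The integral of phi(xi) e^(- xi / h) dxi along e^(it) R_+ converges to v. *)
Definition is_laplace (t : R) (phi : C -> C) (h v : C) : Prop :=
  let g := laplace_integrand t phi h in
  [/\ lebesgue_measure.-integrable `[0, +oo[ (fun r => (complex.Re (g r))%:E),
      lebesgue_measure.-integrable `[0, +oo[ (fun r => (complex.Im (g r))%:E) &
      v = Complex (\int[lebesgue_measure]_(r in `[0, +oo[) complex.Re (g r))
                  (\int[lebesgue_measure]_(r in `[0, +oo[) complex.Im (g r))].

(* \sum_k fk(x) h^k is Borel summable in the direction t uniformly for x in X,
   and f is its Borel resummation on X x S. *)
Definition uniform_borel_resummation (d : nat) (X : set 'rV[C]_d) (S : set C)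
    (t : R) (f : 'rV[C]_d -> C -> C) (fk : nat -> 'rV[C]_d -> C) : Prop :=
  exists eps K L : R, [/\ 0 < eps, 0 < K, 0 < L &
  exists phi : 'rV[C]_d -> C -> C,
    [/\ holomorphic (X `*` tube t eps) (fun p => phi p.1 p.2),
        forall x, X x -> \forall xi \near (0 : C),
          series (fun k => fk k.+1 x / k`!%:R * xi ^+ k) @ \oo --> phi x xi,
        forall x xi, X x -> tube t eps xi ->
          cabs (phi x xi) <= K * expR (L * cabs xi) &
        forall x h, X x -> S h -> is_laplace t (phi x) h (f x h - fk 0%N x)]].

End Complex.

(* The discriminant of c_0 + c_1 X + ... + c_n X^n as a universal polynomial in
   c_0, ..., c_n: (-1)^(n(n-1)/2) / c_n times the resultant of p and p^`(), where
   the division by c_n is performed in the last column of the Sylvester matrix,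
   so that c_n = 0 makes sense (see [disc_resultant] and [disc2]).  The
   convention for p = 0 only matters for n <= 1, the determinant being then 1. *)
Definition disc (K : fieldType) (n : nat) (p : {poly K}) : K :=
  if p == 0 then 0 else
  (-1) ^+ 'C(n, 2) *
  \det (\matrix_(i < n.-1 + n, j < n.-1 + n)
          let q := if j.+1 == (n.-1 + n)%N then 'X^n else p in
          match fintype.split i with
          | inl k => (q * 'X^k)`_j
          | inr k => (q^`() * 'X^k)`_j
          end).

Lemma resultantE (K : fieldType) (m n : nat) (p q : {poly K}) :
  (size q).-1 = m -> (size p).-1 = n ->
  resultant p q = \det (\matrix_(i < m + n, j < m + n)
    match fintype.split i with
    | inl k => (p * 'X^k)`_j
    | inr k => (q * 'X^k)`_j
    end).
Proof.
move=> <- <-; congr (\det _); apply/matrixP => i j.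
rewrite Sylvester_mxE mxE; case: (fintype.split i) => k;
  by rewrite coefMXn; case: ltnP; rewrite ?mulr0n ?mulr1n.
Qed.

Lemma disc_resultant (K : fieldType) (n : nat) (p : {poly K}) :
  (0 < n)%N -> size p = n.+1 -> size p^`() = n ->
  lead_coef p * disc n p = (-1) ^+ 'C(n, 2) * resultant p p^`().
Proof.
move=> n0 sp sp'.
have p0 : p != 0 by rewrite -size_poly_gt0 sp.
rewrite (@resultantE K n.-1 n p p^`()) ?sp ?sp' //.
rewrite /disc (negPf p0) mulrCA; congr (_ * _).
set A := (X in _ * \det X); set B := (X in _ = \det X).
pose v : 'rV[K]_(n.-1 + n) :=
  \row_j (if j.+1 == (n.-1 + n)%N then lead_coef p else 1).
have -> : B = A *m diag_mx v.
  apply/matrixP => i j; rewrite mul_mx_diag !mxE /=.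
  case: eqP => [ej|_]; last by rewrite mulr1.
  have H m : (n <= m)%N -> p`_m = 'X^n`_m * lead_coef p.
    rewrite coefXn leq_eqVlt => /predU1P[<-|nm].
      by rewrite eqxx mul1r lead_coefE sp.
    by rewrite gtn_eqF // mul0r nth_default // sp.
  case: (fintype.split i) => k; rewrite !coefMXn; case: ltnP => kj;
    rewrite ?mul0r ?coef_deriv ?H ?mulrnAl //; have := ltn_ord k; lia.
rewrite det_mulmx det_diag mulrC; congr (_ * _).
have Nn : ((n.-1 + n).-1 < n.-1 + n)%N by lia.
rewrite (bigD1 (Ordinal Nn)) //= big1 ?mulr1 ?mxE /=.
  by rewrite prednK ?eqxx //; lia.
move=> j; rewrite mxE -val_eqE /= => /eqP jN; case: eqP => // ej; lia.
Qed.

Lemma disc2 (K : fieldType) (a b c : K) (p := a%:P + b *: 'X + c *: 'X^2) :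
  p != 0 -> disc 2 p = b ^+ 2 - 4 * a * c.
Proof.
have Hp k : p`_k = [:: a; b; c]`_k.
  rewrite /p !coefD coefC !coefZ coefX coefXn.
  by case: k => [|[|[|k]]]; rewrite /= ?nth_nil ?mulr0 ?mulr1 ?addr0 ?add0r.
rewrite /disc => /negPf ->.
set A := (X in \det X).
have EA (i j : 'I_3) : A i j =
    (nth [::] [:: [:: a; b; 1]; [:: b; 2 * c; 0]; [:: 0; b; 2]] i)`_j.
  rewrite mxE; case: splitP => k ik; rewrite coefMXn ?coef_deriv ik;
    case: k ik => -[|[|//]] //= _ _; case: j => [[|[|[|//]]] /= _];
    rewrite ?coef_deriv ?coefXn ?Hp //= ?mul0rn ?mulr_natl //.
have -> : A = \matrix_(i < 3, j < 3)
    (nth [::] [:: [:: a; b; 1]; [:: b; 2 * c; 0]; [:: 0; b; 2]] i)`_j.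
  by apply/matrixP => i j; rewrite EA mxE.
rewrite (expand_det_row _ ord0) !big_ord_recl big_ord0 /cofactor.
rewrite !(expand_det_row _ ord0) !big_ord_recl !big_ord0 /cofactor.
rewrite !det_mx11 !mxE /=.
ring.
Qed.

(* a_0 + a_1 X + ... + a_n X^n *)
Definition pol (K : fieldType) (n : nat) (a : 'I_n.+1 -> K) : {poly K} :=
  \sum_(i < n.+1) a i *: 'X^i.

(* f is a holomorphic root on X x S of the polynomial with coefficients a, with
   the uniform Gevrey expansion fk, whose leading-order coefficient is f0. *)
Definition gevrey_root (R : realType) (d n : nat) (X : set 'rV[CC R]_d)
    (S : set (CC R)) (alpha beta : R)
    (a : 'I_n.+1 -> 'rV[CC R]_d -> CC R -> CC R) (f0 : 'rV[CC R]_d -> CC R)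
    (f : 'rV[CC R]_d -> CC R -> CC R) (fk : nat -> 'rV[CC R]_d -> CC R) : Prop :=
  [/\ holomorphic (X `*` S) (fun p => f p.1 p.2),
      forall x h, X x -> S h -> root (pol (fun i => a i x h)) (f x h),
      gevrey_expansion X S alpha beta f fk &
      forall x, X x -> fk 0%N x = f0 x].

(* Main.v *)
(* Write the root as f = f0 + h u.  The discriminant being nonzero, F_0'(f0) is
   nonzero, and dividing F(f0 + h u) = 0 by h F_0'(f0) gives
     u = G_0 + h (G_1 u + ... + G_n u^n)
   with Gevrey coefficients G_i.  For small h this has a solution by contraction.
   A Gevrey estimate of order N on u gives one of order N on the bracket, hence,
   thanks to the factor h, one of order N + 1 on u with the same constants.

   Borel summability is Nevanlinna's theorem.  With p = e^(it) / h, the variable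
   z = kap / p - 1 maps a Borel disc to the unit disc, where the normalized
   remainders of f are bounded and have Taylor series in z.  The inverse Laplace
   transforms of p^-(m+1) z^n are multiples of Laguerre polynomials, which decay
   fast enough in n for m large: summing them gives the derivatives of the Borel
   transform along the ray, with bounds A N^j j! e^(L s), and its Taylor series at
   the points of the ray continue it to a tube.

   Holomorphy of limits and Taylor expansions come from Goursat's theorem on
   rectangles, in which line integrals are replaced by antiderivatives. *)
Require Import Defs.
From HB Require Import structures.
From mathcomp Require Import all_boot all_order all_algebra.
From mathcomp Require Import all_classical all_reals all_analysis.
From mathcomp Require Import complex.
From mathcomp Require Import ring lra zify.

Set Implicit Arguments.
Unset Strict Implicit.
Unset Printing Implicit Defensive.

Import Order.TTheory GRing.Theory Num.Theory numFieldNormedType.Exports.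

Local Open Scope classical_set_scope.
Local Open Scope ring_scope.

(** * Complex numbers and derivatives *)

(** Everything takes place on Borel discs, that is on half-planes [Re p > 1 / rho]. The estimates on
    the subarcs, with common constants and a common disc to cover, amount to estimates on one whole
    disc, and a Borel disc is itself a sectorial domain whose opening has length [pi]: it serves as
    [S0]. Compactness of the closure of [X0] serves to bound [f0] and [1 / F_0'(f0)].

    The obstacle in Nevanlinna's theorem is that a bounded function on the unit disc has Taylor
    coefficients that are merely bounded, so summability of the Laguerre series requires two powers
    of [1 / n]. They are paid for with factors [1 / p]: index 5 gives summability, two more indices
    allow termwise differentiation, hence index 7, that is [p^-8].

    The series is never differentiated infinitely often. The candidate for the [j]-th derivative is
    built separately from the remainder of order [j + 8], whose Gevrey bound supplies the factor
    [j!]; successive candidates are linked by the relation between successive remainders, in which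
    the factor [1 / p = (1 + z) / kap] is an integration in [s]. *)

Section ComplexNumbers.
Variable R : realType.
Local Notation C := (CC R).
Implicit Types (z w : C) (x y t : R).

Definition re z : R := complex.Re z.
Definition im z : R := complex.Im z.

Lemma complexP z w : re z = re w -> im z = im w -> z = w.
Proof. by case: z w => [a b] [c d] /= -> ->. Qed.

Lemma reD z w : re (z + w) = re z + re w. Proof. by case: z w => [a b] [c d]. Qed.
Lemma imD z w : im (z + w) = im z + im w. Proof. by case: z w => [a b] [c d]. Qed.
Lemma reN z : re (- z) = - re z. Proof. by case: z. Qed.
Lemma imN z : im (- z) = - im z. Proof. by case: z. Qed.
Lemma reB z w : re (z - w) = re z - re w. Proof. by rewrite reD reN. Qed.
Lemma imB z w : im (z - w) = im z - im w. Proof. by rewrite imD imN. Qed.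
Lemma reM z w : re (z * w) = re z * re w - im z * im w.
Proof. by case: z w => [a b] [c d]. Qed.
Lemma imM z w : im (z * w) = re z * im w + im z * re w.
Proof. by case: z w => [a b] [c d]. Qed.
Lemma re_ofR x : re (ofR x) = x. Proof. by []. Qed.
Lemma im_ofR x : im (ofR x) = 0. Proof. by []. Qed.
Lemma re0 : re (0 : C) = 0. Proof. by []. Qed.
Lemma im0 : im (0 : C) = 0. Proof. by []. Qed.
Lemma re1 : re (1 : C) = 1. Proof. by []. Qed.
Lemma im1 : im (1 : C) = 0. Proof. by []. Qed.
Lemma re_dir t : re (dir t) = cos t. Proof. by []. Qed.
Lemma im_dir t : im (dir t) = sin t. Proof. by []. Qed.
Definition reimE := (reD, imD, reN, imN, reM, imM, re_ofR, im_ofR, re0, im0, re1, im1, re_dir, im_dir).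

Lemma ofRD x y : ofR (x + y) = ofR x + ofR y :> C.
Proof. by apply: complexP; rewrite !reimE ?addr0. Qed.
Lemma ofRM x y : ofR (x * y) = ofR x * ofR y :> C.
Proof. by apply: complexP; rewrite !reimE; ring. Qed.
Lemma ofRN x : ofR (- x) = - ofR x :> C.
Proof. by apply: complexP; rewrite !reimE ?oppr0. Qed.
Lemma ofRB x y : ofR (x - y) = ofR x - ofR y :> C.
Proof. by rewrite ofRD ofRN. Qed.
Lemma ofR0 : ofR 0 = 0 :> C. Proof. by []. Qed.
Lemma ofR1 : ofR 1 = 1 :> C. Proof. by []. Qed.
Lemma ofR_eq0 x : (ofR x == 0 :> C) = (x == 0).
Proof. by apply/eqP/eqP => [[]|->]. Qed.
Lemma ofRV x : ofR x^-1 = (ofR x)^-1 :> C.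
Proof.
have [->|x0] := eqVneq x 0; first by rewrite !(invr0, ofR0).
by apply: (mulfI (x := ofR x)); rewrite ?ofR_eq0// -ofRM !divff// ofR_eq0.
Qed.
Lemma ofR_nat n : ofR n%:R = n%:R :> C.
Proof. by elim: n => [|n ih] //; rewrite -!natr1 ofRD ih. Qed.

Lemma normC_cabs z : `|z| = ofR (cabs z) :> C.
Proof. by rewrite /cabs normc_def. Qed.
Lemma cabsE z : cabs z = Num.sqrt (re z ^+ 2 + im z ^+ 2).
Proof. by rewrite /cabs normc_def. Qed.
Lemma cabs_ge0 z : 0 <= cabs z.
Proof. by rewrite cabsE sqrtr_ge0. Qed.
Hint Resolve cabs_ge0 : core.
Lemma cabs2 z : cabs z ^+ 2 = re z ^+ 2 + im z ^+ 2.
Proof. by rewrite cabsE sqr_sqrtr// addr_ge0 ?sqr_ge0. Qed.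
Lemma cabsM z w : cabs (z * w) = cabs z * cabs w.
Proof.
suff [] : ofR (cabs (z * w)) = ofR (cabs z * cabs w) :> C by [].
by rewrite ofRM -!normC_cabs normrM.
Qed.
Lemma cabsN z : cabs (- z) = cabs z.
Proof. by rewrite /cabs normrN. Qed.
Lemma cabsD z w : cabs (z + w) <= cabs z + cabs w.
Proof.
have := ler_normD z w; rewrite !normC_cabs -ofRD lecE => /andP[_]; exact.
Qed.
Lemma cabsBC z w : cabs (z - w) = cabs (w - z).
Proof. by rewrite -cabsN opprB. Qed.
Lemma cabsB z w : cabs (z - w) <= cabs z + cabs w.
Proof. by rewrite (le_trans (cabsD _ _))// cabsN. Qed.
Lemma cabs_tri u z w : cabs (z - w) <= cabs (z - u) + cabs (u - w).
Proof. by have := cabsD (z - u) (u - w); rewrite addrA subrK. Qed.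
Lemma cabs_ofR x : cabs (ofR x) = `|x|.
Proof. by rewrite cabsE !reimE expr0n addr0 sqrtr_sqr. Qed.
Lemma cabs0 : cabs (0 : C) = 0. Proof. by rewrite -ofR0 cabs_ofR normr0. Qed.
Lemma cabs1 : cabs (1 : C) = 1. Proof. by rewrite -ofR1 cabs_ofR normr1. Qed.
Lemma cabs_nat n : cabs (n%:R : C) = n%:R.
Proof. by rewrite -ofR_nat cabs_ofR ger0_norm. Qed.
Lemma cabs_eq0 z : (cabs z == 0) = (z == 0).
Proof. by rewrite -ofR_eq0 -normC_cabs normr_eq0. Qed.
Lemma cabs_gt0 z : (0 < cabs z) = (z != 0).
Proof. by rewrite lt_def cabs_eq0 cabs_ge0 andbT. Qed.
Lemma cabsV z : cabs z^-1 = (cabs z)^-1.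
Proof.
have [->|z0] := eqVneq z 0; first by rewrite invr0 cabs0 invr0.
apply: (mulfI (x := cabs z)); rewrite ?cabs_eq0// -cabsM !divff ?cabs_eq0//.
exact: cabs1.
Qed.
Lemma cabsX z n : cabs (z ^+ n) = cabs z ^+ n.
Proof. by elim: n => [|n ih]; rewrite ?cabs1// !exprS cabsM ih. Qed.
Lemma cabs_dir t : cabs (dir t) = 1.
Proof. by rewrite cabsE !reimE cos2Dsin2 sqrtr1. Qed.
Lemma dir_neq0 t : dir t != 0 :> C.
Proof. by rewrite -cabs_gt0 cabs_dir. Qed.
Lemma re_le_cabs z : `|re z| <= cabs z.
Proof. by rewrite cabsE -sqrtr_sqr ler_wsqrtr// lerDl sqr_ge0. Qed.
Lemma im_le_cabs z : `|im z| <= cabs z.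
Proof. by rewrite cabsE -sqrtr_sqr ler_wsqrtr// lerDr sqr_ge0. Qed.
Lemma ge_re_cabs z : re z <= cabs z.
Proof. by rewrite (le_trans (ler_norm _))// re_le_cabs. Qed.
Lemma cabs_le_reim z : cabs z <= `|re z| + `|im z|.
Proof.
rewrite -(@ler_pXn2r _ 2)// ?nnegrE ?addr_ge0// cabs2 sqrrD !real_normK ?num_real//.
by rewrite -addrA lerD2l lerDr mulrn_wge0// mulr_ge0.
Qed.
Lemma cabs_sum (I : Type) (r : seq I) (P : pred I) (F : I -> C) :
  cabs (\sum_(i <- r | P i) F i) <= \sum_(i <- r | P i) cabs (F i).
Proof.
elim/big_rec2: _ => [|i y z _ h]; first by rewrite cabs0.
by rewrite (le_trans (cabsD _ _))// lerD2l.
Qed.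
Lemma cabs_dist z w : `|cabs z - cabs w| <= cabs (z - w).
Proof.
have h (u v : C) : cabs u - cabs v <= cabs (u - v).
  by have := cabsD (u - v) v; rewrite subrK -lerBlDr.
rewrite ler_norml h andbT lerNl opprB cabsBC; exact: h.
Qed.

Lemma dirD s t : dir (s + t) = dir s * dir t :> C.
Proof. by apply: complexP; rewrite !reimE ?cosD ?sinD; ring. Qed.
Lemma dir0 : dir 0 = 1 :> C.
Proof. by apply: complexP; rewrite !reimE ?cos0 ?sin0. Qed.
Lemma dirN t : dir (- t) = (dir t)^-1 :> C.
Proof.
by apply: (mulfI (dir_neq0 t)); rewrite -dirD subrr dir0 divff// dir_neq0.
Qed.

Lemma cabs_eq z w : (forall e, 0 < e -> cabs (z - w) <= e) -> z = w.
Proof.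
move=> h; apply/eqP; rewrite -subr_eq0 -cabs_eq0 eq_le cabs_ge0 andbT.
by apply/ler_addgt0Pl => e e0; rewrite addr0; exact: h.
Qed.

Lemma cexpE z : cexp z = ofR (expR (re z)) * dir (im z). Proof. by []. Qed.
Lemma cabs_cexp z : cabs (cexp z) = expR (re z).
Proof. by rewrite cexpE cabsM cabs_dir mulr1 cabs_ofR ger0_norm ?expR_ge0. Qed.
Lemma cexpD z w : cexp (z + w) = cexp z * cexp w.
Proof. by rewrite !cexpE reD imD expRD dirD ofRM; ring. Qed.
Lemma cexp0 : cexp (0 : C) = 1.
Proof. by rewrite cexpE expR0 dir0 mulr1. Qed.

End ComplexNumbers.
Arguments reimE {R}.
#[export] Hint Extern 0 (is_true (0 <= cabs _)) => exact: cabs_ge0 : core.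

(** * Derivatives and primitives of complex functions of a real variable *)

Section RealVariable.
Variable R : realType.
Local Notation C := (CC R).

Lemma is_derive_epsP (f : R -> R) (x l : R) :
  is_derive x 1 f l <->
  forall e, 0 < e -> exists2 d, 0 < d &
    forall h, `|h| < d -> `|f (x + h) - f x - l * h| <= e * `|h|.
Proof.
split=> [[df dE] e e0|h].
  have : (fun h => h^-1 *: (f (h *: 1 + x) - f x)) @ 0^' --> l.
    by rewrite -dE; exact: df.
  move=> /cvgrPdist_le /(_ _ e0); rewrite near_withinE => -[d /= d0 H].
  exists d => // h hd; have [->|h0] := eqVneq h 0.
    by rewrite addr0 subrr mulr0 subrr normr0 mulr0.
  have := H h; rewrite /= sub0r normrN => /(_ hd h0).
  rewrite distrC -[h^-1 *: _]/(h^-1 * _) -[h *: 1]/(h * 1) mulr1 (addrC h).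
  rewrite -ler_pdivrMr ?normr_gt0// => H1; rewrite -normf_div.
  by rewrite mulrBl mulfK// mulrC.
suff H : (fun h => h^-1 *: (f (h *: 1 + x) - f x)) @ 0^' --> l.
  by split; [apply/cvg_ex; exists l|apply/cvg_lim].
apply/cvgrPdist_le => e /h [d d0 H].
rewrite near_withinE; exists d => //= k /=; rewrite sub0r normrN => kd k0.
rewrite distrC -[k^-1 *: _]/(k^-1 * _) -[k *: 1]/(k * 1) mulr1 (addrC k).
have := H _ kd; rewrite -ler_pdivrMr ?normr_gt0// -normf_div.
by rewrite mulrBl mulfK// mulrC.
Qed.

Definition cder (F : R -> C) (x : R) (l : C) :=
  is_derive x 1 (fun t => re (F t)) (re l) /\
  is_derive x 1 (fun t => im (F t)) (im l).

Lemma cder_epsP (F : R -> C) x l :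
  cder F x l <->
  forall e, 0 < e -> exists2 d, 0 < d &
    forall h, `|h| < d -> cabs (F (x + h) - F x - l * ofR h) <= e * `|h|.
Proof.
split=> [[/is_derive_epsP dr /is_derive_epsP di] e e0|H].
  have e20 : 0 < e / 2 by rewrite divr_gt0.
  have [d1 d10 H1] := dr _ e20; have [d2 d20 H2] := di _ e20.
  exists (Num.min d1 d2); first by rewrite lt_min d10.
  move=> h; rewrite lt_min => /andP[/H1 h1 /H2 h2].
  rewrite (le_trans (cabs_le_reim _))// !reimE !mulr0 subr0 add0r.
  by rewrite (splitr e) mulrDl lerD.
split; apply/is_derive_epsP => e /H[d d0 {}H]; exists d => // h /H; apply: le_trans.
  by rewrite (le_trans _ (re_le_cabs _))// !reimE mulr0 subr0.
by rewrite (le_trans _ (im_le_cabs _))// !reimE mulr0 add0r.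
Qed.

Lemma cder_eq (F : R -> C) x l l' : cder F x l -> l = l' -> cder F x l'.
Proof. by move=> + <-. Qed.

Lemma cder_ext (F G : R -> C) x l : F =1 G -> cder F x l -> cder G x l.
Proof. by move=> /funext ->. Qed.

Lemma cder_cst (c : C) x : cder (fun=> c) x 0.
Proof. by split; exact: is_derive_cst. Qed.

Lemma cderD (F G : R -> C) x l m :
  cder F x l -> cder G x m -> cder (fun t => F t + G t) x (l + m).
Proof.
move=> [Fr Fi] [Gr Gi]; split; rewrite reimE;
 under eq_fun do rewrite reimE; exact: is_deriveD.
Qed.

Lemma cderM (F G : R -> C) x l m : cder F x l -> cder G x m ->
  cder (fun t => F t * G t) x (l * G x + F x * m).
Proof.
move=> [Fr Fi] [Gr Gi]; split; under eq_fun do rewrite reimE.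
  have H := is_deriveB (is_deriveM Fr Gr) (is_deriveM Fi Gi).
  by apply: (is_derive_eq H); rewrite !reimE /GRing.scale/=; ring.
have H := is_deriveD (is_deriveM Fr Gi) (is_deriveM Fi Gr).
by apply: (is_derive_eq H); rewrite !reimE /GRing.scale/=; ring.
Qed.

Lemma cderZ (c : C) (F : R -> C) x l :
  cder F x l -> cder (fun t => c * F t) x (c * l).
Proof.
by move=> dF; apply: cder_eq (cderM (cder_cst c x) dF) _; rewrite mul0r add0r.
Qed.

Lemma cderB (F G : R -> C) x l m :
  cder F x l -> cder G x m -> cder (fun t => F t - G t) x (l - m).
Proof.
move=> dF dG; rewrite -[- m]mulN1r.
by apply: cder_ext (cderD dF (cderZ (-1) dG)) => t; rewrite mulN1r.
Qed.

Lemma cder_sum (n : nat) (F : nat -> R -> C) x (l : nat -> C) :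
  (forall i, (i < n)%N -> cder (F i) x (l i)) ->
  cder (fun t => \sum_(i < n) F i t) x (\sum_(i < n) l i).
Proof.
elim: n => [|n ih] H.
  rewrite big_ord0; apply: cder_ext (cder_cst 0 x) => t; by rewrite big_ord0.
rewrite big_ord_recr /=.
apply: cder_ext (cderD (ih _) (H n (ltnSn n))); last first.
  by move=> i /ltnW; exact: H.
by move=> t; rewrite big_ord_recr.
Qed.

Lemma cder_ofR (f : R -> R) (x l : R) : is_derive x 1 f l -> cder (fun t => ofR (f t)) x (ofR l).
Proof. by move=> H; split => //=; exact: is_derive_cst. Qed.

Lemma cder_dir (f : R -> R) (x l : R) : is_derive x 1 f l ->
  cder (fun t => dir (f t)) x (Complex 0 l * dir (f x)).
Proof.
move=> H; split.
  apply: (@is_derive_eq _ _ _ (cos \o f)).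
  by rewrite !reimE /=; ring.
apply: (@is_derive_eq _ _ _ (sin \o f)).
by rewrite !reimE /=; ring.
Qed.

Lemma cder_cexp (F : R -> C) x l : cder F x l ->
  cder (fun t => cexp (F t)) x (l * cexp (F x)).
Proof.
move=> [Fr Fi]; have He : is_derive x 1 (expR \o (fun t => re (F t))) (re l * expR (re (F x))).
  by apply: is_derive_eq; rewrite mulrC.
apply: cder_eq (cderM (cder_ofR He) (cder_dir Fi)) _.
by rewrite cexpE ofRM; apply: complexP; rewrite !reimE /=; ring.
Qed.

Lemma cder_continuous (F : R -> C) x l : cder F x l ->
  {for x, continuous (fun t => re (F t))} /\ {for x, continuous (fun t => im (F t))}.
Proof.
by move=> [[/derivable1_diffP/differentiable_continuous ? _]
           [/derivable1_diffP/differentiable_continuous ? _]].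
Qed.

(** A complex-valued function has no exact intermediate point, so [F] is projected on the direction
    [D = F b - F a]: the real mean value theorem is applied to [|D| E - Re (conj D * F)], whose
    derivative is nonnegative. The majorant is a function [E] rather than a constant in order to
    integrate exponential bounds. *)
Lemma cder_le (a b : R) (F f : R -> C) (E e : R -> R) : a <= b ->
  (forall x, a <= x <= b -> cder F x (f x)) ->
  (forall x, a <= x <= b -> is_derive x 1 E (e x)) ->
  (forall x, a <= x <= b -> cabs (f x) <= e x) ->
  cabs (F b - F a) <= E b - E a.
Proof.
move=> ab dF dE fe; have [-> //|] := eqVneq a b; first by rewrite !subrr cabs0.
move=> aneb; set D := F b - F a.
pose u := re D; pose v := im D; pose N := cabs D.
have N0 : 0 <= N by exact: cabs_ge0.
(* For [D = 0] the projection says nothing; it remains that [E] does not decrease, because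
   [0 <= cabs (f x) <= e x]. *)
have [NN0|NN0] := eqVneq N 0.
  rewrite -/N NN0.
  have [c] := MVT_segment ab (fun x xab => dE x (subset_itv_oo_cc xab))
    (@derivable_within_continuous _ _ E `[a, b] (fun x xab => @ex_derive _ _ _ _ _ _ _ (dE x xab))).
  rewrite in_itv/= => cab ->; rewrite mulr_ge0 ?subr_ge0//.
  by apply: le_trans (fe _ cab).
pose G x := N * E x - (u * re (F x) + v * im (F x)).
pose g x := N * e x - (u * re (f x) + v * im (f x)).
have dG x : a <= x <= b -> is_derive x 1 G (g x).
  move=> xab; have [Fr Fi] := dF _ xab; have Ex := dE _ xab.
  have H := is_deriveB (is_deriveZ N Ex) (is_deriveD (is_deriveZ u Fr) (is_deriveZ v Fi)).
  exact: H.
have [c] := MVT_segment ab (fun x xab => dG x (subset_itv_oo_cc xab))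
    (@derivable_within_continuous _ _ G `[a, b] (fun x xab => @ex_derive _ _ _ _ _ _ _ (dG x xab))).
rewrite in_itv/= => cab GE.
have : 0 <= g c.
  have : N * cabs (f c) <= N * e c by rewrite ler_wpM2l// fe.
  rewrite /g subr_ge0; apply: le_trans.
  pose w : C := Complex u (- v) * f c.
  have <- : re w = u * re (f c) + v * im (f c) by rewrite /w reM /=; ring.
  rewrite (le_trans (ge_re_cabs _))// /w cabsM ler_wpM2r//.
  by rewrite /N !cabsE /= sqrrN.
move=> g0; have : 0 <= G b - G a by rewrite GE mulr_ge0// subr_ge0.
rewrite /G; have -> : N * E b - (u * re (F b) + v * im (F b)) - (N * E a - (u * re (F a) + v * im (F a)))
  = N * (E b - E a) - (u * u + v * v).
  by rewrite /u /v /D !reimE; ring.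
have -> : u * u + v * v = N * N by rewrite -!expr2 /N cabs2.
by rewrite -mulrBr pmulr_rge0 ?subr_ge0// lt_def NN0.
Qed.

Lemma cder_le_cst (a b M : R) (F f : R -> C) : a <= b ->
  (forall x, a <= x <= b -> cder F x (f x)) ->
  (forall x, a <= x <= b -> cabs (f x) <= M) ->
  cabs (F b - F a) <= M * (b - a).
Proof.
move=> ab dF fM; rewrite mulrBr.
apply: (@cder_le a b F f (fun x => M * x) (fun=> M)) => // x xab.
by have := is_deriveZ M (is_derive_id x (1 : R)); rewrite [M *: 1]mulr1.
Qed.

Lemma cder_uniq (a b : R) (F G f : R -> C) : a <= b ->
  (forall x, a <= x <= b -> cder F x (f x)) ->
  (forall x, a <= x <= b -> cder G x (f x)) ->
  F b - F a = G b - G a.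
Proof.
move=> ab dF dG; apply/eqP; rewrite -subr_eq0 -cabs_eq0 eq_le cabs_ge0 andbT.
have := @cder_le_cst a b 0 (fun t => F t - G t) (fun=> 0) ab.
rewrite mul0r => H; rewrite (le_trans _ (H _ _))//.
- by rewrite le_eqVlt; apply/orP; left; apply/eqP; congr cabs; ring.
- by move=> x xab; have := cderB (dF _ xab) (dG _ xab); rewrite subrr.
- by move=> x _; rewrite cabs0.
Qed.

Lemma antiderivative_real (a b : R) (f : R -> R) : a < b ->
  (forall x, a <= x <= b -> {for x, continuous f}) ->
  exists F, forall x, a < x < b -> is_derive x 1 F (f x).
Proof.
move=> ab cf; exists (fun x => \int[lebesgue_measure]_(t in `[a, x]) f t).
move=> x /andP[ax xb].
have intf : lebesgue_measure.-integrable `[a, b] (EFin \o f).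
  apply: continuous_compact_integrable; first exact: segment_compact.
  apply: continuous_in_subspaceT => y; rewrite inE/= in_itv/=; exact: cf.
have cfx : {for x, continuous f} by apply: cf; rewrite !ltW.
have [dF FE] := continuous_FTC1_closed xb intf ax cfx.
by move: FE; rewrite derive1E => FE; apply: DeriveDef.
Qed.

Lemma antiderivative (a b : R) (f : R -> C) : a < b ->
  (forall x, a <= x <= b -> {for x, continuous (fun t => re (f t))}) ->
  (forall x, a <= x <= b -> {for x, continuous (fun t => im (f t))}) ->
  exists F, forall x, a < x < b -> cder F x (f x).
Proof.
move=> ab /(antiderivative_real ab)[F HF] /(antiderivative_real ab)[G HG].
exists (fun x => Complex (F x) (G x)) => x xab.
by split; [exact: HF|exact: HG].
Qed.

End RealVariable.

(** * Goursat's theorem and Taylor expansions *)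

Section Goursat.
Variable R : realType.
Local Notation C := (CC R).
Local Notation I := (Complex 0 1 : C).

Definition ccont (g : C -> C) (z : C) := forall e : R, 0 < e -> exists2 d, 0 < d &
  forall w, cabs (w - z) < d -> cabs (g w - g z) <= e.

Definition cdiff (g : C -> C) (z l : C) := forall e : R, 0 < e -> exists2 d, 0 < d &
  forall w, cabs (w - z) < d -> cabs (g w - g z - l * (w - z)) <= e * cabs (w - z).

Lemma cdiff_cont g z l : cdiff g z l -> ccont g z.
Proof.
move=> H e e0; have [d d0 Hd] := H 1 ltr01.
pose K := 1 + cabs l; have K0 : 0 < K by rewrite ltr_wpDr.
exists (Num.min d (e / K)); first by rewrite lt_min d0 divr_gt0.
move=> w; rewrite lt_min => /andP[/Hd h1 h2].
have -> : g w - g z = (g w - g z - l * (w - z)) + l * (w - z) by ring.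
rewrite (le_trans (cabsD _ _))// (le_trans (lerD h1 (lexx _)))//.
by rewrite cabsM -mulrDl mulrC -ler_pdivlMr// ltW.
Qed.

Lemma cder_re y x : cder (fun t => Complex t y : C) x 1.
Proof.
by split; rewrite /=; [exact: is_derive_id|exact: is_derive_cst].
Qed.

Lemma cder_im y x : cder (fun t => Complex x t : C) y I.
Proof.
by split; rewrite /=; [exact: is_derive_cst|exact: is_derive_id].
Qed.

(** Affine functions have a primitive in the complex sense, which is why their integral over a
    rectangle vanishes and why a first-order approximation of [g] suffices in Goursat's argument. *)
Lemma cder_quadratic (al be z0 : C) (z : R -> C) t l : cder z t l ->
  cder (fun t => al * z t + be * 2^-1 * ((z t - z0) * (z t - z0))) t
    (l * (al + be * (z t - z0))).
Proof.
move=> dz.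
have dz0 := cderB dz (cder_cst z0 t).
apply: cder_eq (cderD (cderZ al dz) (cderZ (be * 2^-1) (cderM dz0 dz0))) _.
rewrite subr0 -[LHS]/(al * l + be * 2^-1 * (l * (z t - z0) + (z t - z0) * l)).
by field.
Qed.

(* The boundary integral of g over the rectangle [a, b] x [c, d], in terms of
   antiderivatives [H y] and [V x] of g along horizontal and vertical lines. *)
Definition rect_int (H V : R -> R -> C) (a b c d : R) : C :=
  H c b - H c a - (H d b - H d a) + I * ((V b d - V b c) - (V a d - V a c)).

Variables (g : C -> C) (H V : R -> R -> C) (a0 b0 c0 d0 : R).
Hypothesis dH : forall x y, a0 <= x <= b0 -> c0 <= y <= d0 ->
  cder (H y) x (g (Complex x y)).
Hypothesis dV : forall x y, a0 <= x <= b0 -> c0 <= y <= d0 ->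
  cder (V x) y (g (Complex x y)).

(** The affine function contributes nothing, since the increments of its primitive [P] cancel around
    the rectangle; each side then contributes at most [M] times its length. *)
Lemma rect_int_le (a b c d : R) (al be z0 : C) (M : R) :
  a0 <= a -> a <= b -> b <= b0 -> c0 <= c -> c <= d -> d <= d0 ->
  (forall x y, a <= x <= b -> c <= y <= d ->
    cabs (g (Complex x y) - (al + be * (Complex x y - z0))) <= M) ->
  cabs (rect_int H V a b c d) <= 2 * M * ((b - a) + (d - c)).
Proof.
move=> a0a ab bb0 c0c cd dd0 gM.
pose P z : C := al * z + be * 2^-1 * ((z - z0) * (z - z0)).
have hor y : c <= y <= d ->
   cabs ((H y b - P (Complex b y)) - (H y a - P (Complex a y))) <= M * (b - a).
  move=> ycd; have ycd0 : c0 <= y <= d0 by lra.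
  apply: (@cder_le_cst _ _ _ _ (fun x => H y x - P (Complex x y)) _ ab) => x xab.
    have xab0 : a0 <= x <= b0 by lra.
    exact: cderB (dH xab0 ycd0) (cder_quadratic al be z0 (cder_re y x)).
  by rewrite /= mul1r; exact: gM.
(* [V x] is a primitive with respect to the real ordinate, along which [P] picks up a factor [I];
   hence the [- I], compensated by the [I] before the vertical sides in [rect_int]. *)
have ver x : a <= x <= b ->
   cabs ((V x d - (- I) * P (Complex x d)) - (V x c - (- I) * P (Complex x c))) <= M * (d - c).
  move=> xab; have xab0 : a0 <= x <= b0 by lra.
  apply: (@cder_le_cst _ _ _ _ (fun y => V x y - (- I) * P (Complex x y)) _ cd) => y ycd.
    have ycd0 : c0 <= y <= d0 by lra.
    exact: cderB (dV xab0 ycd0) (cderZ (- I) (cder_quadratic al be z0 (cder_im y x))).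
  rewrite /=; have -> : - I * (I * (al + be * (Complex x y - z0))) = al + be * (Complex x y - z0).
    rewrite mulrA; have -> : - I * I = 1 by apply: complexP; rewrite !reimE /=; ring.
    by rewrite mul1r.
  exact: gM.
have II : I * I = -1 by apply: complexP; rewrite !reimE /=; ring.
pose E1 := (H c b - P (Complex b c)) - (H c a - P (Complex a c)).
pose E2 := (H d b - P (Complex b d)) - (H d a - P (Complex a d)).
pose E3 := (V b d - (- I) * P (Complex b d)) - (V b c - (- I) * P (Complex b c)).
pose E4 := (V a d - (- I) * P (Complex a d)) - (V a c - (- I) * P (Complex a c)).
have -> : rect_int H V a b c d = (E1 - E2) + I * (E3 - E4).
  rewrite /rect_int /E1 /E2 /E3 /E4.
  set p1 := P _; set p2 := P _; set p3 := P _; set p4 := P _; set J := I.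
  have JJ : J * J = -1 by [].
  by apply/eqP; rewrite -subr_eq0; apply/eqP; ring: JJ.
rewrite (le_trans (cabsD _ _))// cabsM.
have -> : cabs I = 1 by rewrite cabsE /re /im /= expr0n add0r expr1n sqrtr1.
have h1 : cabs (E1 - E2) <= M * (b - a) + M * (b - a).
  by rewrite (le_trans (cabsB _ _))// lerD//; apply: hor; rewrite lexx ?cd ?andbT.
have h2 : cabs (E3 - E4) <= M * (d - c) + M * (d - c).
  by rewrite (le_trans (cabsB _ _))// lerD//; apply: ver; rewrite lexx ?ab ?andbT.
by rewrite mul1r; lra.
Qed.

Lemma rect_int_split (a m b c n d : R) : rect_int H V a b c d =
  rect_int H V a m c n + rect_int H V m b c n +
  rect_int H V a m n d + rect_int H V m b n d.
Proof. by rewrite /rect_int; ring. Qed.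

(** Quadrisection: some quarter carries at least a quarter of the integral, while at the limit point
    the affine approximation bounds the integral by a small multiple of the squared size of the
    rectangle, which is also divided by 4 at each step. *)
Lemma goursat_diff (a b c d : R) :
  a0 <= a -> a <= b -> b <= b0 -> c0 <= c -> c <= d -> d <= d0 ->
  (forall x y, a <= x <= b -> c <= y <= d -> exists l, cdiff g (Complex x y) l) ->
  rect_int H V a b c d = 0.
Proof.
move=> a0a ab bb0 c0c cd dd0 dg.
apply/eqP; rewrite -cabs_eq0; apply/negP => /negP I0.
set eta := cabs _ in I0.
have eta0 : 0 < eta by rewrite lt_def I0 cabs_ge0.
pose w := b - a; pose h := d - c.
pose J n (s : R * R) := cabs (rect_int H V s.1 (s.1 + w / 2 ^+ n) s.2 (s.2 + h / 2 ^+ n)).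
have w0 : 0 <= w by rewrite subr_ge0.
have h0 : 0 <= h by rewrite subr_ge0.
have half (u : R) n : u / 2 ^+ n.+1 + u / 2 ^+ n.+1 = u / 2 ^+ n.
  by rewrite exprS; field; rewrite expf_neq0.
have step (ns : nat * (R * R)) : exists s' : R * R,
  [/\ J ns.1 ns.2 <= 4 * J ns.1.+1 s',
      ns.2.1 <= s'.1 <= ns.2.1 + w / 2 ^+ ns.1.+1 &
      ns.2.2 <= s'.2 <= ns.2.2 + h / 2 ^+ ns.1.+1].
  case: ns => n [u v] /=.
  have wn : 0 <= w / 2 ^+ n.+1 by rewrite divr_ge0// exprn_ge0.
  have hn : 0 <= h / 2 ^+ n.+1 by rewrite divr_ge0// exprn_ge0.
  have := erefl (J n (u, v)); rewrite {1}/J /=.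
  rewrite (@rect_int_split u (u + w / 2 ^+ n.+1) _ v (v + h / 2 ^+ n.+1)).
  rewrite -(half w n) -(half h n) (addrA u) (addrA v) => E.
  pose x1 := J n.+1 (u, v); pose x2 := J n.+1 (u + w / 2 ^+ n.+1, v).
  pose x3 := J n.+1 (u, v + h / 2 ^+ n.+1).
  pose x4 := J n.+1 (u + w / 2 ^+ n.+1, v + h / 2 ^+ n.+1).
  have {E} : J n (u, v) <= x1 + x2 + x3 + x4.
    rewrite -E; do 3 (apply: (le_trans (cabsD _ _)); apply: lerD; last exact: lexx).
    exact: lexx.
  move=> le4; have [l1|g1] := leP (J n (u, v)) (4 * x1).
    by exists (u, v); split=> //=; apply/andP; split; lra.
  have [l2|g2] := leP (J n (u, v)) (4 * x2).
    by exists (u + w / 2 ^+ n.+1, v); split=> //=; apply/andP; split; lra.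
  have [l3|g3] := leP (J n (u, v)) (4 * x3).
    by exists (u, v + h / 2 ^+ n.+1); split=> //=; apply/andP; split; lra.
  exists (u + w / 2 ^+ n.+1, v + h / 2 ^+ n.+1); split=> /=.
  - by rewrite -/x4; lra.
  - by apply/andP; split; lra.
  - by apply/andP; split; lra.
have [f fP] := choice step.
pose s := fix s n := if n is m.+1 then f (m, s m) else (a, c).
have sP n : [/\ J n (s n) <= 4 * J n.+1 (s n.+1),
    (s n).1 <= (s n.+1).1 <= (s n).1 + w / 2 ^+ n.+1 &
    (s n).2 <= (s n.+1).2 <= (s n).2 + h / 2 ^+ n.+1] := fP (n, s n).
have Jn n : eta <= 4 ^+ n * J n (s n).
  elim: n => [|n ih].
    rewrite expr0 mul1r /J /= expr0 !divr1 /w /h.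
    by rewrite (_ : a + (b - a) = b) 1?(_ : c + (d - c) = d)//; ring.
  rewrite (le_trans ih)// exprS -mulrA mulrCA ler_wpM2l ?exprn_ge0//.
  by case: (sP n).
have nested (u : R) (t : nat -> R) :
   (forall n, t n <= t n.+1 <= t n + u / 2 ^+ n.+1) ->
   exists x, forall n, t n <= x <= t n + u / 2 ^+ n.
  move=> tP.
  have incr n m : t n <= t (n + m)%N.
    by elim: m => [|m ih]; rewrite ?addn0// addnS (le_trans ih)//; case/andP: (tP (n + m)%N).
  have decr n m : t (n + m)%N + u / 2 ^+ (n + m) <= t n + u / 2 ^+ n.
    elim: m => [|m ih]; first by rewrite addn0.
    apply: le_trans ih; rewrite addnS -[in leRHS](half u (n + m)%N) addrA lerD2r.
    by case/andP: (tP (n + m)%N).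
  have u0 : 0 <= u by case/andP: (tP 0%N) => *; have := half u 0%N; rewrite expr0; lra.
  have un n : 0 <= u / 2 ^+ n by rewrite divr_ge0// exprn_ge0.
  have bd n m : t m <= t n + u / 2 ^+ n.
    have := incr m n; have := decr n m; have := un (n + m)%N.
    by rewrite (addnC m); lra.
  exists (sup (range t)) => n; apply/andP; split.
    apply: ub_le_sup; last by exists n.
    by exists (t 0%N + u / 2 ^+ 0) => _ [m _ <-].
  apply: ge_sup; first by exists (t 0%N), 0%N.
  by move=> _ [m _ <-].
have [x xP] := nested w (fun n => (s n).1) (fun n => let: And3 _ p _ := sP n in p).
have [y yP] := nested h (fun n => (s n).2) (fun n => let: And3 _ _ p := sP n in p).
have inw n : a <= (s n).1 /\ (s n).1 + w / 2 ^+ n <= b.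
  elim: n => [|n [h1 h2]]; first by rewrite /= expr0 divr1 /w; lra.
  by case: (sP n) => _ /andP[p q] _; have := half w n; lra.
have inh n : c <= (s n).2 /\ (s n).2 + h / 2 ^+ n <= d.
  elim: n => [|n [h1 h2]]; first by rewrite /= expr0 divr1 /h; lra.
  by case: (sP n) => _ _ /andP[p q]; have := half h n; lra.
have xab : a <= x <= b by case: (inw 0%N); case/andP: (xP 0%N) => *; apply/andP; split; lra.
have ycd : c <= y <= d by case: (inh 0%N); case/andP: (yP 0%N) => *; apply/andP; split; lra.
have [l dl] := dg x y xab ycd.
pose L := w + h.
have L0 : 0 <= L by rewrite addr_ge0.
(* At scale [n] the integral will be at most [2 e L^2 / 4^n], and this [e] makes [2 e L^2 < eta].
   The 1 covers the degenerate case [L = 0]. *)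
pose e := eta / (2 * L ^+ 2 + 1) / 2.
have De : 0 < 2 * L ^+ 2 + 1 by rewrite ltr_wpDl// mulr_ge0// sqr_ge0.
have e0 : 0 < e by rewrite !divr_gt0.
have [dlt dlt0 Hd] := dl e e0.
have [n Hn] : exists n, L / 2 ^+ n < dlt.
  have Ld : 0 <= L / dlt by rewrite divr_ge0// ltW.
  exists (Num.bound (L / dlt)); rewrite ltr_pdivrMr ?exprn_gt0// mulrC -ltr_pdivrMr//.
  rewrite (lt_le_trans (archi_boundP Ld))// -natrX ler_nat ltnW//.
  exact: ltn_expl.
have q0 : (0 : R) < 2 ^+ n by rewrite exprn_gt0.
have [wn1 wn2] := inw n; have [hn1 hn2] := inh n.
have wn : 0 <= w / 2 ^+ n by rewrite divr_ge0// ltW.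
have hn : 0 <= h / 2 ^+ n by rewrite divr_ge0// ltW.
have : J n (s n) <= 2 * (e * (L / 2 ^+ n)) * (L / 2 ^+ n).
  rewrite /J; have := @rect_int_le (s n).1 ((s n).1 + w / 2 ^+ n) (s n).2 ((s n).2 + h / 2 ^+ n)
    (g (Complex x y)) l (Complex x y) (e * (L / 2 ^+ n)).
  have -> : (s n).1 + w / 2 ^+ n - (s n).1 + ((s n).2 + h / 2 ^+ n - (s n).2) = L / 2 ^+ n.
    by rewrite /L; ring.
  apply; try lra.
  move=> x1 y1 x1P y1P.
  have dist : cabs (Complex x1 y1 - Complex x y : C) <= L / 2 ^+ n.
    rewrite (le_trans (cabs_le_reim _))// !reimE /= /L mulrDl lerD// ler_norml.
      by have := xP n => /andP[? ?]; apply/andP; split; lra.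
    by have := yP n => /andP[? ?]; apply/andP; split; lra.
  rewrite opprD addrA (le_trans (Hd _ _))//; first by rewrite (le_lt_trans dist).
  by rewrite ler_wpM2l// ltW.
move=> Jle; have := Jn n; have : 4 ^+ n * J n (s n) <= 2 * e * L ^+ 2.
  have -> : 2 * e * L ^+ 2 = 4 ^+ n * (2 * (e * (L / 2 ^+ n)) * (L / 2 ^+ n)).
    rewrite (_ : 4 = 2 * 2 :> R) ?exprMn; last by ring.
    by field; rewrite gt_eqF.
  by rewrite ler_wpM2l// exprn_ge0.
have : 2 * e * L ^+ 2 < eta; last by lra.
have -> : 2 * e * L ^+ 2 = eta * (L ^+ 2 / (2 * L ^+ 2 + 1)).
  by rewrite /e; field; rewrite gt_eqF.
rewrite gtr_pMr// ltr_pdivrMr// mul1r.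
by have := sqr_ge0 L; lra.
Qed.

(** Used to cut a rectangle around the exceptional point. The last clause says that a strip of
    nonzero width is cut off only if it misses this point; otherwise the strip is degenerate and its
    integral is 0. *)
Lemma shrink_left (u z r : R) : u <= z -> 0 < r ->
  [/\ u <= Num.max u (z - r), z - r <= Num.max u (z - r), Num.max u (z - r) <= z &
      (u < Num.max u (z - r) -> Num.max u (z - r) < z)].
Proof. by move=> uz r0; case: (leP u (z - r)) => ?; split=> [|||?]; lra. Qed.

Lemma shrink_right (u z r : R) : z <= u -> 0 < r ->
  [/\ Num.min u (z + r) <= u, Num.min u (z + r) <= z + r, z <= Num.min u (z + r) &
      (Num.min u (z + r) < u -> z < Num.min u (z + r))].
Proof. by move=> uz r0; case: (leP u (z + r)) => ?; split=> [|||?]; lra. Qed.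

(* The rectangles that contain the exceptional point are shrunk to it. *)
Lemma goursat (a b c d : R) (z1 : C) :
  a0 <= a -> a <= b -> b <= b0 -> c0 <= c -> c <= d -> d <= d0 ->
  (forall x y, a <= x <= b -> c <= y <= d -> ccont g (Complex x y)) ->
  (forall x y, a <= x <= b -> c <= y <= d -> Complex x y <> z1 ->
     exists l, cdiff g (Complex x y) l) ->
  rect_int H V a b c d = 0.
Proof.
move=> a0a ab bb0 c0c cd dd0 cg dg.
case: (pselect (a <= re z1 <= b /\ c <= im z1 <= d)) => [[z1ab z1cd]|nin]; last first.
  apply: goursat_diff => // x y xab ycd; apply: dg => //.
  by move=> E; apply: nin; rewrite -E.
have [[z1a z1b] [z1c z1d]] := (andP z1ab, andP z1cd).
have z1E : z1 = Complex (re z1) (im z1) by apply: complexP.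
have [dlt dlt0 Hd] := cg _ _ z1ab z1cd 1 ltr01.
apply: cabs_eq => eps eps0; rewrite subr0.
pose M := cabs (g z1) + 1.
have M0 : 0 < M by rewrite ltr_wpDl.
(* [dlt / 4] keeps the inner rectangle in the disc where [|g| <= M]; its two side lengths add up to
   at most [4 r], so [rect_int_le] gives at most [8 M r <= eps]. *)
pose r := Num.min (dlt / 4) (eps / (8 * M)).
have r0 : 0 < r by rewrite lt_min !divr_gt0// mulr_gt0.
have rd : r <= dlt / 4 by rewrite /r ge_min lexx.
have re8 : r * (8 * M) <= eps by rewrite -ler_pdivlMr ?mulr_gt0// /r ge_min lexx orbT.
pose m1 := Num.max a (re z1 - r); pose m2 := Num.min b (re z1 + r).
pose n1 := Num.max c (im z1 - r); pose n2 := Num.min d (im z1 + r).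
have [m1a m1r m1z m1l] : [/\ a <= m1, re z1 - r <= m1, m1 <= re z1 & (a < m1 -> m1 < re z1)].
  exact: shrink_left z1a r0.
have [m2b m2r m2z m2l] : [/\ m2 <= b, m2 <= re z1 + r, re z1 <= m2 & (m2 < b -> re z1 < m2)].
  exact: shrink_right z1b r0.
have [n1c n1r n1z n1l] : [/\ c <= n1, im z1 - r <= n1, n1 <= im z1 & (c < n1 -> n1 < im z1)].
  exact: shrink_left z1c r0.
have [n2d n2r n2z n2l] : [/\ n2 <= d, n2 <= im z1 + r, im z1 <= n2 & (n2 < d -> im z1 < n2)].
  exact: shrink_right z1d r0.
have m12 := le_trans m1z m2z; have n12 := le_trans n1z n2z.
have am2 := le_trans m1a m12; have m1b := le_trans m12 m2b.
have cn2 := le_trans n1c n12; have n1d := le_trans n12 n2d.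
have good a' b' c' d' : a <= a' -> a' <= b' -> b' <= b -> c <= c' -> c' <= d' -> d' <= d ->
   ~ (a' <= re z1 <= b' /\ c' <= im z1 <= d') -> rect_int H V a' b' c' d' = 0.
  move=> aa' a'b' b'b cc' c'd' d'd nin.
  apply: goursat_diff; rewrite ?(le_trans a0a) ?(le_trans b'b) ?(le_trans c0c) ?(le_trans d'd)//.
  move=> x y /andP[a'x xb'] /andP[c'y yd']; apply: dg.
  - by rewrite (le_trans aa')// (le_trans xb').
  - by rewrite (le_trans cc')// (le_trans yd').
  by move=> E; apply: nin; rewrite -E /= a'x xb' c'y yd'.
have degh a' c' d' : rect_int H V a' a' c' d' = 0 by rewrite /rect_int; ring.
have degv a' b' c' : rect_int H V a' b' c' c' = 0 by rewrite /rect_int; ring.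
have S1 : rect_int H V a m1 c d = 0.
  have [<-|?] := eqVneq a m1; first exact: degh.
  have alt : a < m1 by rewrite lt_def eq_sym; apply/andP.
  apply: good => // -[/andP[_ h] _]; by move: (m1l alt); rewrite ltNge h.
have S2 : rect_int H V m2 b c d = 0.
  have [<-|?] := eqVneq m2 b; first exact: degh.
  have alt : m2 < b by rewrite lt_def eq_sym; apply/andP.
  apply: good => // -[/andP[h _] _]; by move: (m2l alt); rewrite ltNge h.
have S3 : rect_int H V m1 m2 c n1 = 0.
  have [<-|?] := eqVneq c n1; first exact: degv.
  have alt : c < n1 by rewrite lt_def eq_sym; apply/andP.
  apply: good => // -[_ /andP[_ h]]; by move: (n1l alt); rewrite ltNge h.
have S4 : rect_int H V m1 m2 n2 d = 0.
  have [<-|?] := eqVneq n2 d; first exact: degv.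
  have alt : n2 < d by rewrite lt_def eq_sym; apply/andP.
  apply: good => // -[_ /andP[h _]]; by move: (n2l alt); rewrite ltNge h.
have -> : rect_int H V a b c d = rect_int H V a m1 c d + rect_int H V m2 b c d +
   rect_int H V m1 m2 c n1 + rect_int H V m1 m2 n2 d + rect_int H V m1 m2 n1 n2.
  by rewrite /rect_int; ring.
rewrite S1 S2 S3 S4 4!add0r.
have := @rect_int_le m1 m2 n1 n2 0 0 0 M.
have hlen : 2 * M * (m2 - m1 + (n2 - n1)) <= eps.
  apply: le_trans re8; rewrite -subr_ge0.
  have -> : r * (8 * M) - 2 * M * (m2 - m1 + (n2 - n1)) = 2 * M * (4 * r - (m2 - m1 + (n2 - n1))) by ring.
  by rewrite mulr_ge0//; lra.
move=> Hle; apply: le_trans hlen; apply: Hle; try lra.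
move=> x y xab ycd; rewrite mul0r addr0 subr0.
have : cabs (g (Complex x y) - g z1) <= 1.
  rewrite z1E; apply: Hd; rewrite (le_lt_trans (cabs_le_reim _))// !reimE /=.
  have : `|x - re z1| <= r by rewrite ler_norml; lra.
  have : `|y - im z1| <= r by rewrite ler_norml; lra.
  by lra.
have := cabsD (g (Complex x y) - g z1) (g z1); rewrite subrK /M; lra.
Qed.

End Goursat.

(** * Complex derivatives and the exponential *)

Section ComplexDerivative.
Variable R : realType.
Local Notation C := (CC R).
Implicit Types (f g : C -> C) (z w l m : C).

Lemma ltC_ofR (x y : R) : (ofR x < ofR y :> C) = (x < y).
Proof. by rewrite ltcE /= eqxx. Qed.

Lemma leC_ofR (x y : R) : (ofR x <= ofR y :> C) = (x <= y).
Proof. by rewrite lecE /= eqxx. Qed.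

Lemma gt0C (e : C) : 0 < e -> e = ofR (re e) /\ 0 < re e.
Proof.
rewrite ltcE /= => /andP[/eqP i0 r0]; split=> //.
by apply: complexP.
Qed.

Lemma cdiffP g z l : cdiff g z l <-> is_derive (z : C^o) 1 (g : C^o -> C^o) l.
Proof.
split=> [h|[df dE] e e0].
  suff H : (fun k : C^o => k^-1 *: ((g : C^o -> C^o) (k *: 1 + z) - g z)) @ 0^' --> (l : C^o).
    by split; [apply/cvg_ex; exists l|apply/cvg_lim].
  apply/cvgrPdist_le => e e0; have [-> r0] := gt0C e0; have [d d0 H] := h _ r0.
  rewrite near_withinE; exists (ofR d) => /=; first by rewrite ltC_ofR.
  move=> k /=; rewrite sub0r normrN normC_cabs ltC_ofR => kd k0.
  rewrite distrC -[k^-1 *: _]/(k^-1 * _) -[k *: 1]/(k * 1) mulr1.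
  have := H (k + z); rewrite addrK => /(_ kd).
  rewrite -[k^-1 * _](@mulfK _ k)//.
  rewrite normC_cabs leC_ofR -ler_pdivrMr ?cabs_gt0// -cabsV -cabsM.
  by rewrite mulrBl mulfK// (mulrC _ k^-1) mulfK.
have : (fun k : C^o => k^-1 *: ((g : C^o -> C^o) (k *: 1 + z) - g z)) @ 0^' --> (l : C^o).
  by rewrite -dE; exact: df.
move=> /cvgrPdist_le /(_ (ofR e)); rewrite ltC_ofR => /(_ e0).
rewrite near_withinE => -[d /= dC H]; have [dE' d0] := gt0C dC; rewrite dE' in H.
exists (re d); first by [].
move=> w wd; have [->|wz] := eqVneq w z.
  by rewrite !subrr mulr0 subrr cabs0 mulr0.
have := H (w - z); rewrite /= sub0r normrN normC_cabs ltC_ofR subr_eq0 => /(_ wd wz).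
have k0 : w - z != 0 by rewrite subr_eq0.
rewrite distrC -[(w - z)^-1 *: _]/((w - z)^-1 * _) -[(w - z) *: 1]/((w - z) * 1) mulr1 subrK.
rewrite normC_cabs leC_ofR => H1; rewrite -ler_pdivrMr ?cabs_gt0// -cabsV -cabsM.
by rewrite mulrBl mulfK// mulrC.
Qed.

Lemma cdiffM f g z l m : cdiff f z l -> cdiff g z m ->
  cdiff (fun w => f w * g w) z (f z * m + g z * l).
Proof. by move=> /cdiffP h1 /cdiffP h2; apply/cdiffP; exact: is_deriveM. Qed.

Lemma cdiffB f g z l m : cdiff f z l -> cdiff g z m ->
  cdiff (fun w => f w - g w) z (l - m).
Proof. by move=> /cdiffP h1 /cdiffP h2; apply/cdiffP; exact: is_deriveB. Qed.

Lemma cdiff_cst (c z : C) : cdiff (fun=> c) z 0.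
Proof. by apply/cdiffP; exact: is_derive_cst. Qed.

Lemma cdiff_id z : cdiff id z 1.
Proof. by apply/cdiffP; exact: is_derive_id. Qed.

Lemma cdiffV f z l : f z != 0 -> cdiff f z l -> exists m, cdiff (fun w => (f w)^-1) z m.
Proof.
move=> fz /cdiffP[df _]; exists ('D_1 ((fun w => (f w)^-1) : C^o -> C^o) z).
by apply/cdiffP; apply: derivableP; exact: derivableV.
Qed.

Lemma cdiffX f z l n : cdiff f z l -> exists m, cdiff (fun w => f w ^+ n) z m.
Proof.
move=> df; elim: n => [|n [m ih]]; first by exists 0; exact: cdiff_cst.
exists (f z * m + f z ^+ n * l); under eq_fun do rewrite exprS; exact: cdiffM.
Qed.

Lemma cdiff_comp f g z l m : cdiff f z l -> cdiff g (f z) m ->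
  cdiff (g \o f) z (m * l).
Proof.
move=> df dg e e0.
have L0 : 0 < cabs l + 1 by rewrite ltr_wpDl.
have M0 : 0 < cabs m + 1 by rewrite ltr_wpDl.
have [d1 d10 H1] := dg (e / 2 / (cabs l + 1)) (divr_gt0 (divr_gt0 e0 (ltr0n _ 2)) L0).
have [d2 d20 H2] := df (e / 2 / (cabs m + 1)) (divr_gt0 (divr_gt0 e0 (ltr0n _ 2)) M0).
have [d3 d30 H3] := df 1 ltr01.
exists (Num.min (d1 / (cabs l + 1)) (Num.min d2 d3)).
  by rewrite !lt_min d20 d30 divr_gt0.
move=> w; rewrite !lt_min => /and3P[w1 /H2 w2 /H3 w3] /=.
have fw : cabs (f w - f z) <= (cabs l + 1) * cabs (w - z).
  have -> : f w - f z = (f w - f z - l * (w - z)) + l * (w - z) by ring.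
  by rewrite (le_trans (cabsD _ _))// cabsM mulrDl addrC lerD2l.
have fwd : cabs (f w - f z) < d1.
  by rewrite (le_lt_trans fw)// mulrC -ltr_pdivlMr.
have -> : g (f w) - g (f z) - m * l * (w - z) =
  (g (f w) - g (f z) - m * (f w - f z)) + m * (f w - f z - l * (w - z)) by ring.
rewrite (le_trans (cabsD _ _))// (splitr e) mulrDl lerD//.
  rewrite (le_trans (H1 _ fwd))// -mulrA ler_wpM2l//; first by rewrite divr_ge0// ltW.
  by rewrite ler_pdivrMl.
rewrite cabsM (le_trans (ler_wpM2l (cabs_ge0 m) w2))//.
rewrite mulrA ler_wpM2r// mulrCA ler_piMr//; first by rewrite divr_ge0// ltW.
by rewrite ler_pdivrMr// mul1r lerDl.
Qed.

Lemma ccont_comp f g z : ccont f z -> ccont g (f z) -> ccont (g \o f) z.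
Proof.
move=> cf cg e /cg[d d0 H]; have [d' d'0 H'] := cf (d / 2) (divr_gt0 d0 (ltr0n _ 2)).
exists d' => // w /H' w1; apply: H; rewrite (le_lt_trans w1)//.
by rewrite ltr_pdivrMr// ltr_pMr// ltr1n.
Qed.

Lemma ccontM f g z : ccont f z -> ccont g z -> ccont (fun w => f w * g w) z.
Proof.
move=> cf cg e e0.
pose K := cabs (f z) + cabs (g z) + 2.
have K0 : 0 < K by rewrite ltr_wpDl// addr_ge0.
have eK : 0 < Num.min 1 (e / K) by rewrite lt_min ltr01 divr_gt0.
have [d1 d10 H1] := cf _ eK; have [d2 d20 H2] := cg _ eK.
exists (Num.min d1 d2); first by rewrite lt_min d10.
move=> w; rewrite lt_min => /andP[/H1 w1 /H2 w2].
move: w1 w2; rewrite !le_min => /andP[w11 w12] /andP[w21 w22].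
have -> : f w * g w - f z * g z = (f w - f z) * (g w - g z) + (f w - f z) * g z + f z * (g w - g z) by ring.
rewrite !(le_trans (cabsD _ _))//.
have -> : e = e / K * 2 / 2 + e / K * cabs (g z) + cabs (f z) * (e / K) + e / K * 1.
  by rewrite /K; field; rewrite gt_eqF.
rewrite (@le_trans _ _ (e / K * 1 + e / K * cabs (g z) + cabs (f z) * (e / K)))//; last first.
  have : 0 <= e / K by rewrite divr_ge0 ?ltW.
  by lra.
apply: lerD; first apply: (le_trans (cabsD _ _)); first apply: lerD.
- by rewrite cabsM ler_pM.
- by rewrite cabsM ler_wpM2r.
- by rewrite cabsM ler_wpM2l.
Qed.

Lemma ccont_path (g : C -> C) (p : R -> C) (t : R) :
  (forall h, cabs (p (t + h) - p t) <= `|h|) -> ccont g (p t) ->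
  {for t, continuous (fun t => re (g (p t)))} /\
  {for t, continuous (fun t => im (g (p t)))}.
Proof.
move=> lp cg; split; apply/cvgrPdist_le => e /cg[d d0 H]; exists d => //= u /= ud;
  have := lp (u - t); rewrite (addrC t) subrK distrC => ut;
  rewrite distrC; apply: le_trans (H (p u) (le_lt_trans ut ud)).
- by rewrite -reB; exact: re_le_cabs.
- by rewrite -imB; exact: im_le_cabs.
Qed.

Lemma cexp_sub1_le z : cabs (cexp z - 1) <= cabs z * expR (cabs z).
Proof.
have dz (t : R) : cder (fun t => ofR t * z) t z.
  apply: cder_eq (cderM (cder_ofR (is_derive_id _ _)) (cder_cst _ _)) _.
  by rewrite ofR1; ring.
have := @cder_le_cst R 0 1 (cabs z * expR (cabs z)) (fun t => cexp (ofR t * z))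
  (fun t => z * cexp (ofR t * z)) ler01.
rewrite subr0 mulr1 ofR1 ofR0 mul1r mul0r cexp0; apply.
  by move=> x _; exact: cder_cexp (dz x).
move=> x x01; rewrite cabsM ler_wpM2l// cabs_cexp ler_expR.
rewrite (le_trans (ge_re_cabs _))// cabsM cabs_ofR ger0_norm; last by lra.
by rewrite ler_piMl//; lra.
Qed.

Lemma cexp_sub1B_le z : cabs (cexp z - 1 - z) <= cabs z ^+ 2 * expR (cabs z).
Proof.
have dz (t : R) : cder (fun t => ofR t * z) t z.
  apply: cder_eq (cderM (cder_ofR (is_derive_id _ _)) (cder_cst _ _)) _.
  by rewrite ofR1; ring.
have := @cder_le_cst R 0 1 (cabs z ^+ 2 * expR (cabs z)) (fun t => cexp (ofR t * z) - ofR t * z)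
  (fun t => z * cexp (ofR t * z) - z) ler01.
rewrite subr0 mulr1 ofR1 ofR0 mul1r mul0r cexp0 subr0.
rewrite (_ : cexp z - z - 1 = cexp z - 1 - z); last by ring.
apply; first by move=> x _; apply: cderB; [exact: cder_cexp (dz x)|exact: dz].
move=> x x01; rewrite (_ : z * _ - z = z * (cexp (ofR x * z) - 1)); last by ring.
rewrite cabsM expr2 -mulrA ler_wpM2l//.
have xz : cabs (ofR x * z) <= cabs z.
  by rewrite cabsM cabs_ofR ger0_norm ?ler_piMl//; lra.
by rewrite (le_trans (cexp_sub1_le _))// ler_pM ?expR_ge0// ler_expR.
Qed.

Lemma cdiff_cexp z : cdiff (@cexp R) z (cexp z).
Proof.
move=> e e0; pose K := cabs (cexp z) * expR 1 + 1.
have K0 : 0 < K by rewrite ltr_wpDl// mulr_ge0// expR_ge0.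
exists (Num.min 1 (e / K)); first by rewrite lt_min ltr01 divr_gt0.
move=> w; rewrite lt_min => /andP[w1 w2]; set h := w - z.
have -> : cexp w - cexp z - cexp z * h = cexp z * (cexp h - 1 - h).
  by rewrite -[w](subrK z) -/h cexpD; ring.
rewrite cabsM (le_trans (ler_wpM2l (cabs_ge0 _) (cexp_sub1B_le h)))//.
rewrite expr2 -mulrA mulrCA mulrC ler_wpM2r//.
have h1 : cabs h * expR (cabs h) <= cabs h * expR 1 by rewrite ler_wpM2l// ler_expR ltW.
rewrite (le_trans (ler_wpM2l (cabs_ge0 _) h1))// mulrCA.
rewrite (@le_trans _ _ (cabs h * K))//; first by rewrite ler_wpM2l// lerDl.
by rewrite -ler_pdivlMr// ltW.
Qed.

End ComplexDerivative.

(** * Cauchy's theorem on annuli *)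

Section Taylor.
Variable R : realType.
Local Notation C := (CC R).
Local Notation I := (Complex 0 1 : C).

Definition circ (r t : R) : C := ofR r * dir t.

Lemma cabs_circ r t : 0 <= r -> cabs (circ r t) = r.
Proof. by move=> r0; rewrite /circ cabsM cabs_dir mulr1 cabs_ofR ger0_norm. Qed.

Lemma cder_circ r t : cder (circ r) t (I * circ r t).
Proof.
apply: cder_eq (cderZ (ofR r) (cder_dir (is_derive_id t (1 : R)))) _.
by rewrite /circ; ring.
Qed.

Lemma circ_lip (r t h : R) : 0 <= r -> r <= 1 -> cabs (circ r (t + h) - circ r t) <= `|h|.
Proof.
move=> r0 r1.
have bd x : cabs (I * circ r x) <= 1.
  rewrite cabsM cabs_circ// (_ : cabs I = 1) ?mul1r//.
  by rewrite cabsE /re /im /= expr0n add0r expr1n sqrtr1.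
have [h0|h0] := leP 0 h.
  have := @cder_le_cst R t (t + h) 1 (circ r) (fun x => I * circ r x).
  rewrite addrC addrK mul1r ger0_norm//; apply; first by rewrite lerDr.
    by move=> x _; exact: cder_circ.
  by move=> x _; exact: bd.
have := @cder_le_cst R (t + h) t 1 (circ r) (fun x => I * circ r x).
rewrite opprD addrA subrr add0r mul1r ler0_norm ?(ltW h0)// cabsBC; apply.
- by rewrite gerDl ltW.
- by move=> x _; exact: cder_circ.
- by move=> x _; exact: bd.
Qed.

Lemma pi_lt4 : pi < 4 :> R.
Proof. by have := pihalf_lt2 R; lra. Qed.

Lemma circ_antiderivative (g : C -> C) r : 0 < r -> r <= 1 ->
  (forall z, cabs z = r -> ccont g z) ->
  exists F, forall t, - pi <= t <= pi -> cder F t (g (circ r t)).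
Proof.
move=> r0 r1 cg.
have c t := ccont_path (fun h => circ_lip t h (ltW r0) r1) (cg _ (cabs_circ t (ltW r0))).
(* [antiderivative] gives derivatives at interior points only, whence an interval larger than
   [[- pi, pi]]. *)
have [|||F HF] := @antiderivative R (-4) 4 (fun t => g (circ r t)).
- by rewrite gtrN.
- by move=> x _; case: (c x).
- by move=> x _; case: (c x).
by exists F => t tpi; apply: HF; have := pi_lt4; lra.
Qed.

Lemma cexp_polar (x y : R) : cexp (Complex x y : C) = circ (expR x) y.
Proof. by []. Qed.

(** The rectangle of height [2 pi] that [cexp] maps onto an annulus can contain two preimages of
    [z1], one on each side of the cut. In a half of height [pi] there is at most one, [cos] being
    injective there, so [goursat] applies with a single exceptional point. *)
Lemma polar_window (z1 : C) (a b : R) : (a = 0 /\ b = pi) \/ (a = - pi /\ b = 0) ->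
  exists w1 : C, forall x y, a <= y <= b -> cexp (Complex x y) = z1 -> Complex x y = w1.
Proof.
move=> ab.
case: (pselect (exists x y, a <= y <= b /\ cexp (Complex x y : C) = z1)) => [[x0 [y0 [y0ab E0]]]|no].
  exists (Complex x0 y0) => x y yab E.
  have ex : x = x0.
    by apply: expR_inj; have := cabs_cexp (Complex x y : C); rewrite E -E0 cabs_cexp.
  subst x0; congr (Complex x _).
  have : dir y = dir y0 :> C.
    apply: (mulfI (x := ofR (expR x))); first by rewrite ofR_eq0 expR_eq0.
    by rewrite -[LHS]/(cexp (Complex x y)) E -E0.
  move=> /(congr1 (@re R)); rewrite !re_dir => ec.
  case: ab => -[ea eb]; subst a b.
    by apply: cos_inj => //; rewrite in_itv.
  apply: oppr_inj; apply: cos_inj; rewrite ?cosN// in_itv /=; lra.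
exists 0 => x y yab E; exfalso; apply: no; by exists x, y.
Qed.

(** The increment of a primitive of [g (circ r t)] is the integral of [g dz / (i z)] over the circle
    of radius [r]. The exponential turns the annulus into a rectangle and the circles into its
    vertical sides; the horizontal sides cancel by periodicity. *)
Lemma annulus (g : C -> C) (z1 : C) (r1 r2 : R) (F1 F2 : R -> C) :
  (forall z, 0 < cabs z < 1 -> ccont g z) ->
  (forall z, 0 < cabs z < 1 -> z <> z1 -> exists l, cdiff g z l) ->
  0 < r1 -> r1 <= r2 -> r2 < 1 ->
  (forall t, - pi <= t <= pi -> cder F1 t (g (circ r1 t))) ->
  (forall t, - pi <= t <= pi -> cder F2 t (g (circ r2 t))) ->
  F1 pi - F1 (- pi) = F2 pi - F2 (- pi).
Proof.
move=> cg dg r10 r12 r21 dF1 dF2.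
have r20 : 0 < r2 by rewrite (lt_le_trans r10).
pose G := g \o (@cexp R).
have cexp01 (x y : R) : x < 0 -> 0 < cabs (cexp (Complex x y : C)) < 1.
  by move=> x0; rewrite cabs_cexp expR_gt0 expR_lt1.
have cG (x y : R) : x < 0 -> ccont G (Complex x y).
  move=> x0; apply: ccont_comp; first exact: cdiff_cont (cdiff_cexp _).
  exact: cg (cexp01 _ _ x0).
have dG (x y : R) : x < 0 -> cexp (Complex x y) <> z1 -> exists l, cdiff G (Complex x y) l.
  move=> x0 ne; have [l dl] := dg _ (cexp01 x y x0) ne.
  by exists (l * cexp (Complex x y)); apply: cdiff_comp dl; exact: cdiff_cexp.
pose u1 := ln r1; pose u2 := ln r2.
have u1E : expR u1 = r1 by rewrite lnK ?posrE.
have u2E : expR u2 = r2 by rewrite lnK ?posrE.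
have u12 : u1 <= u2 by rewrite -ler_expR u1E u2E.
have u20 : u2 < 0 by rewrite -expR_lt1 u2E.
have lineh (x y h : R) : cabs (Complex (x + h) y - Complex x y : C) <= `|h|.
  by rewrite (le_trans (cabs_le_reim _))// /re /im /= subrr normr0 addr0 addrC addKr.
have linev (x y h : R) : cabs (Complex x (y + h) - Complex x y : C) <= `|h|.
  by rewrite (le_trans (cabs_le_reim _))// /re /im /= subrr normr0 add0r addrC addKr.
have exH (y : R) : exists F, forall x, u1 <= x <= u2 -> cder F x (G (Complex x y)).
  have c x : x < 0 -> _ := fun x0 => ccont_path (p := fun x => Complex x y) (fun h => lineh x y h) (cG x y x0).
  have [|||F HF] := @antiderivative R (u1 - 1) (u2 / 2) (fun x => G (Complex x y)).
  - by lra.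
  - by move=> x xP; case: (c x) => //; lra.
  - by move=> x xP; case: (c x) => //; lra.
  by exists F => x xP; apply: HF; lra.
have exV (x : R) : exists F, u1 <= x <= u2 -> forall y : R, - pi <= y <= pi -> cder F y (G (Complex x y)).
  case: (pselect (u1 <= x <= u2)) => [xP|no]; last by exists (fun=> 0) => xP; case: no.
  have x0 : x < 0 by lra.
  have c y := ccont_path (p := fun y => Complex x y) (fun h => linev x y h) (cG x y x0).
  have [|||F HF] := @antiderivative R (-4) 4 (fun y => G (Complex x y)).
  - by rewrite gtrN.
  - by move=> y yP; case: (c y).
  - by move=> y yP; case: (c y).
  by exists F => _ y yP; apply: HF; have := pi_lt4; lra.
have [H HP] := choice exH; have [V VP] := choice exV.
have dH (x y : R) : u1 <= x <= u2 -> - pi <= y <= pi -> cder (H y) x (G (Complex x y)).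
  by move=> xP _; exact: HP.
have dV (x y : R) : u1 <= x <= u2 -> - pi <= y <= pi -> cder (V x) y (G (Complex x y)).
  by move=> xP; exact: VP.
have pi0 := pi_ge0 R.
have [w1 w1P] := @polar_window z1 0 pi (or_introl (conj erefl erefl)).
have [w2 w2P] := @polar_window z1 (- pi) 0 (or_intror (conj erefl erefl)).
have I1 : rect_int H V u1 u2 0 pi = 0.
  apply: (goursat dH dV (z1 := w1)); [lra|lra|lra|lra|lra|lra|..].
    by move=> x y xP yP; apply: cG; lra.
  by move=> x y xP yP ne; apply: dG; [lra|move=> /(w1P _ _ yP)].
have I2 : rect_int H V u1 u2 (- pi) 0 = 0.
  apply: (goursat dH dV (z1 := w2)); [lra|lra|lra|lra|lra|lra|..].
    by move=> x y xP yP; apply: cG; lra.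
  by move=> x y xP yP ne; apply: dG; [lra|move=> /(w2P _ _ yP)].
have HH : H pi u2 - H pi u1 = H (- pi) u2 - H (- pi) u1.
  apply: (@cder_uniq _ u1 u2 _ _ (fun x => G (Complex x pi))) => // x xP.
    exact: HP.
  have -> : G (Complex x pi) = G (Complex x (- pi)).
    by rewrite /G /=; congr g; apply: complexP; rewrite !cexpE !reimE /= ?cosN ?sinN ?sinpi ?oppr0 ?mulr0 ?mul0r.
  exact: HP.
have pip : - pi <= pi :> R by lra.
have E1 : F1 pi - F1 (- pi) = V u1 pi - V u1 (- pi).
  apply: (@cder_uniq _ (- pi) pi _ _ (fun y => g (circ r1 y))) => // y yP.
  by rewrite -u1E -cexp_polar; apply: dV => //; lra.
have E2 : F2 pi - F2 (- pi) = V u2 pi - V u2 (- pi).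
  apply: (@cder_uniq _ (- pi) pi _ _ (fun y => g (circ r2 y))) => // y yP.
  by rewrite -u2E -cexp_polar; apply: dV => //; lra.
have : rect_int H V u1 u2 (- pi) 0 + rect_int H V u1 u2 0 pi = 0 by rewrite I1 I2 addr0.
rewrite E1 E2 /rect_int => E.
have {}E : I * ((V u2 pi - V u2 (- pi)) - (V u1 pi - V u1 (- pi))) = 0.
  rewrite -[RHS]E -[LHS]add0r -(subrr (H pi u2 - H pi u1)) {1}HH; ring.
move: E => /eqP; rewrite mulf_eq0 => /orP[/eqP[/eqP]|]; first by rewrite oner_eq0.
by rewrite subr_eq0 => /eqP ->.
Qed.

End Taylor.

(** * Taylor expansions of bounded functions on the unit disc *)

Section TaylorSeries.
Variable R : realType.
Local Notation C := (CC R).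
Local Notation I := (Complex 0 1 : C).

(** This lets [r] tend to 1 in estimates on circles of radius [r]; Bernoulli's inequality
    [1 - n (1 - r) <= r^n] makes the choice of [r] explicit. *)
Lemma le_lim_pow (X Y s : R) (n : nat) : 0 <= X -> 0 <= s -> s < 1 ->
  (forall r, s < r -> r < 1 -> X * r ^+ n <= Y) -> X <= Y.
Proof.
move=> X0 s0 s1 H.
have bern (r : R) k : 0 <= r -> r <= 1 -> 1 - k%:R * (1 - r) <= r ^+ k.
  move=> r0 r1; elim: k => [|k ih]; first by rewrite mul0r subr0.
  rewrite exprS; have : r ^+ k <= 1 by rewrite exprn_ile1.
  by rewrite -natr1 => h; nra.
apply/ler_addgt0Pl => e e0.
pose d := Num.min ((1 - s) / 2) (e / (X * n%:R + 1)).
have D0 : 0 < X * n%:R + 1 by rewrite ltr_wpDl// mulr_ge0.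
have d0 : 0 < d by rewrite lt_min !divr_gt0// subr_gt0.
have d1 : d <= (1 - s) / 2 by rewrite ge_min lexx.
have d2 : d * (X * n%:R + 1) <= e by rewrite -ler_pdivlMr// ge_min lexx orbT.
have r0 : 0 <= 1 - d by lra.
have r1 : 1 - d <= 1 by lra.
have h1 : s < 1 - d by lra.
have h2 : 1 - d < 1 by lra.
have := H _ h1 h2; have := ler_wpM2l X0 (bern _ n r0 r1).
have -> : 1 - (1 - d) = d by ring.
by move=> a b; have := le_trans a b; nra.
Qed.

Lemma cdiff_near (f g : C -> C) z l d : 0 < d ->
  (forall w, cabs (w - z) < d -> f w = g w) -> cdiff f z l -> cdiff g z l.
Proof.
move=> d0 fg df e /df[d' d'0 H]; exists (Num.min d d'); first by rewrite lt_min d0.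
move=> w; rewrite lt_min => /andP[/fg <- /H].
by rewrite (fg z) ?subrr ?cabs0.
Qed.

Lemma circ_pi r : circ r pi = circ r (- pi) :> C.
Proof. by rewrite /circ; congr (_ * _); apply: complexP; rewrite !reimE ?cosN ?sinN ?sinpi ?oppr0. Qed.

Lemma circ_neq0 r t : 0 < r -> circ r t != 0 :> C.
Proof. by move=> r0; rewrite -cabs_gt0 cabs_circ// ltW. Qed.

Lemma cder_circV r t k : 0 < r ->
  cder (fun t => (circ r t)^-1 ^+ k : C) t (- k%:R * I * (circ r t)^-1 ^+ k).
Proof.
move=> r0; elim: k => [|k ih].
  by rewrite oppr0 !mul0r; exact: cder_cst.
have d1 : cder (fun t => (circ r t)^-1 : C) t (- I * (circ r t)^-1).
  have E u : ofR r^-1 * dir (- u) = (circ r u)^-1 :> C.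
    by rewrite /circ invfM dirN ofRV.
  apply: (cder_ext E); rewrite -E.
  have dN : is_derive t 1 (fun u : R => - u) (- 1) by exact: is_deriveNid.
  apply: cder_eq (cderZ (ofR r^-1) (cder_dir dN)) _.
  have -> : Complex 0 (-1) = - I :> C by apply: complexP; rewrite !reimE /re /im /= ?oppr0.
  by ring.
under eq_fun do rewrite exprS.
apply: cder_eq (cderM d1 ih) _.
by rewrite exprS -natr1; ring.
Qed.

Variables (V : C -> C) (M : R).
Hypothesis dV : forall z, cabs z < 1 -> exists l, cdiff V z l.
Hypothesis VM : forall z, cabs z < 1 -> cabs (V z) <= M.

Let M0 : 0 <= M.
Proof. by apply: le_trans (VM (z := 0) _); rewrite ?cabs0. Qed.

Definition diffquo (z l w : C) := if w == z then l else (V w - V z) / (w - z).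

Lemma cdiff_diffquo z l w : cabs w < 1 -> w != z -> exists m, cdiff (diffquo z l) w m.
Proof.
move=> w1 wz; have [m dm] := dV w1.
have wz0 : w - z != 0 by rewrite subr_eq0.
have [m' dm'] := @cdiffV _ (fun u => u - z) w _ wz0 (cdiffB (cdiff_id w) (cdiff_cst z w)).
have Hm := cdiffM (cdiffB dm (cdiff_cst (V z) w)) dm'.
eexists; apply: (cdiff_near (d := cabs (w - z))) Hm; first by rewrite cabs_gt0.
move=> u uw; rewrite /diffquo; case: eqP => // E.
by move: uw; rewrite E cabsBC ltxx.
Qed.

Lemma ccont_diffquo z l w : cabs z < 1 -> cdiff V z l -> cabs w < 1 -> ccont (diffquo z l) w.
Proof.
move=> z1 dl w1; have [->|wz] := eqVneq w z; last first.
  by have [m] := cdiff_diffquo l w1 wz; exact: cdiff_cont.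
move=> e e0; have [d d0 H] := dl _ e0; exists d => // u uz; rewrite /diffquo eqxx.
case: eqP => [_|/eqP ne]; first by rewrite subrr cabs0 ltW.
have k0 : u - z != 0 by rewrite subr_eq0.
have := H _ uz; rewrite -ler_pdivrMr ?cabs_gt0// -cabsV -cabsM.
by rewrite mulrBl (mulfK k0).
Qed.

(** Cauchy's theorem for the difference quotient. The integrand vanishes at 0 and by [annulus] its
    integral does not depend on the radius, so it equals its limit as the radius tends to 0. *)
Lemma circ_int_diffquo z l r F : cabs z < 1 -> cdiff V z l -> 0 < r -> r < 1 ->
  (forall t, - pi <= t <= pi -> cder F t (circ r t * diffquo z l (circ r t))) ->
  F pi - F (- pi) = 0.
Proof.
move=> z1 dl r0 r1 dF.
pose g w := w * diffquo z l w.
have cg w : cabs w < 1 -> ccont g w.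
  move=> w1; apply: ccontM; first exact: cdiff_cont (cdiff_id w).
  exact: ccont_diffquo.
have dg w : cabs w < 1 -> w <> z -> exists m, cdiff g w m.
  move=> w1 /eqP wz; have [m dm] := cdiff_diffquo l w1 wz.
  by eexists; apply: cdiffM (cdiff_id w) dm.
apply: cabs_eq => e e0; rewrite subr0.
have z01 : cabs (0 : C) < 1 by rewrite cabs0.
have pi2 : 0 < pi *+ 2 :> R by rewrite mulrn_wgt0// pi_gt0.
have e20 : 0 < e / (pi *+ 2) by rewrite divr_gt0.
have [d d0 H] := cg 0 z01 _ e20.
pose r' := Num.min r (d / 2).
have r'0 : 0 < r' by rewrite lt_min r0 divr_gt0.
have r'r : r' <= r by rewrite ge_min lexx.
have r'd : r' < d by rewrite gt_min [d / 2 < d]gtr_pMr// invf_lt1// ltr1n orbT.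
have r'1 : r' <= 1 by rewrite (le_trans r'r)// ltW.
have [|F' dF'] := circ_antiderivative (g := g) r'0 r'1.
  by move=> w w1; apply: cg; rewrite w1 (le_lt_trans r'r).
rewrite -(@annulus _ g z r' r F' F) //.
- have pip : - pi <= pi :> R by have := pi_ge0 R; lra.
  have := @cder_le_cst R (- pi) pi (e / (pi *+ 2)) F' (fun t => g (circ r' t)) pip dF'.
  rewrite opprK -mulr2n divfK ?gt_eqF//; apply => t _.
  have := H (circ r' t); rewrite subr0 cabs_circ ?(ltW r'0)// => /(_ r'd).
  by rewrite {2}/g mul0r subr0.
- by move=> w /andP[_ w1]; exact: cg.
- by move=> w /andP[_ w1]; exact: dg.
Qed.

(** The function [G = (V w - V z) / (1 - z / w)] has integral 0 over circles. Subtracting the first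
    terms of its geometric series in [z / w] leaves [(z / w)^N G], which is small, while the
    integrals of these terms give the Taylor polynomial, the coefficients being the circle means of
    [V w / w^k]. The factor 2 comes from [|V w - V z| <= 2 M]. *)
Lemma taylor : exists v : nat -> C, (forall n, cabs (v n) <= M) /\
  forall z N, cabs z < 1 ->
    cabs (V z - \sum_(k < N) v k * z ^+ k) <= 2 * M * cabs z ^+ N / (1 - cabs z).
Proof.
pose g k w := V w * w^-1 ^+ k.
have dg k w : 0 < cabs w < 1 -> exists m, cdiff (g k) w m.
  move=> /andP[w0 w1]; have [l dl] := dV w1.
  rewrite cabs_gt0 in w0.
  have [m dm] := cdiffV w0 (cdiff_id w); have [m' dm'] := cdiffX k dm.
  by eexists; apply: cdiffM dl dm'.
have cg k w : 0 < cabs w < 1 -> ccont (g k) w.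
  by move=> /(dg k)[m]; exact: cdiff_cont.
have anti r : 0 < r -> r < 1 -> forall k, exists F, forall t, - pi <= t <= pi ->
    cder F t (g k (circ r t)).
  move=> r0 r1 k; apply: circ_antiderivative => //; first exact: ltW.
  by move=> w w1; apply: cg; rewrite w1 r0.
have h0 : (0 : R) < 2^-1 by rewrite invr_gt0.
have h1 : (2^-1 : R) < 1 by rewrite invf_lt1// ltr1n.
have [Psi0 Psi0P] := choice (anti _ h0 h1).
have pi2 : 0 < pi *+ 2 :> R by rewrite mulrn_wgt0// pi_gt0.
have pi2C : ofR (pi *+ 2) != 0 :> C by rewrite ofR_eq0 gt_eqF.
have pip : - pi <= pi :> R by have := pi_ge0 R; lra.
pose v k := (Psi0 k pi - Psi0 k (- pi)) / ofR (pi *+ 2).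
have vE r k F : 0 < r -> r < 1 ->
    (forall t, - pi <= t <= pi -> cder F t (g k (circ r t))) ->
    F pi - F (- pi) = ofR (pi *+ 2) * v k.
  move=> r0 r1 dF; rewrite /v mulrC divfK//.
  have dg' (z1 : C) w : 0 < cabs w < 1 -> w <> z1 -> exists m, cdiff (g k) w m.
    by move=> w1 _; exact: dg.
  have [le12|/ltW le21] := leP r 2^-1.
    exact: (@annulus _ (g k) 0 _ _ _ _ (cg k) (dg' 0) r0 le12 h1 dF (Psi0P k)).
  by apply/esym; exact: (@annulus _ (g k) 0 _ _ _ _ (cg k) (dg' 0) h0 le21 r1 (Psi0P k) dF).
exists v; split.
  move=> k; apply: (@le_lim_pow _ _ 0 k) => //.
  move=> r r0 r1; have [F dF] := anti r r0 r1 k.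
  have : cabs (F pi - F (- pi)) <= M / r ^+ k * (pi - - pi).
    apply: (cder_le_cst pip dF) => t _.
    rewrite /g cabsM cabsX cabsV cabs_circ ?(ltW r0)// exprVn ler_wpM2r//.
      by rewrite invr_ge0 exprn_ge0// ltW.
    by apply: VM; rewrite cabs_circ// ltW.
  rewrite (vE r k F)// opprK -mulr2n cabsM cabs_ofR gtr0_norm// mulrC ler_pM2r//.
  by rewrite ler_pdivlMr ?exprn_gt0.
move=> z [|N] z1.
  rewrite big_ord0 subr0 expr0 mulr1 ler_pdivlMr ?subr_gt0//.
  rewrite mulrC; apply: (@le_trans _ _ (1 * M)); last by rewrite ler_wpM2r// ler1n.
  by apply: ler_pM; rewrite ?VM// ?subr_ge0 ?(ltW z1)// gerBl.
have [l dl] := dV z1.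
set X := cabs _; set Y := 2 * M * _.
have main r : cabs z < r -> r < 1 -> X * r ^+ N.+1 * (r - cabs z) <= Y.
  move=> zr r1; have r0 : 0 < r by rewrite (le_lt_trans _ zr).
  have r1' := ltW r1.
  have [Psi PsiP] := choice (anti r r0 r1).
  have [|Phi PhiP] := circ_antiderivative (g := fun w => w * diffquo z l w) r0 r1'.
    move=> w w1; apply: ccontM; first exact: cdiff_cont (cdiff_id w).
    by apply: ccont_diffquo => //; rewrite w1.
  have Phi0 := circ_int_diffquo z1 dl r0 r1 PhiP.
  (* A primitive of [(circ r t)^-k]. It is periodic for [k > 0], so only [k = 0] contributes, with
     increment [2 pi]. *)
  pose E k t : C := if k is k'.+1 then I * (k'.+1%:R)^-1 * (circ r t)^-1 ^+ k else ofR t.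
  have dE k t : cder (E k) t ((circ r t)^-1 ^+ k).
    case: k => [|k].
      apply: cder_eq (cder_ofR (is_derive_id t (1 : R))) _; by rewrite expr0 ofR1.
    apply: cder_eq (cderZ (I * (k.+1%:R)^-1) (cder_circV t k.+1 r0)) _.
    have -> : - k.+1%:R * I * (circ r t)^-1 ^+ k.+1 = k.+1%:R * (- I * (circ r t)^-1 ^+ k.+1) by ring.
    rewrite -mulrA mulKf; last by rewrite pnatr_eq0.
    by rewrite mulrA (_ : I * - I = 1) ?mul1r//; apply: complexP; rewrite !reimE /re /im/=; ring.
  pose D t := Phi t - \sum_(k < N.+1) z ^+ k * (Psi k t - V z * E k t).
  pose d t := (z / circ r t) ^+ N.+1 * (circ r t * diffquo z l (circ r t)).
  have dD t : - pi <= t <= pi -> cder D t (d t).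
    move=> tP; set w := circ r t.
    have w0 : w != 0 by exact: circ_neq0.
    have wz : w != z.
      by apply/eqP => E1; move: zr; rewrite -E1 cabs_circ ?ltxx// ltW.
    have HS := @cder_sum _ N.+1 (fun k t => z ^+ k * (Psi k t - V z * E k t)) t
      (fun k => z ^+ k * (g k w - V z * w^-1 ^+ k)).
    apply: cder_eq (cderB (PhiP t tP) (HS _)) _.
      by move=> k _; apply: cderZ; apply: cderB; [exact: PsiP|apply: cderZ; exact: dE].
    rewrite -/w /d -/w; set G := w * diffquo z l w.
    have GE : G * (1 - z / w) = V w - V z.
      rewrite /G /diffquo (negPf wz); field.
      by rewrite w0 subr_eq0.
    elim: N.+1 => [|n ih]; first by rewrite big_ord0 subr0 expr0 mul1r.
    rewrite big_ord_recr/= opprD addrA ih exprS /g.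
    have -> : z ^+ n * (V w * w^-1 ^+ n - V z * w^-1 ^+ n) = (z / w) ^+ n * (V w - V z).
      by rewrite exprMn; ring.
    by rewrite -GE; ring.
  have rz0 : 0 < r - cabs z by rewrite subr_gt0.
  have DE : D pi - D (- pi) = - (ofR (pi *+ 2) * (\sum_(k < N.+1) v k * z ^+ k - V z)).
    have -> : D pi - D (- pi) = (Phi pi - Phi (- pi)) -
        \sum_(k < N.+1) z ^+ k * (ofR (pi *+ 2) * v k - V z * (E k pi - E k (- pi))).
      have -> : \sum_(k < N.+1) z ^+ k * (ofR (pi *+ 2) * v k - V z * (E k pi - E k (- pi))) =
        \sum_(k < N.+1) z ^+ k * (Psi k pi - V z * E k pi) -
        \sum_(k < N.+1) z ^+ k * (Psi k (- pi) - V z * E k (- pi)).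
        rewrite -sumrB; apply: eq_bigr => k _.
        have := vE r k (Psi k) r0 r1 (PsiP k).
        move: (ofR (pi *+ 2) * v k) (E k pi) (E k (- pi)) (z ^+ k) => y e1 e2 zk <-.
        by ring.
      have aux (a b c e : C) : a - b - (c - e) = a - c - (b - e) by ring.
      exact: aux.
    rewrite Phi0 sub0r; congr (- _); rewrite !big_ord_recl /= !expr0.
    have -> : ofR pi - ofR (- pi) = ofR (pi *+ 2) :> C by rewrite -ofRB opprK mulr2n.
    rewrite (eq_bigr (fun i : 'I_N => ofR (pi *+ 2) * (v (bump 0 i) * z ^+ bump 0 i))).
      rewrite -mulr_sumr; move: (ofR (pi *+ 2)) (v 0%N) (V z) (\sum_(i < N) _) => a b c e.
      by ring.
    move=> k _; rewrite /E /bump /= circ_pi subrr mulr0 subr0.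
    by rewrite mulrC mulrA.
  have HX : X <= (cabs z / r) ^+ N.+1 * (r * (2 * M / (r - cabs z))).
    rewrite -(ler_pM2r pi2) /X cabsBC mulrC.
    have -> : pi *+ 2 = cabs (ofR (pi *+ 2) : C) by rewrite cabs_ofR gtr0_norm.
    rewrite -cabsM -cabsN -DE cabs_ofR gtr0_norm//.
    have -> : pi *+ 2 = pi - - pi :> R by rewrite opprK mulr2n.
    apply: (cder_le_cst pip dD) => t tP.
    have w0 : circ r t != 0 by exact: circ_neq0.
    have cw : cabs (circ r t) = r by rewrite cabs_circ// ltW.
    rewrite /d cabsM cabsX cabsM cabsV cw; apply: ler_wpM2l.
      by rewrite exprn_ge0// divr_ge0// ltW.
    rewrite cabsM cw; apply: ler_wpM2l; first exact: ltW.
    have wz : circ r t != z by apply/eqP => E1; move: zr; rewrite -E1 cw ltxx.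
    rewrite /diffquo (negPf wz) cabsM cabsV; apply: ler_pM => //.
    - by rewrite invr_ge0.
    - rewrite (le_trans (cabsB _ _))// mulr_natl mulr2n lerD ?VM//.
      by rewrite cw.
    - rewrite lef_pV2 ?posrE//; last by rewrite cabs_gt0 subr_eq0.
      by have := cabsD (circ r t - z) z; rewrite subrK cw; lra.
  apply: (@le_trans _ _ (r * Y)); last first.
    rewrite -[leRHS]mul1r ler_wpM2r//.
    by rewrite /Y !mulr_ge0// exprn_ge0.
  have -> : r * Y = (cabs z / r) ^+ N.+1 * (r * (2 * M / (r - cabs z))) * (r ^+ N.+1 * (r - cabs z)).
    rewrite /Y exprMn exprVn; field.
    by rewrite !gt_eqF ?exprn_gt0.
  by rewrite -mulrA ler_wpM2r// mulr_ge0 ?exprn_ge0// ltW.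
have X0 : 0 <= X by exact: cabs_ge0.
rewrite ler_pdivlMr ?subr_gt0//.
(* [r] occurs twice in [main]: it tends to 1 first in the power, with [r0'] frozen in the
   difference, and then in the difference. *)
have half r0' : cabs z < r0' -> r0' < 1 -> X * (r0' - cabs z) <= Y.
  move=> zr r1; have rz0 : 0 <= r0' - cabs z by rewrite subr_ge0 ltW.
  apply: (@le_lim_pow _ _ r0' N.+1) => //.
  - by rewrite mulr_ge0.
  - by rewrite (le_trans _ (ltW zr)).
  move=> r rr r1''; apply: le_trans (main r (lt_trans zr rr) r1'').
  rewrite -!mulrA ler_wpM2l// mulrC ler_wpM2l ?lerD2r ?(ltW rr)// exprn_ge0//.
  by rewrite (le_trans _ (ltW rr))// (le_trans _ (ltW zr)).
rewrite mulrBr mulr1 lerBlDr; apply: (@le_lim_pow _ _ (cabs z) 1) => //.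
by move=> r zr r1; have := half r zr r1; rewrite expr1 mulrBr lerBlDr.
Qed.

End TaylorSeries.

(** * Holomorphic functions on normed modules *)

Section ComplexSequences.
Variable R : realType.
Local Notation C := (CC R).

Definition ccvg (u : nat -> C) (l : C) := forall e : R, 0 < e ->
  exists N, forall n, (N <= n)%N -> cabs (u n - l) <= e.

(** The limit is found as a lower limit, the supremum of the eventual lower bounds. *)
Lemma real_cauchy (u : nat -> R) :
  (forall e, 0 < e -> exists N, forall n m, (N <= n)%N -> (N <= m)%N -> `|u n - u m| <= e) ->
  exists l, forall e, 0 < e -> exists N, forall n, (N <= n)%N -> `|u n - l| <= e.
Proof.
move=> cu; pose A := [set x | exists N, forall n, (N <= n)%N -> x <= u n].
exists (sup A) => e e0; have [N HN] := cu (e / 2) (divr_gt0 e0 (ltr0n _ 2)).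
have ubN x : A x -> x <= u N + e / 2.
  move=> [N' HN']; have := HN' _ (leq_maxr N N').
  have := HN _ _ (leq_maxl N N') (leqnn N); rewrite ler_norml; lra.
have inA : A (u N - e / 2).
  by exists N => n Nn; have := HN _ _ Nn (leqnn N); rewrite ler_norml; lra.
have h1 : u N - e / 2 <= sup A by apply: ub_le_sup => //; exists (u N + e / 2) => x /ubN.
have h2 : sup A <= u N + e / 2 by apply: ge_sup; [exists (u N - e / 2)|exact: ubN].
exists N => n Nn; have := HN _ _ Nn (leqnn N); rewrite !ler_norml; lra.
Qed.

Lemma ccauchy (u : nat -> C) :
  (forall e, 0 < e -> exists N, forall n m, (N <= n)%N -> (N <= m)%N -> cabs (u n - u m) <= e) ->
  exists l, ccvg u l.
Proof.
move=> cu.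
have [|a Ha] := @real_cauchy (fun n => re (u n)).
  move=> e /cu[N HN]; exists N => n m Nn Nm.
  by rewrite -reB (le_trans (re_le_cabs _))// HN.
have [|b Hb] := @real_cauchy (fun n => im (u n)).
  move=> e /cu[N HN]; exists N => n m Nn Nm.
  by rewrite -imB (le_trans (im_le_cabs _))// HN.
exists (Complex a b) => e e0.
have e20 : 0 < e / 2 by rewrite divr_gt0.
have [N HN] := Ha _ e20; have [M HM] := Hb _ e20.
exists (maxn N M) => n; rewrite geq_max => /andP[/HN h1 /HM h2].
by rewrite (le_trans (cabs_le_reim _))// reB imB (splitr e) lerD.
Qed.

Lemma ccvg_uniq u l l' : ccvg u l -> ccvg u l' -> l = l'.
Proof.
move=> h h'; apply: cabs_eq => e e0.
have e20 : 0 < e / 2 by rewrite divr_gt0.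
have [N HN] := h _ e20; have [M HM] := h' _ e20.
have h1 := HN _ (leq_maxl N M); have h2 := HM _ (leq_maxr N M).
rewrite (le_trans (cabs_tri (u (maxn N M)) _ _))// (splitr e) lerD//.
by rewrite cabsBC.
Qed.

Lemma ccvg_cst c : ccvg (fun=> c) c.
Proof. by move=> e e0; exists 0%N => n _; rewrite subrr cabs0 ltW. Qed.

Lemma ccvgD u v l m : ccvg u l -> ccvg v m -> ccvg (fun n => u n + v n) (l + m).
Proof.
move=> h h' e e0; have e20 : 0 < e / 2 by rewrite divr_gt0.
have [N HN] := h _ e20; have [M HM] := h' _ e20.
exists (maxn N M) => n; rewrite geq_max => /andP[/HN h1 /HM h2].
rewrite (_ : u n + v n - (l + m) = (u n - l) + (v n - m)); last by ring.
by rewrite (le_trans (cabsD _ _))// (splitr e) lerD.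
Qed.

Lemma ccvgZ c u l : ccvg u l -> ccvg (fun n => c * u n) (c * l).
Proof.
move=> h e e0; have c0 : 0 < cabs c + 1 by rewrite ltr_wpDl.
have [N HN] := h _ (divr_gt0 e0 c0); exists N => n /HN h1.
rewrite -mulrBr cabsM (le_trans (ler_wpM2l (cabs_ge0 _) h1))//.
by rewrite mulrCA ler_piMr ?ltW// ltr_pdivrMr// mul1r ltrDl.
Qed.

Lemma ccvg_le u l B : ccvg u l -> (exists N, forall n, (N <= n)%N -> cabs (u n) <= B) ->
  cabs l <= B.
Proof.
move=> h [N HN]; apply/ler_addgt0Pl => e /h[M HM].
have h1 := HN _ (leq_maxl N M); have h2 := HM _ (leq_maxr N M).
have := cabsD (l - u (maxn N M)) (u (maxn N M)); rewrite subrK cabsBC; lra.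
Qed.

Lemma ccvg_ext u v l : u =1 v -> ccvg u l -> ccvg v l.
Proof. by move=> /funext ->. Qed.

Definition rcvg0 (e : nat -> R) := forall eps, 0 < eps ->
  exists N, forall n, (N <= n)%N -> e n <= eps.

Lemma ccvg_rate u l e : rcvg0 e -> (forall n, cabs (u n - l) <= e n) -> ccvg u l.
Proof.
move=> h h' eps /h[N HN]; exists N => n /HN h1; exact: le_trans h1.
Qed.

End ComplexSequences.

(** * Differentials and uniform limits of holomorphic functions *)

Section Holomorphic.
Variable R : realType.
Local Notation C := (CC R).
Variable V : normedModType C.
Implicit Types (f : V -> C) (p v : V).

Definition nrm v : R := re `|v|.

Lemma normV v : `|v| = ofR (nrm v) :> C.
Proof.
have : 0 <= `|v| by [].
by rewrite lecE /= => /andP[/eqP i0 _]; apply: complexP.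
Qed.
Lemma nrm_ge0 v : 0 <= nrm v.
Proof. by have := normr_ge0 v; rewrite normV -ofR0 leC_ofR. Qed.
Lemma nrmZ (a : C) v : nrm (a *: v) = cabs a * nrm v.
Proof. by rewrite /nrm normrZ normV normC_cabs -ofRM. Qed.
Lemma nrm0 : nrm 0 = 0.
Proof. by rewrite /nrm normr0. Qed.
Lemma nrm_eq0 v : (nrm v == 0) = (v == 0).
Proof. by rewrite -ofR_eq0 -normV normr_eq0. Qed.

(** Fréchet differentiability with the differential named and the norms in [R]; in an arbitrary
    normed space the boundedness of [L] has to be demanded. *)
Definition fdiff f p (L : V -> C) :=
  [/\ forall a u v, L (a *: u + v) = a * L u + L v,
      exists K, forall v, cabs (L v) <= K * nrm v &
      forall e, 0 < e -> exists2 d, 0 < d & forall v, nrm v < d ->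
        cabs (f (p + v) - f p - L v) <= e * nrm v].

Lemma near0P (P : V -> Prop) : (\forall v \near (0 : V), P v) <->
  exists2 d : R, 0 < d & forall v, nrm v < d -> P v.
Proof.
split=> [/nbhs_normP[d /= d0 H]|[d d0 H]].
  have [dE d0'] := gt0C d0; exists (re d) => // v vd; apply: H => /=.
  by rewrite /ball_/= sub0r normrN normV dE ltC_ofR.
apply/nbhs_normP; exists (ofR d) => /=; first by rewrite ltC_ofR.
by move=> v; rewrite /ball_/= sub0r normrN normV ltC_ofR; exact: H.
Qed.

Lemma fdiffP f p : differentiable (f : V -> C^o) p <-> exists L, fdiff f p L.
Proof.
split=> [df|[L [Llin [K HK] H]]].
  have [cd _] := (diff_locallyP _ _).1 df.
  exists ('d (f : V -> C^o) p); split.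
  - by move=> a u v; rewrite linearP.
  - have [k k0 Hk] := linear_lipschitz cd.
    have [kE _] := gt0C k0; exists (re k) => v.
    by have := Hk v; rewrite normV kE normC_cabs -ofRM leC_ofR.
  - move=> e e0; have := diff_locally df; move=> /eqaddoP /(_ (ofR e)).
    rewrite ltC_ofR => /(_ e0) /near0P[d d0 Hd]; exists d => // v /Hd /=.
    rewrite [X in `|X|](_ : _ = f (p + v) - f p - 'd (f : V -> C^o) p v :> C).
      by rewrite normV normC_cabs -ofRM leC_ofR.
    by rewrite -[RHS]addrA -opprD (addrC p).
pose l := HB.pack_for {linear V -> C^o} L (GRing.isLinear.Build _ _ _ _ L Llin).
have lc : continuous l.
  apply: continuousfor0_continuous; apply/cvgrPdist_le => e e0.
  have [-> r0] := gt0C e0; rewrite linear0.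
  have K0 : 0 < `|K| + 1 by rewrite ltr_wpDl.
  apply/near0P; exists (re e / (`|K| + 1)); first by rewrite divr_gt0.
  move=> v; rewrite ltr_pdivlMr// => vd.
  rewrite sub0r normrN normC_cabs leC_ofR (le_trans (HK v))//.
  rewrite (le_trans _ (ltW vd))// mulrC ler_wpM2l ?nrm_ge0//.
  by rewrite (le_trans (ler_norm _))// lerDl.
have E : (f : V -> C^o) \o shift p = cst (f p : C^o) + l +o_ 0 id.
  apply/eqaddoP => e e0; have [-> r0] := gt0C e0.
  have [d d0 Hd] := H _ r0; apply/near0P; exists d => // v /Hd.
  rewrite [X in `|X|](_ : _ = f (p + v) - f p - L v :> C).
    by rewrite normV normC_cabs -ofRM leC_ofR.
  by rewrite -addrA -opprD (addrC p).
have dE := diff_unique lc E.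
by apply/diff_locallyP; rewrite dE.
Qed.

Lemma fdiff_line f p L v : fdiff f p L -> cdiff (fun t : C => f (p + t *: v)) 0 (L v).
Proof.
move=> [Llin _ H] e e0.
have v0 : 0 < nrm v + 1 by rewrite ltr_wpDl// nrm_ge0.
have [d d0 Hd] := H _ (divr_gt0 e0 v0); exists (d / (nrm v + 1)); first by rewrite divr_gt0.
move=> t; rewrite subr0 scale0r addr0 ltr_pdivlMr// => td.
have LE : L (t *: v) = t * L v.
  have := Llin 1 0 0; rewrite scale1r addr0 mul1r => /eqP.
  rewrite addrC -subr_eq subrr eq_sym => /eqP L0.
  by have := Llin t v 0; rewrite addr0 L0 addr0.
have := Hd (t *: v); rewrite nrmZ LE (mulrC (L v)) => /(_ _) h.
rewrite (le_trans (h _))//.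
  by rewrite (le_lt_trans _ td)// ler_wpM2l// lerDl.
have -> : e / (nrm v + 1) * (cabs t * nrm v) = e * cabs t * (nrm v / (nrm v + 1)) by ring.
by rewrite ler_piMr ?mulr_ge0 ?(ltW e0)// ler_pdivrMr// mul1r lerDl.
Qed.

Lemma open_ball (U : set V) p : open U -> U p ->
  exists2 r, 0 < r & forall v, nrm v < r -> U (p + v).
Proof.
move=> oU Up; have : nbhs p U by exact: open_nbhs_nbhs.
rewrite -[nbhs p U]/(\forall x \near p, U x) (near_shift 0 p) => /near0P[r r0 H].
by exists r => // v /H; rewrite /= subr0 addrC.
Qed.

Lemma holo_line (U : set V) f p v (t : C) : holomorphic U f -> U (p + t *: v) ->
  exists l, cdiff (fun s : C => f (p + s *: v)) t l.
Proof.
move=> hf /hf /fdiffP[L dL]; exists (L v).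
have := fdiff_line v dL => H e /H[d d0 Hd]; exists d => // s st.
have := Hd (s - t); rewrite !subr0 => /(_ st).
have -> : p + t *: v + (s - t) *: v = p + s *: v.
  by rewrite -addrA -scalerDl (addrC t) subrK.
by rewrite scale0r addr0.
Qed.

(* Schwarz's lemma on complex lines. *)
Lemma holo_lip (U : set V) f p r M v : holomorphic U f -> 0 < r ->
  (forall v, nrm v < r -> U (p + v)) ->
  (forall v, nrm v < r -> cabs (f (p + v)) <= M) ->
  nrm v <= r / 2 -> cabs (f (p + v) - f p) <= 4 * M / r * nrm v.
Proof.
move=> hf r0 inU fM vr; have [->|v0] := eqVneq v 0.
  by rewrite addr0 subrr cabs0 nrm0 mulr0.
have a0 : 0 < nrm v by rewrite lt_def nrm_eq0 v0 nrm_ge0.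
pose w := ofR (r / nrm v) *: v.
have nw : nrm w = r by rewrite nrmZ cabs_ofR gtr0_norm ?divr_gt0// divfK ?gt_eqF.
have nt (t : C) : cabs t < 1 -> nrm (t *: w) < r.
  by move=> t1; rewrite nrmZ nw gtr_pMl.
have [|t t1|u [uM Hu]] := @taylor R (fun t => f (p + t *: w)) M.
- by move=> t t1; apply: (holo_line hf); apply: inU; exact: nt.
- by apply: fM; exact: nt.
pose t : C := ofR (nrm v / r).
have ct : cabs t = nrm v / r by rewrite cabs_ofR gtr0_norm// divr_gt0.
have t1 : cabs t <= 1 / 2.
  by rewrite ct ler_pdivrMr// mul1r mulrC.
have tw : t *: w = v.
  rewrite /t /w scalerA -ofRM (_ : _ * _ = 1) ?scale1r//.
  by field; rewrite !gt_eqF.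
have M0 : 0 <= M by apply: le_trans (fM 0 _); rewrite ?nrm0.
have c01 : cabs (0 : C) < 1 by rewrite cabs0.
have h2 : cabs (f p - u 0%N) <= 0.
  move: (Hu 0 1%N c01); rewrite big_ord1 expr0 mulr1 scale0r addr0 cabs0 expr1.
  by rewrite mulr0 mul0r.
have h1 := Hu t 1%N; rewrite big_ord1 expr0 mulr1 tw expr1 in h1.
rewrite (le_trans (cabs_tri (u 0%N) _ _))// (cabsBC (u 0%N)).
have h1' := h1 (le_lt_trans t1 _).
rewrite -[leRHS]addr0 lerD//.
rewrite (le_trans (h1' _))//; first by lra.
have -> : 4 * M / r * nrm v = 4 * M * cabs t by rewrite ct; ring.
rewrite ler_pdivrMr; last by lra.
rewrite -subr_ge0 (_ : _ - _ = 2 * M * cabs t * (1 - 2 * cabs t)); last by ring.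
by rewrite !mulr_ge0//; lra.
Qed.

(** Cauchy's estimate, obtained by letting the increment in [holo_lip] shrink along the direction
    [v]. *)
Lemma fdiff_le (U : set V) f p L r M v : holomorphic U f -> fdiff f p L -> 0 < r ->
  (forall v, nrm v < r -> U (p + v)) ->
  (forall v, nrm v < r -> cabs (f (p + v)) <= M) ->
  cabs (L v) <= 4 * M / r * nrm v.
Proof.
move=> hf dL r0 inU fM; apply/ler_addgt0Pl => e e0.
have v0 : 0 < nrm v + 1 by rewrite ltr_wpDl// nrm_ge0.
have [d d0 Hd] := fdiff_line v dL e0.
pose t := Num.min (d / 2) (r / 2 / (nrm v + 1)).
have t0 : 0 < t by rewrite lt_min !divr_gt0.
have td : t < d by rewrite gt_min [d / 2 < d]gtr_pMr// invf_lt1// ltr1n.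
have ct : cabs (ofR t : C) = t by rewrite cabs_ofR gtr0_norm.
have tr : t * nrm v <= r / 2.
  have : t * (nrm v + 1) <= r / 2 by rewrite -ler_pdivlMr// ge_min lexx orbT.
  by rewrite mulrDr mulr1; lra.
have := Hd (ofR t); rewrite subr0 ct scale0r addr0 => /(_ td) h1.
have := holo_lip (v := ofR t *: v) hf r0 inU fM; rewrite nrmZ ct => /(_ tr) h2.
rewrite -(ler_pM2r t0) -{1}ct -cabsM.
have -> : L v * ofR t = (f (p + ofR t *: v) - f p) -
   (f (p + ofR t *: v) - f p - L v * ofR t) by ring.
rewrite (le_trans (cabsB _ _))//.
have -> : (e + 4 * M / r * nrm v) * t = 4 * M / r * (t * nrm v) + e * t by ring.
exact: lerD.
Qed.

Lemma fdiffB f g p L K : fdiff f p L -> fdiff g p K ->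
  fdiff (fun q => f q - g q) p (fun v => L v - K v).
Proof.
move=> [Ll [B HB] HL] [Kl [B' HB'] HK]; split.
- by move=> a u v; rewrite Ll Kl; ring.
- exists (B + B') => v; rewrite (le_trans (cabsB _ _))// mulrDl lerD//.
- move=> e e0; have e20 : 0 < e / 2 by rewrite divr_gt0.
  have [d1 d10 H1] := HL _ e20; have [d2 d20 H2] := HK _ e20.
  exists (Num.min d1 d2); first by rewrite lt_min d10.
  move=> v; rewrite lt_min => /andP[/H1 h1 /H2 h2].
  rewrite (_ : f (p + v) - g (p + v) - (f p - g p) - (L v - K v) =
    (f (p + v) - f p - L v) - (g (p + v) - g p - K v)); last by ring.
  by rewrite (le_trans (cabsB _ _))// (splitr e) mulrDl lerD.
Qed.

(** Weierstrass's theorem. Schwarz's bound for [g n - g m] is proportional to [nrm v]; hence the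
    differentials converge, and the increments of [g n - f] are at most a multiple of [e n * nrm v],
    which makes the limit of the differentials a differential of [f]. *)
Lemma holo_lim (U : set V) (g : nat -> V -> C) (f : V -> C) (e : nat -> R) :
  open U -> (forall n, holomorphic U (g n)) -> rcvg0 e ->
  (forall n p, U p -> cabs (g n p - f p) <= e n) -> holomorphic U f.
Proof.
move=> oU hg e0 gf p Up.
have [r r0 inU] := open_ball oU Up.
have [L dL] := choice (fun n => (fdiffP (g n) p).1 (hg n p Up)).
have diffL n m v : cabs (L n v - L m v) <= 4 * (e n + e m) / r * nrm v.
  have hgnm : holomorphic U (fun q => g n q - g m q).
    by move=> q Uq; apply: (differentiableB (f := g n : V -> C^o) (g := g m : V -> C^o)); exact: hg.
  apply: (@fdiff_le U _ p (fun v => L n v - L m v) r (e n + e m) v hgnm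
    (fdiffB (dL n) (dL m)) r0 inU) => u ur.
  rewrite (le_trans (cabs_tri (f (p + u)) _ _))// lerD ?gf//; try exact: inU.
  by rewrite cabsBC gf//; exact: inU.
have cvL v : exists l, ccvg (fun n => L n v) l.
  apply: ccauchy => eps eps0.
  have q0 : 0 < eps * r / (8 * (nrm v + 1)).
    by rewrite divr_gt0 ?mulr_gt0// ltr_wpDl// nrm_ge0.
  have [N HN] := e0 _ q0; exists N => n m /HN h1 /HN h2.
  apply: le_trans (diffL n m v) _.
  have E : 4 * (2 * (eps * r / (8 * (nrm v + 1)))) / r * (nrm v + 1) = eps.
    field; rewrite (gt_eqF r0) /=; apply/eqP => E'; have := nrm_ge0 v; lra.
  rewrite -[leRHS]E; apply: ler_pM.
  - rewrite divr_ge0 ?mulr_ge0 ?(ltW r0)//.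
    have h (k : nat) : 0 <= e k by apply: le_trans (gf k p Up); exact: cabs_ge0.
    by rewrite addr_ge0.
  - exact: nrm_ge0.
  - rewrite ler_wpM2r ?invr_ge0 ?(ltW r0)// ler_wpM2l//; lra.
  - by rewrite lerDl.
have [l Hl] := choice cvL.
have Ll n v : cabs (L n v - l v) <= 4 * e n / r * nrm v.
  have h (k : nat) : 0 <= e k by apply: le_trans (gf k p Up); exact: cabs_ge0.
  apply/ler_addgt0Pl => eps eps0.
  have q0 : 0 < eps * r / (8 * (nrm v + 1)).
    by rewrite divr_gt0 ?mulr_gt0// ltr_wpDl// nrm_ge0.
  have [N HN] := e0 _ q0; have [N' HN'] := Hl v _ (divr_gt0 eps0 (ltr0n _ 2)).
  have h1 := HN _ (leq_maxl N N'); have h2 := HN' _ (leq_maxr N N').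
  move: h1 h2; set m := maxn N N' => h1 h2.
  apply: le_trans (cabs_tri (L m v) _ _) _.
  have h3 := diffL n m v.
  have h4 : 4 * e m / r * nrm v <= eps / 2.
    have E : 4 * (eps * r / (8 * (nrm v + 1))) / r * (nrm v + 1) = eps / 2.
      field; rewrite (gt_eqF r0) /=; apply/eqP => E'; have := nrm_ge0 v; lra.
    rewrite -E; apply: ler_pM.
    - by rewrite divr_ge0 ?mulr_ge0 ?(ltW r0).
    - exact: nrm_ge0.
    - by rewrite ler_wpM2r ?invr_ge0 ?(ltW r0)// ler_wpM2l.
    - by rewrite lerDl.
  have E : 4 * (e n + e m) / r * nrm v = 4 * e n / r * nrm v + 4 * e m / r * nrm v by ring.
  lra.
(* Schwarz's bound cannot be applied to [g n - f], as [f] is not yet known to be holomorphic. It is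
   applied to [g n - g m], with [m] so large that [g m - f] costs at most [eps]. *)
have gfl n v : nrm v <= r / 2 -> cabs ((g n (p + v) - g n p) - (f (p + v) - f p)) <= 4 * (2 * e n) / r * nrm v.
  move=> vr; apply/ler_addgt0Pl => eps eps0.
  have q0 : 0 < Num.min 1 (eps / (4 / r * nrm v + 2)).
    rewrite lt_min ltr01 divr_gt0// ltr_wpDl// mulr_ge0 ?nrm_ge0// divr_ge0//.
    exact: ltW.
  have [N HN] := e0 _ q0; have := HN _ (leq_maxl N n); set m := maxn N n.
  rewrite le_min => /andP[_ h1].
  have D0 : 0 < 4 / r * nrm v + 2.
    by rewrite ltr_wpDl// mulr_ge0 ?nrm_ge0// divr_ge0// ltW.
  rewrite ler_pdivlMr// in h1.
  have hgnm : holomorphic U (fun q => g n q - g m q).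
    by move=> q Uq; apply: (differentiableB (f := g n : V -> C^o) (g := g m : V -> C^o)); exact: hg.
  have bd (u : V) : nrm u < r -> cabs (g n (p + u) - g m (p + u)) <= e n + e m.
    move=> ur; rewrite (le_trans (cabs_tri (f (p + u)) _ _))// lerD ?gf//; try exact: inU.
    by rewrite cabsBC gf//; exact: inU.
  have h2 := holo_lip hgnm r0 inU bd vr.
  have h3 : cabs ((g m (p + v) - f (p + v)) - (g m p - f p)) <= 2 * e m.
    have vr' : nrm v < r by have := r0; lra.
    by rewrite (le_trans (cabsB _ _))// mulr_natl mulr2n lerD ?gf//; exact: inU.
  rewrite (_ : g n (p + v) - g n p - (f (p + v) - f p) =
    (g n (p + v) - g m (p + v) - (g n p - g m p)) +
    ((g m (p + v) - f (p + v)) - (g m p - f p))); last by ring.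
  rewrite (le_trans (cabsD _ _))//.
  have en0 : 0 <= e n by apply: le_trans (gf n p Up); exact: cabs_ge0.
  have q1 : 0 <= 4 * e n / r * nrm v.
    by rewrite mulr_ge0 ?nrm_ge0// divr_ge0 ?mulr_ge0// ltW.
  have E1 : 4 * (e n + e m) / r * nrm v + 2 * e m = 4 * e n / r * nrm v + e m * (4 / r * nrm v + 2) by ring.
  have E2 : 4 * (2 * e n) / r * nrm v = 2 * (4 * e n / r * nrm v) by ring.
  lra.
apply/fdiffP; exists l; split.
- move=> a u v; apply: (ccvg_uniq (Hl _)).
  apply: ccvg_ext (ccvgD (ccvgZ a (Hl u)) (Hl v)) => n.
  by case: (dL n) => -> .
- case: (dL 0%N) => _ [B HB] _; exists (4 * e 0%N / r + B) => v.
  have := Ll 0%N v; have := HB v; have := cabs_tri (L 0%N v) (l v) 0.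
  rewrite !subr0 (cabsBC (l v)) mulrDl; lra.
- move=> eps eps0.
  (* So that [4 e N / r <= eps / 6]. This enters three times, twice through [gfl] and once through
     [Ll], next to the [eps / 2] from the differentiability of [g N]. *)
  have q0 : 0 < eps * r / 24 by rewrite divr_gt0// mulr_gt0.
  have [N HN] := e0 _ q0; have hN := HN N (leqnn N).
  case: (dL N) => _ _ /(_ (eps / 2) (divr_gt0 eps0 (ltr0n _ 2)))[d d0 Hd].
  exists (Num.min d (r / 2)); first by rewrite lt_min d0 divr_gt0.
  move=> v; rewrite lt_min => /andP[/Hd h1 /ltW /(gfl N) h2].
  have h3 := Ll N v.
  rewrite (_ : f (p + v) - f p - l v = (g N (p + v) - g N p - L N v)
    - ((g N (p + v) - g N p) - (f (p + v) - f p)) + (L N v - l v)); last by ring.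
  have h4 := cabsD (g N (p + v) - g N p - L N v - ((g N (p + v) - g N p) - (f (p + v) - f p))) (L N v - l v).
  have h5 := cabsB (g N (p + v) - g N p - L N v) ((g N (p + v) - g N p) - (f (p + v) - f p)).
  have h6 : 4 * e N / r <= eps / 6.
    by rewrite ler_pdivrMr//; lra.
  have h7 : 4 * e N / r * nrm v <= eps / 6 * nrm v by rewrite ler_wpM2r ?nrm_ge0.
  have E : 4 * (2 * e N) / r * nrm v = 2 * (4 * e N / r * nrm v) by ring.
  lra.
Qed.

End Holomorphic.

Section HolomorphicAlgebra.
Variable R : realType.
Local Notation C := (CC R).
Variable V : normedModType C.
Variable U : set V.
Implicit Types (f g : V -> C).

Lemma holo_cst (c : C) : holomorphic U (fun=> c).
Proof. by move=> p _; exact: differentiable_cst. Qed.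

Lemma holoD f g : holomorphic U f -> holomorphic U g -> holomorphic U (fun p => f p + g p).
Proof. by move=> hf hg p Up; apply: (@differentiableD _ _ C^o f g); [exact: hf|exact: hg]. Qed.

Lemma holoB f g : holomorphic U f -> holomorphic U g -> holomorphic U (fun p => f p - g p).
Proof. by move=> hf hg p Up; apply: (@differentiableB _ _ C^o f g); [exact: hf|exact: hg]. Qed.

Lemma holoM f g : holomorphic U f -> holomorphic U g -> holomorphic U (fun p => f p * g p).
Proof. by move=> hf hg p Up; apply: (@differentiableM _ _ f g); [exact: hf|exact: hg]. Qed.

Lemma holoZ (c : C) f : holomorphic U f -> holomorphic U (fun p => c * f p).
Proof. by move=> hf; apply: holoM => //; exact: holo_cst. Qed.

Lemma holoX f n : holomorphic U f -> holomorphic U (fun p => f p ^+ n).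
Proof.
move=> hf; elim: n => [|n ih]; first exact: holo_cst.
by under eq_fun do rewrite exprS; exact: holoM.
Qed.

Lemma holoV f : holomorphic U f -> (forall p, U p -> f p != 0) ->
  holomorphic U (fun p => (f p)^-1).
Proof.
move=> hf f0 p Up; apply: (@differentiableV _ _ f p); [exact: hf|exact: f0].
Qed.

Lemma holo_sum (I : Type) (r : seq I) (P : pred I) (F : I -> V -> C) :
  (forall i, holomorphic U (F i)) ->
  holomorphic U (fun p => \sum_(i <- r | P i) F i p).
Proof.
move=> hF; elim: r => [|i r ih].
  by under eq_fun do rewrite big_nil; exact: holo_cst.
have -> : (fun p => \sum_(j <- i :: r | P j) F j p) =
    fun p => if P i then F i p + \sum_(j <- r | P j) F j p else \sum_(j <- r | P j) F j p.
  by apply/funext => p; rewrite big_cons.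
by case: (P i) => //; exact: holoD.
Qed.

(** The constant sequence [f] converges to [g] on [U] with rate 0. *)
Lemma holo_eq f g : open U -> (forall p, U p -> f p = g p) -> holomorphic U f -> holomorphic U g.
Proof.
move=> oU fg hf; apply: (@holo_lim _ _ U (fun=> f) g (fun=> 0)) => //.
  by move=> e e0; exists 0%N => n _; exact: ltW.
by move=> _ p /fg ->; rewrite subrr cabs0.
Qed.

End HolomorphicAlgebra.

Section Products.
Variable R : realType.
Local Notation C := (CC R).
Variables (V W T : normedModType C).

Lemma holo_sub (A B : set V) (f : V -> C) : A `<=` B -> holomorphic B f -> holomorphic A f.
Proof. by move=> AB hf p /AB; exact: hf. Qed.

Lemma differentiable_fst (x : V * W) : differentiable (fst : V * W -> V) x.
Proof.
pose l := HB.pack_for {linear (V * W)%type -> V} (fst : V * W -> V)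
  (GRing.isLinear.Build _ (V * W)%type V _ (fst : V * W -> V) (fun a u v => erefl)).
by apply: (linear_differentiable (f := l)) => p; exact: cvg_fst.
Qed.

Lemma differentiable_snd (x : V * W) : differentiable (snd : V * W -> W) x.
Proof.
pose l := HB.pack_for {linear (V * W)%type -> W} (snd : V * W -> W)
  (GRing.isLinear.Build _ (V * W)%type W _ (snd : V * W -> W) (fun a u v => erefl)).
by apply: (linear_differentiable (f := l)) => p; exact: cvg_snd.
Qed.

Lemma holo_fst (X : set V) (S : set W) (f : V -> C) : holomorphic X f ->
  holomorphic (X `*` S) (fun p => f p.1).
Proof.
move=> hf [x s] [/= Xx _].
apply: (@differentiable_comp _ _ V C^o fst f); last exact: hf.
exact: differentiable_fst.
Qed.

Lemma holo_snd (X : set V) (S : set W) (f : W -> C) : holomorphic S f ->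
  holomorphic (X `*` S) (fun p => f p.2).
Proof.
move=> hf [x s] [/= _ Ss].
apply: (@differentiable_comp _ _ W C^o snd f); last exact: hf.
exact: differentiable_snd.
Qed.

Lemma holo_slice1 (X : set V) (S : set W) (F : V -> W -> C) h :
  holomorphic (X `*` S) (fun p => F p.1 p.2) -> S h -> holomorphic X (F ^~ h).
Proof.
move=> hF Sh x Xx.
apply: (@differentiable_comp _ V (V * W)%type C^o (fun x => (x, h)) (fun p => F p.1 p.2)).
  by apply: differentiable_pair; [exact: ex_diff|exact: differentiable_cst].
exact: hF.
Qed.

Lemma holo_slice2 (X : set V) (S : set W) (F : V -> W -> C) x :
  holomorphic (X `*` S) (fun p => F p.1 p.2) -> X x -> holomorphic S (F x).
Proof.
move=> hF Xx s Ss.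
apply: (@differentiable_comp _ W (V * W)%type C^o (fun s => (x, s)) (fun p => F p.1 p.2)).
  by apply: differentiable_pair; [exact: differentiable_cst|exact: ex_diff].
exact: hF.
Qed.

Lemma holo_id (S : set C) : holomorphic S id.
Proof. by move=> s _; exact: ex_diff. Qed.

Lemma holo_cdiff (S : set C) (f : C -> C) z : holomorphic S f -> S z -> exists l, cdiff f z l.
Proof.
move=> hf Sz; have [|l dl] := @holo_line R C S f 0 1 z hf.
  by rewrite add0r -[z *: 1]/(z * 1) mulr1.
exists l; apply: (cdiff_near ltr01) dl => w _.
by rewrite add0r -[w *: 1]/(w * 1) mulr1.
Qed.

Lemma nrmC (z : C) : nrm (z : C^o) = cabs z.
Proof. by []. Qed.

End Products.

(** * Uniqueness and holomorphy of Taylor coefficients *)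

Section TaylorCoefficients.
Variable R : realType.
Local Notation C := (CC R).

Lemma rcvg0P (e : nat -> R) : e @ \oo --> 0 -> rcvg0 e.
Proof.
move=> h eps eps0; move/cvgrPdist_le: h => /(_ _ eps0)[N _ HN].
exists N => n Nn; have := HN n Nn; rewrite /= sub0r normrN; exact: le_trans (ler_norm _).
Qed.

Lemma rcvg0Z (c : R) (e : nat -> R) : 0 <= c -> rcvg0 e -> rcvg0 (fun n => c * e n).
Proof.
move=> c0 h eps eps0; have c1 : 0 < c + 1 by rewrite ltr_wpDl.
have [N HN] := h _ (divr_gt0 eps0 c1); exists N => n /HN h1.
rewrite (le_trans (ler_wpM2l c0 h1))// mulrCA ler_piMr ?(ltW eps0)//.
by rewrite ler_pdivrMr// mul1r lerDl.
Qed.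

Lemma rcvg0_geometric (q : R) : 0 <= q -> q < 1 -> @rcvg0 R (fun n => q ^+ n).
Proof.
move=> q0 q1; apply: rcvg0P; have := @cvg_geometric R 1 q.
rewrite ger0_norm// => /(_ q1); rewrite /geometric.
by under eq_fun do rewrite mul1r.
Qed.

Lemma rcvg0_harmonic : @rcvg0 R (fun n => n.+1%:R^-1).
Proof. by apply: rcvg0P; exact: cvg_harmonic. Qed.

Lemma rcvg0S (e : nat -> R) : rcvg0 e -> rcvg0 (fun n => e n.+1).
Proof. by move=> h eps /h[N HN]; exists N => n Nn; apply: HN; exact: leqW. Qed.

Definition is_taylor (A : R) (f : C -> C) (v : nat -> C) :=
  forall z N, cabs z < 1 ->
    cabs (f z - \sum_(k < N) v k * z ^+ k) <= A * cabs z ^+ N / (1 - cabs z).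

Lemma is_taylor_sub (A : R) (f : C -> C) v z N : is_taylor A f v ->
  0 <= A -> z != 0 -> cabs z <= 1 / 2 ->
  cabs ((f z - \sum_(k < N) v k * z ^+ k) / z ^+ N - v N) <= 2 * A * cabs z.
Proof.
move=> tv A0 z0 z1.
have zN0 : z ^+ N != 0 by rewrite expf_neq0.
have -> : (f z - \sum_(k < N) v k * z ^+ k) / z ^+ N - v N =
  (f z - \sum_(k < N.+1) v k * z ^+ k) / z ^+ N.
  rewrite big_ord_recr /=; move: (\sum_(k < N) _) => s; field.
  by rewrite zN0.
have p0 : 0 < cabs z ^+ N by rewrite exprn_gt0// cabs_gt0.
rewrite cabsM cabsV cabsX ler_pdivrMr// (le_trans (tv z N.+1 _))//; first by lra.
rewrite ler_pdivrMr; last by lra.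
rewrite exprS mulrCA !mulrA -subr_ge0.
rewrite (_ : _ - _ = A * (cabs z * cabs z ^+ N) * (1 - 2 * cabs z)); last by ring.
by rewrite !mulr_ge0// ?(ltW p0)//; lra.
Qed.

(** Points of the half disc tending to 0, along which a Taylor coefficient is the limit of quotients
    formed with the function and the lower coefficients, by [is_taylor_sub]. *)
Definition test_point n : C := ofR (n.+2%:R^-1).

Lemma cabs_test_point n : cabs (test_point n) = n.+2%:R^-1.
Proof. by rewrite cabs_ofR ger0_norm. Qed.

Lemma test_point_neq0 n : test_point n != 0.
Proof. by rewrite ofR_eq0 invr_eq0 pnatr_eq0. Qed.

Lemma test_point_half n : cabs (test_point n) <= 1 / 2.
Proof.
by rewrite cabs_test_point div1r lef_pV2 ?posrE// ler_nat.
Qed.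

Lemma rcvg0_test_point (c : R) : 0 <= c -> @rcvg0 R (fun n => c * cabs (test_point n)).
Proof.
move=> c0; apply: rcvg0Z => //.
by under eq_fun do rewrite cabs_test_point; exact: (rcvg0S rcvg0_harmonic).
Qed.

Lemma taylor_uniq (A B : R) (f g : C -> C) u v : 0 <= A -> 0 <= B ->
  is_taylor A f u -> is_taylor B g v ->
  (forall z, cabs z < 1 -> f z = g z) -> forall n, u n = v n.
Proof.
move=> A0 B0 tu tv fg; elim/ltn_ind => n ih.
have h1 : ccvg (fun j => (f (test_point j) - \sum_(k < n) u k * test_point j ^+ k) / test_point j ^+ n) (u n).
  apply: (ccvg_rate (rcvg0_test_point (mulr_ge0 (ler0n _ 2) A0))) => j.
  exact: (is_taylor_sub n tu A0 (test_point_neq0 j) (test_point_half j)).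
apply: (ccvg_uniq h1).
apply: (ccvg_rate (rcvg0_test_point (mulr_ge0 (ler0n _ 2) B0))) => j.
rewrite fg; last by have := test_point_half j; lra.
rewrite (eq_bigr (fun k : 'I_n => v k * test_point j ^+ k)); last first.
  by move=> k _; rewrite ih.
exact: (is_taylor_sub n tv B0 (test_point_neq0 j) (test_point_half j)).
Qed.

(** The limit along the test points is uniform in [x], because the constant [A] is, so [holo_lim]
    applies inductively. *)
Lemma holo_coef (V : normedModType C) (X : set V) (A : R) (F : V -> C -> C)
  (v : V -> nat -> C) : open X -> 0 <= A ->
  (forall x, X x -> is_taylor A (F x) (v x)) ->
  (forall z, cabs z < 1 -> holomorphic X (F ^~ z)) ->
  forall n, holomorphic X (v ^~ n).
Proof.
move=> oX A0 tF hF; elim/ltn_ind => n ih.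
apply: (@holo_lim _ _ X (fun j x => (F x (test_point j) - \sum_(k < n) v x k * test_point j ^+ k) *
  (test_point j ^+ n)^-1) _ _ oX _ (rcvg0_test_point (mulr_ge0 (ler0n _ 2) A0))).
  move=> j; apply: holoM; last exact: holo_cst.
  apply: holoB; first by apply: hF; have := test_point_half j; lra.
  by apply: holo_sum => k; apply: holoM; [exact: ih|exact: holo_cst].
move=> j x Xx.
exact: (is_taylor_sub n (tF x Xx) A0 (test_point_neq0 j) (test_point_half j)).
Qed.

End TaylorCoefficients.

(** * Laguerre functions and the Laplace transform *)

Section Laguerre.
Variable R : realType.
Local Notation C := (CC R).
Variable kap : R.
Hypothesis kap0 : 0 < kap.

(* [la n m] is the inverse Laplace transform of p^-(m+1) (kap / p - 1)^n,
   a multiple of a Laguerre polynomial. *)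
Fixpoint la (n m : nat) (s : R) : R :=
  if n is n'.+1 then kap * la n' m.+1 s - la n' m s else s ^+ m / m`!%:R.

Lemma la_derive n m (s : R) : is_derive s 1 (la n m.+1) (la n m s).
Proof.
elim: n m => [|n ih] m /=.
  have H := is_deriveZ m.+1`!%:R^-1 (DeriveDef (@exprn_derivable R m.+1 s 1) (exp_derive m.+1 s 1)).
  have -> : (fun s0 : R => s0 ^+ m.+1 / m.+1`!%:R) = m.+1`!%:R^-1 \*: (fun u : R => u ^+ m.+1).
    by apply/funext => u; rewrite /= [RHS]mulrC.
  apply: (is_derive_eq H); rewrite factS natrM /GRing.scale /= mulr1; field.
  by rewrite ?nat1r !pnatr_eq0 -lt0n fact_gt0.
exact: (is_deriveB (is_deriveZ kap (ih m.+1)) (ih m)).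
Qed.

Lemma la_at0 n m : la n m.+1 0 = 0.
Proof.
elim: n m => [|n ih] m /=; first by rewrite expr0n mul0r.
by rewrite !ih mulr0 subr0.
Qed.

(** On the Laplace side this is [- d/dp] of [p^-(m+1) (kap / p - 1)^n]. For [n = 0] the truncated
    [n.-1] is harmless, its term having the factor [n]. *)
Lemma la_mul n m s : s * la n m s = m.+1%:R * la n m.+1 s + kap * n%:R * la n.-1 m.+2 s.
Proof.
elim: n m => [|n ih] m /=.
  rewrite mulr0 mul0r addr0 exprS factS natrM; field.
  by rewrite ?nat1r !pnatr_eq0 -lt0n fact_gt0.
rewrite mulrBr mulrCA ih ih; case: n ih => [|n] ih /=.
  by rewrite -!natr1; ring.
by rewrite -!natr1; ring.
Qed.

(** An energy argument. [J n s] is the integral of [(la n 0 u)^2 e^(- kap u)] over [[0, s]]; by the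
    recursion of [la] the difference of two successive integrands is a total derivative, so that
    [J n s - J n.+1 s] is the left-hand side. As all [J n s] are nonnegative and [J 0 s <= 1 / kap],
    each difference is at most [1 / kap]. *)
Lemma la_sqr_le n s : 0 <= s -> kap * (la n 1 s) ^+ 2 * expR (- kap * s) <= kap^-1.
Proof.
move=> s0.
pose J := fix J n (s : R) : R := if n is n'.+1 then J n' s - kap * (la n' 1 s) ^+ 2 * expR (- kap * s)
  else (1 - expR (- kap * s)) / kap.
have dexp (u : R) : is_derive u 1 (fun u => expR (- kap * u)) (- kap * expR (- kap * u)).
  have := is_deriveZ (- kap) (is_derive_id u (1 : R)).
  rewrite /GRing.scale /= mulr1 => H.
  have := @is_derive1_comp _ expR (fun u => - kap * u) u _ _ (is_derive_expR _) H.
  by move=> H'; apply: (is_derive_eq H'); rewrite mulrC.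
have dJ k (u : R) : is_derive u 1 (J k) ((la k 0 u) ^+ 2 * expR (- kap * u)).
  elim: k => [|k ih].
    have := is_deriveZ kap^-1 (is_deriveB (is_derive_cst (1 : R) u (1 : R)) (dexp u)).
    rewrite /GRing.scale /= => H.
    have -> : (fun v : R => (1 - expR (- kap * v)) / kap) = kap^-1 \*: (cst 1 - (fun u => expR (- kap * u))).
      by apply/funext => v; rewrite /= mulrC.
    apply: (is_derive_eq H); rewrite expr0 fact0 divr1 expr1n; field.
    by rewrite gt_eqF.
  have dl := la_derive k 0 u.
  have H := is_deriveB ih (is_deriveM (is_deriveZ kap (is_deriveM dl dl)) (dexp u)).
  have -> : J k.+1 = J k - ((kap \*: (la k 1 * la k 1)) * (fun u => expR (- kap * u))).
    by apply/funext => v; rewrite /= expr2.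
  apply: (is_derive_eq H); rewrite /GRing.scale /= /GRing.scale /=.
  rewrite -[(la k 1 * la k 1) u]/(la k 1 u * la k 1 u); ring.
have J00 k : J k 0 = 0.
  elim: k => [|k ih] /=; first by rewrite mulr0 expR0 subrr mul0r.
  by rewrite ih la_at0 expr0n mulr0 mul0r subr0.
have Jge0 k : 0 <= J k s.
  have := @cder_le R 0 s (fun=> 0) (fun=> 0) (J k) _ s0 (fun x _ => cder_cst 0 x) (fun x _ => dJ k x).
  rewrite subrr cabs0 J00 subr0; apply => x _.
  by rewrite mulr_ge0 ?sqr_ge0 ?expR_ge0.
have Jle k : J k s <= kap^-1.
  elim: k => [|k ih] /=.
    rewrite -[leRHS]mul1r; apply: ler_wpM2r; first by rewrite invr_ge0 ltW.
    by rewrite gerBl expR_ge0.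
  apply: le_trans ih; rewrite gerBl; apply: mulr_ge0; last exact: expR_ge0.
  by apply: mulr_ge0; [exact: ltW|exact: sqr_ge0].
have := Jge0 n.+1; have := Jle n; rewrite /=; lra.
Qed.

(** The starting bound is the square root of [la_sqr_le]; raising [m] is an integration from 0,
    under which [e^(kap s / 2)] is stable up to a constant. *)
Lemma la_bound1 m : exists2 B, 0 <= B &
  forall n s, 0 <= s -> `|la n m.+1 s| <= B * expR (kap / 2 * s).
Proof.
elim: m => [|m [B B0 HB]].
  exists kap^-1; first by rewrite invr_ge0 ltW.
  move=> n s s0; rewrite -(@ler_pXn2r _ 2)// ?nnegrE ?mulr_ge0 ?invr_ge0 ?expR_ge0 ?(ltW kap0)//.
  rewrite exprMn real_normK ?num_real//.
  have := la_sqr_le n s0; rewrite mulNr expRN.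
  have -> : expR (kap / 2 * s) ^+ 2 = expR (kap * s).
    by rewrite expr2 -expRD; congr expR; field.
  rewrite ler_pdivrMr ?expR_gt0// -ler_pdivlMl// => H.
  by rewrite (le_trans H)// exprVn mulrA -invfM -expr2.
exists (B * (2 / kap)); first by rewrite mulr_ge0// divr_ge0// ltW.
move=> n s s0.
have dexp (u : R) : is_derive u 1 (fun u => B * (2 / kap) * expR (kap / 2 * u)) (B * expR (kap / 2 * u)).
  have := is_deriveZ (kap / 2) (is_derive_id u (1 : R)).
  rewrite /GRing.scale /= mulr1 => H.
  have H' := @is_derive1_comp _ expR (fun u => kap / 2 * u) u _ _ (is_derive_expR _) H.
  have H'' := is_deriveZ (B * (2 / kap)) H'.
  apply: (is_derive_eq H''); rewrite /GRing.scale /=.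
  by field; rewrite gt_eqF.
have := @cder_le R 0 s (fun u => ofR (la n m.+2 u)) (fun u => ofR (la n m.+1 u)) _ _ s0
  (fun x _ => cder_ofR (la_derive n m.+1 x)) (fun x _ => dexp x).
rewrite la_at0 subr0 cabs_ofR => H; rewrite (le_trans (H _))//.
  by move=> x /andP[x0 _]; rewrite cabs_ofR; exact: HB.
by rewrite gerBl !mulr_ge0 ?expR_ge0// invr_ge0 ltW.
Qed.

(* Multiplication by s amounts to - d/dp on the Laplace side, which brings out
   a factor n: this gains one power of n at the cost of two derivatives. *)
Lemma la_gain (a b : R) (d : nat) m : 0 < a -> a < b ->
  (forall m', (m <= m')%N -> exists2 B, 0 <= B & forall n s, 0 <= s ->
     `|la n m' s| * n.+1%:R ^+ d <= B * expR (a * s)) ->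
  forall m', (m.+2 <= m')%N -> exists2 B, 0 <= B & forall n s, 0 <= s ->
     `|la n m' s| * n.+1%:R ^+ d.+1 <= B * expR (b * s).
Proof.
move=> a0 ab H [//|[//|m']]; rewrite !ltnS => mm'.
have [B B0 HB] := H _ mm'; have [B' B'0 HB'] := H m'.+1 (leqW mm').
have ba : 0 < b - a by rewrite subr_gt0.
exists (((b - a)^-1 * B + m'.+1%:R * B') / kap).
  by rewrite divr_ge0 ?addr_ge0 ?mulr_ge0 ?invr_ge0 ?(ltW kap0) ?(ltW ba).
move=> n s s0.
have E : kap * n.+1%:R * la n m'.+2 s = s * la n.+1 m' s - m'.+1%:R * la n.+1 m'.+1 s.
  by rewrite la_mul /=; ring.
have E1 : kap * n.+1%:R * `|la n m'.+2 s| <= s * `|la n.+1 m' s| + m'.+1%:R * `|la n.+1 m'.+1 s|.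
  have -> : kap * n.+1%:R * `|la n m'.+2 s| = `|kap * n.+1%:R * la n m'.+2 s|.
    by rewrite normrM ger0_norm// mulr_ge0// ltW.
  rewrite E (le_trans (ler_normB _ _))// !normrM (ger0_norm s0).
  by rewrite (@ger0_norm _ m'.+1%:R).
have nd : n.+1%:R ^+ d <= n.+2%:R ^+ d :> R.
  by rewrite lerXn2r ?nnegrE// ler_nat.
have nd0 : 0 <= n.+1%:R ^+ d :> R by rewrite exprn_ge0.
have E2 : `|la n.+1 m' s| * n.+1%:R ^+ d <= B * expR (a * s).
  by apply: le_trans (HB n.+1 s s0); rewrite ler_wpM2l.
have E3 : `|la n.+1 m'.+1 s| * n.+1%:R ^+ d <= B' * expR (a * s).
  by apply: le_trans (HB' n.+1 s s0); rewrite ler_wpM2l.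
have ex1 : s * expR (a * s) <= (b - a)^-1 * expR (b * s).
  have -> : expR (b * s) = expR ((b - a) * s) * expR (a * s).
    by rewrite -expRD; congr expR; ring.
  rewrite mulrA ler_wpM2r ?expR_ge0// ler_pdivlMl//.
  by rewrite (le_trans _ (expR_ge1Dx _))// lerDr.
have ex2 : expR (a * s) <= expR (b * s).
  by rewrite ler_expR ler_wpM2r// ltW.
rewrite -(ler_pM2l kap0) exprS.
have -> : kap * (`|la n m'.+2 s| * (n.+1%:R * n.+1%:R ^+ d)) =
  (kap * n.+1%:R * `|la n m'.+2 s|) * n.+1%:R ^+ d by ring.
have -> : kap * (((b - a)^-1 * B + m'.+1%:R * B') / kap * expR (b * s)) =
  B * ((b - a)^-1 * expR (b * s)) + m'.+1%:R * (B' * expR (b * s)).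
  by field; rewrite !gt_eqF.
apply: le_trans (ler_wpM2r nd0 E1) _.
rewrite mulrDl -!mulrA lerD//.
  apply: le_trans (ler_wpM2l s0 E2) _.
  by rewrite mulrCA ler_wpM2l.
rewrite ler_wpM2l//; apply: le_trans E3 _.
by rewrite ler_wpM2l.
Qed.

(** Two powers of [n] make a series with bounded coefficients summable. Each use of [la_gain] raises
    the least index by 2, from 1 to 3 and from 3 to 5, and needs a strictly larger rate to absorb a
    factor [s]: hence the rates [kap / 2], [3 kap / 4] and [kap]. *)
Lemma la_bound m : (5 <= m)%N -> exists2 B, 0 <= B & forall n s, 0 <= s ->
  `|la n m s| * n.+1%:R ^+ 2 <= B * expR (kap * s).
Proof.
have k2 : 0 < kap / 2 by rewrite divr_gt0.
have k34 : kap / 2 < kap * (3 / 4) by lra.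
have k1 : kap * (3 / 4) < kap by lra.
apply: (@la_gain (kap * (3 / 4)) kap 1 3 _ k1); first by lra.
apply: (@la_gain (kap / 2) (kap * (3 / 4)) 0 1 k2 k34).
move=> [//|m'] _; have [B B0 HB] := la_bound1 m'; exists B => // n s s0.
by rewrite expr0 mulr1; exact: HB.
Qed.

(** Extending by 0 to [s < 0] gives two-sided derivatives at 0, as [cder] demands; from index 2 on
    the extension is differentiable there, because [la n m.+2] and its derivative vanish at 0. *)
Definition lap n m s := if s < 0 then 0 else la n m s.

Lemma lap_ge0 n m s : 0 <= s -> lap n m s = la n m s.
Proof. by rewrite /lap ltNge => ->. Qed.

Lemma lapS n m s : lap n.+1 m s = kap * lap n m.+1 s - lap n m s.
Proof. by rewrite /lap; case: ifP => //; rewrite mulr0 subr0. Qed.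

Lemma lap_derive n m (s : R) : is_derive s 1 (lap n m.+2) (lap n m.+1 s).
Proof.
apply/is_derive_epsP => e e0.
have /is_derive_epsP /(_ e e0)[d d0 Hd] := la_derive n m.+1 s.
have [s0|s0|s0] := ltgtP s 0.
- exists (- s); first by rewrite oppr_gt0.
  move=> h; rewrite ltr_norml => /andP[h1 h2].
  rewrite /lap s0 (_ : s + h < 0); last by lra.
  by rewrite subrr mul0r subr0 normr0 mulr_ge0// ltW.
- exists (Num.min d s); first by rewrite lt_min d0.
  move=> h; rewrite lt_min => /andP[/Hd h1]; rewrite ltr_norml => /andP[h2 h3].
  by rewrite !lap_ge0//; lra.
- exists d => // h /Hd; rewrite s0 !add0r !la_at0 mul0r !subr0 /lap ltxx !la_at0 mul0r !subr0.
  by case: ifP => // _ _; rewrite normr0 mulr_ge0// ltW.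
Qed.

Lemma lap_bound m : (5 <= m)%N -> exists2 B, 0 <= B & forall n s,
  `|lap n m s| * n.+1%:R ^+ 2 <= B * expR (kap * s).
Proof.
move=> /la_bound[B B0 HB]; exists B => // n s; rewrite /lap; case: ltP => [_|]; last exact: HB.
by rewrite normr0 mul0r mulr_ge0// expR_ge0.
Qed.

End Laguerre.

(** * Laguerre series with bounded coefficients *)

Section LaguerreSeries.
Variable R : realType.
Local Notation C := (CC R).
Variable kap : R.
Hypothesis kap0 : 0 < kap.
Local Notation lap := (lap kap).

Lemma sum_inv_sqr (N k : nat) :
  \sum_(N <= n < N + k) (n.+1%:R ^+ 2)^-1 <= 2 / N.+1%:R - 2 / (N + k).+1%:R :> R.
Proof.
elim: k => [|k ih]; first by rewrite addn0 big_geq// subrr.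
rewrite addnS big_nat_recr ?leq_addr//=; set m := (N + k)%N in ih *.
have : (m.+1%:R ^+ 2)^-1 <= 2 / m.+1%:R - 2 / m.+2%:R :> R.
  rewrite -!natr1; set x : R := m%:R; have x0 : 0 <= x by rewrite /x.
  rewrite -subr_ge0.
  rewrite (_ : _ - _ = x / ((x + 1) ^+ 2 * (x + 1 + 1))).
    by rewrite divr_ge0// mulr_ge0 ?sqr_ge0//; lra.
  by field; rewrite !gt_eqF//; lra.
by move=> h; apply: le_trans (lerD ih h) _; rewrite addrA subrK.
Qed.

Definition lpart (w : nat -> C) m N s := \sum_(n < N) w n * ofR (lap n m s).

(** The sum is picked by [xget], with default 0, so that it is a total function of the coefficients;
    [lser_cvg] shows that it is the limit for bounded coefficients and [m >= 5]. *)
Definition lser (w : nat -> C) m s : C := xget 0 [set l | ccvg (fun N => lpart w m N s) l].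

Lemma lpart_dist m : (5 <= m)%N -> exists2 B, 0 <= B &
  forall w A, (forall n, cabs (w n) <= A) -> forall s N k,
    cabs (lpart w m (N + k) s - lpart w m N s) <= A * (B * expR (kap * s)) * (2 / N.+1%:R).
Proof.
move=> /(lap_bound kap0)[B B0 HB]; exists B => // w A wA s N k.
have A0 : 0 <= A by apply: le_trans (wA 0%N).
have -> : lpart w m (N + k) s - lpart w m N s = \sum_(N <= n < N + k) w n * ofR (lap n m s).
  rewrite /lpart -!(big_mkord xpredT (fun n => w n * ofR (lap n m s))).
  by rewrite [X in X - _](@big_cat_nat _ _ _ N)//= ?leq_addr// [LHS]addrC addKr.
rewrite (le_trans (cabs_sum _ _ _))//.
have P0 : 0 <= A * (B * expR (kap * s)) by rewrite !mulr_ge0 ?expR_ge0.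
apply: (@le_trans _ _ (\sum_(N <= n < N + k) A * (B * expR (kap * s)) * (n.+1%:R ^+ 2)^-1)).
  apply: ler_sum => n _; rewrite cabsM -mulrA; apply: ler_pM => //.
  by rewrite cabs_ofR ler_pdivlMr ?exprn_gt0.
rewrite -mulr_sumr ler_wpM2l// (le_trans (sum_inv_sqr N k))//.
by rewrite gerBl divr_ge0.
Qed.

Lemma lser_rate m : (5 <= m)%N -> exists2 B, 0 <= B &
  forall w A, (forall n, cabs (w n) <= A) -> forall s N,
    cabs (lpart w m N s - lser w m s) <= A * (B * expR (kap * s)) / N.+1%:R.
Proof.
move=> /lpart_dist[B B0 HB]; exists (2 * B); first by rewrite mulr_ge0.
move=> w A wA s N; have A0 : 0 <= A by apply: le_trans (wA 0%N).
have P0 : 0 <= A * (2 * B * expR (kap * s)) by rewrite !mulr_ge0 ?expR_ge0.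
have HB' N' k : cabs (lpart w m (N' + k) s - lpart w m N' s) <= A * (2 * B * expR (kap * s)) / N'.+1%:R.
  by apply: le_trans (HB w A wA s N' k) _; rewrite le_eqVlt; apply/orP; left; apply/eqP; ring.
have [l Hl] : exists l, ccvg (fun N => lpart w m N s) l.
  apply: ccauchy => e e0.
  have [M HM] := rcvg0Z P0 (@rcvg0_harmonic R) (divr_gt0 e0 (ltr0n _ 2)).
  exists M => n k Mn Mk.
  rewrite (le_trans (cabs_tri (lpart w m M s) _ _))// (splitr e) lerD//.
    by rewrite -(subnKC Mn) (le_trans (HB' M _))// HM.
  by rewrite cabsBC -(subnKC Mk) (le_trans (HB' M _))// HM.
have Hser : ccvg (fun N => lpart w m N s) (lser w m s).
  by rewrite /lser; case: xgetP => [x _ //|/(_ l)].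
rewrite cabsBC.
apply: (ccvg_le (ccvgD Hser (ccvg_cst (- lpart w m N s)))).
by exists N => n Nn; rewrite -(subnKC Nn).
Qed.

Lemma lser_cvg m w A s : (5 <= m)%N -> (forall n, cabs (w n) <= A) ->
  ccvg (fun N => lpart w m N s) (lser w m s).
Proof.
move=> /lser_rate[B B0 HB] wA; have A0 : 0 <= A by apply: le_trans (wA 0%N).
have P0 : 0 <= A * (B * expR (kap * s)) by rewrite !mulr_ge0 ?expR_ge0.
exact: (ccvg_rate (rcvg0Z P0 (@rcvg0_harmonic R)) (HB w A wA s)).
Qed.

Lemma lser_bound m : (5 <= m)%N -> exists2 B, 0 <= B &
  forall w A, (forall n, cabs (w n) <= A) -> forall s,
    cabs (lser w m s) <= A * (B * expR (kap * s)).
Proof.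
move=> /lser_rate[B B0 HB]; exists B => // w A wA s.
by have := HB w A wA s 0%N; rewrite /lpart big_ord0 sub0r cabsN divr1.
Qed.

(** Used uniformly in the partial sums: a second derivative bounded independently of [N] controls
    the difference quotients, which allows termwise differentiation in [lser_derive]. *)
Lemma cder_second_order (F F1 F2 : R -> C) (s d M : R) :
  (forall u, `|u - s| <= d -> cder F u (F1 u)) ->
  (forall u, `|u - s| <= d -> cder F1 u (F2 u)) ->
  (forall u, `|u - s| <= d -> cabs (F2 u) <= M) ->
  forall h, `|h| <= d -> cabs (F (s + h) - F s - F1 s * ofR h) <= M * h ^+ 2.
Proof.
move=> dF dF1 F2M h hd.
have M0 : 0 <= M.
  apply: le_trans (F2M s _); first exact: cabs_ge0.
  by rewrite subrr normr0 (le_trans _ hd).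
have F1le u : `|u - s| <= `|h| -> cabs (F1 u - F1 s) <= M * `|h|.
  move=> uh; have ud : `|u - s| <= d by exact: le_trans hd.
  have [us|/ltW us] := leP u s.
    rewrite cabsBC (le_trans (@cder_le_cst _ u s M F1 F2 us _ _))//.
    - by move=> x xP; apply: dF1; move: ud; rewrite !ler_norml; lra.
    - by move=> x xP; apply: F2M; move: ud; rewrite !ler_norml; lra.
    by rewrite ler_wpM2l// (le_trans _ uh)// distrC ler_norm.
  rewrite (le_trans (@cder_le_cst _ s u M F1 F2 us _ _))//.
  - by move=> x xP; apply: dF1; move: ud; rewrite !ler_norml; lra.
  - by move=> x xP; apply: F2M; move: ud; rewrite !ler_norml; lra.
  by rewrite ler_wpM2l// (le_trans _ uh)// ler_norm.
pose G u := F u - F1 s * ofR u.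
have dG u : `|u - s| <= d -> cder G u (F1 u - F1 s).
  move=> ud; apply: cder_eq (cderB (dF u ud) (cderZ (F1 s) (cder_ofR (is_derive_id u (1 : R))))) _.
  by rewrite ofR1 mulr1.
have -> : F (s + h) - F s - F1 s * ofR h = G (s + h) - G s.
  by rewrite /G ofRD; ring.
have -> : M * h ^+ 2 = M * `|h| * `|h| by rewrite -(real_normK (num_real h)); ring.
have [h0|/ltW h0] := leP 0 h.
  have sh : s <= s + h by lra.
  rewrite (le_trans (@cder_le_cst _ s (s + h) (M * `|h|) G (fun u => F1 u - F1 s) sh _ _))//.
  - by move=> x xP; apply: dG; move: hd; rewrite !ler_norml; lra.
  - by move=> x xP; apply: F1le; rewrite (ger0_norm h0) ler_norml; lra.
  by rewrite (ger0_norm h0) addrC addKr.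
have sh : s + h <= s by lra.
rewrite cabsBC (le_trans (@cder_le_cst _ (s + h) s (M * `|h|) G (fun u => F1 u - F1 s) sh _ _))//.
- by move=> x xP; apply: dG; move: hd; rewrite !ler_norml; lra.
- by move=> x xP; apply: F1le; rewrite (ler0_norm h0) ler_norml; lra.
by rewrite (ler0_norm h0) opprD addrA subrr add0r.
Qed.

Lemma lpart_derive w m N s : cder (lpart w m.+2 N) s (lpart w m.+1 N s).
Proof.
apply: (@cder_sum _ N (fun n s => w n * ofR (lap n m.+2 s)) s (fun n => w n * ofR (lap n m.+1 s))).
by move=> n _; apply: cderZ; apply: cder_ofR; exact: lap_derive.
Qed.

(** Index 7 is chosen because two derivatives lead from it to index 5, the least one covered by
    [la_bound]; the bound on the partial sums of index 5 is what [cder_second_order] needs. *)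
Lemma lser_derive w A s : (forall n, cabs (w n) <= A) ->
  cder (lser w 7) s (lser w 6 s).
Proof.
move=> wA; have [B B0 HB] := @lpart_dist 5 isT.
have A0 : 0 <= A by apply: le_trans (wA 0%N).
pose M := A * (B * expR (kap * (s + 1))) * 2.
have M0 : 0 <= M by rewrite !mulr_ge0 ?expR_ge0.
have b5 N u : `|u - s| <= 1 -> cabs (lpart w 5 N u) <= M.
  move=> us; have := HB w A wA u 0%N N.
  rewrite add0n {2}/lpart big_ord0 subr0 divr1 => H; apply: (le_trans H).
  rewrite /M ler_wpM2r// ler_wpM2l// ler_wpM2l// ler_expR ler_wpM2l ?(ltW kap0)//.
  by move: us; rewrite ler_norml; lra.
have main h : `|h| <= 1 -> cabs (lser w 7 (s + h) - lser w 7 s - lser w 6 s * ofR h) <= M * h ^+ 2.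
  move=> h1.
  have c1 := lser_cvg (s + h) (isT : 5 <= 7)%N wA.
  have c2 := lser_cvg s (isT : 5 <= 7)%N wA.
  have c3 := lser_cvg s (isT : 5 <= 6)%N wA.
  have := ccvgD (ccvgD c1 (ccvgZ (-1) c2)) (ccvgZ (- ofR h) c3).
  rewrite mulN1r mulNr (mulrC (ofR h)) => c.
  apply: (ccvg_le c); exists 0%N => N _.
  rewrite mulN1r mulNr (mulrC (ofR h)).
  apply: (@cder_second_order (lpart w 7 N) (lpart w 6 N) (lpart w 5 N) s 1) => // u us.
  - exact: lpart_derive.
  - exact: lpart_derive.
  - exact: b5.
apply/cder_epsP => e e0; exists (Num.min 1 (e / (M + 1))).
  by rewrite lt_min ltr01 divr_gt0// ltr_wpDl.
move=> h; rewrite lt_min => /andP[/ltW h1 h2]; apply: le_trans (main h h1) _.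
rewrite -(real_normK (num_real h)) expr2 mulrA ler_wpM2r//.
move: h2; rewrite ltr_pdivlMr ?ltr_wpDl// => /ltW; apply: le_trans.
by rewrite mulrC ler_wpM2l// lerDl.
Qed.

(** As [1 / p = (1 + z) / kap], the hypothesis says that [u(z) = g + w(z) / p] for the power series
    with these coefficients; multiplied by [p^-7] and transformed back, it becomes the
    conclusion. *)
Lemma lser_rec (u w : nat -> C) (g : C) A s : (forall n, cabs (w n) <= A) ->
  (forall n, cabs (u n) <= A) ->
  (forall n, u n = (if n == 0%N then g else 0) + ofR kap^-1 * (w n + (if n is k.+1 then w k else 0))) ->
  lser u 6 s = g * ofR (lap 0 6 s) + lser w 7 s.
Proof.
move=> wA uA uE; apply: (ccvg_uniq (lser_cvg s (isT : 5 <= 6)%N uA)).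
have k0 : kap != 0 by rewrite gt_eqF.
have kC : ofR kap != 0 :> C by rewrite ofR_eq0.
(* Summation by parts with [lap N.+1 6 = kap * lap N 7 - lap N 6]. The boundary term tends to 0,
   since [lap N 6] decays like [N^-2] and [w] is bounded. *)
have E N : lpart u 6 N.+1 s = g * ofR (lap 0 6 s) + lpart w 7 N s + ofR kap^-1 * w N * ofR (lap N 6 s).
  elim: N => [|N ih].
    rewrite /lpart big_ord_recl !big_ord0 uE eqxx /=.
    by rewrite !addr0 mulrDl.
  rewrite /lpart big_ord_recr -[X in X + _ = _]/(lpart u 6 N.+1 s) ih /= uE /=.
  rewrite [in RHS]big_ord_recr /= -/(lpart w 7 N s) (lapS kap N 6) ofRB ofRM ofRV.
  have kV : (ofR kap)^-1 * ofR kap = 1 :> C by rewrite mulVf.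
  move: (lpart _ _ _ _) (ofR kap) (ofR kap)^-1 kV => y c d dc.
  by ring: dc.
have A0 : 0 <= A by apply: le_trans (wA 0%N).
have [B B0 HB] := @lap_bound _ _ kap0 6 isT.
have cw := lser_cvg s (isT : 5 <= 7)%N wA.
have c3 : ccvg (fun N => ofR kap^-1 * w N * ofR (lap N 6 s)) 0.
  have P0 : 0 <= kap^-1 * A * (B * expR (kap * s)).
    by rewrite !mulr_ge0 ?expR_ge0// invr_ge0 ltW.
  apply: (ccvg_rate (rcvg0Z P0 (@rcvg0_harmonic R))) => n.
  rewrite subr0 !cabsM !cabs_ofR (ger0_norm (x := kap^-1)) ?invr_ge0 ?(ltW kap0)//.
  rewrite -!mulrA ler_wpM2l ?invr_ge0 ?(ltW kap0)//; apply: ler_pM => //.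
  have n1 : 1 <= n.+1%:R :> R by rewrite ler1n.
  rewrite mulrA ler_pdivlMr// (le_trans _ (HB n s))// ler_wpM2l// expr2.
  by rewrite ler_pMl//; apply: lt_le_trans n1.
have := ccvgD (ccvgD (ccvg_cst (g * ofR (lap 0 6 s))) cw) c3; rewrite addr0 => c e e0.
have [N HN] := c e e0; exists N.+1 => -[//|n] Nn.
by rewrite E; exact: HN.
Qed.

End LaguerreSeries.

(** * Laplace transforms through primitives *)

Section LaplaceTransform.
Variable R : realType.
Local Notation C := (CC R).

Lemma antiderivative_ray (a : R) (f : R -> C) :
  (forall x, a <= x -> {for x, continuous (fun t => re (f t))}) ->
  (forall x, a <= x -> {for x, continuous (fun t => im (f t))}) ->
  exists F, forall x, a < x -> cder F x (f x).
Proof.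
have real (g : R -> R) : (forall x, a <= x -> {for x, continuous g}) ->
    exists F, forall x, a < x -> is_derive x 1 F (g x).
  move=> cg; exists (fun x => \int[lebesgue_measure]_(t in `[a, x]) g t) => x ax.
  have xx1 : x < x + 1 by rewrite ltrDl.
  have intf : lebesgue_measure.-integrable `[a, x + 1] (EFin \o g).
    apply: continuous_compact_integrable; first exact: segment_compact.
    apply: continuous_in_subspaceT => y; rewrite inE/= in_itv/= => /andP[ay _]; exact: cg.
  have [dF FE] := continuous_FTC1_closed xx1 intf ax (cg x (ltW ax)).
  by move: FE; rewrite derive1E => FE; apply: DeriveDef.
move=> /real[F HF] /real[G HG].
exists (fun x => Complex (F x) (G x)) => x xa.
by split; [exact: HF|exact: HG].
Qed.

(** The integral of [b s e^(- p s)] over the half-line, as the limit of a primitive [Y]: linearity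
    and integration by parts then require no integrability, which is only established in
    [LT_is_laplace]. *)
Definition LT (p : C) (b : R -> C) (v : C) := exists Y : R -> C,
  [/\ forall s, 0 <= s -> cder Y s (b s * cexp (- (p * ofR s))), Y 0 = 0 &
      forall e, 0 < e -> exists S0, forall S, S0 <= S -> cabs (Y S - v) <= e].

Lemma LT_ext p b b' v v' : (forall s, 0 <= s -> b s = b' s) -> v = v' -> LT p b v -> LT p b' v'.
Proof.
by move=> bb <- [Y [dY Y0 Yv]]; exists Y; split=> // s s0; rewrite -bb//; exact: dY.
Qed.

Lemma LT_lin p b1 b2 v1 v2 c d : LT p b1 v1 -> LT p b2 v2 ->
  LT p (fun s => c * b1 s + d * b2 s) (c * v1 + d * v2).
Proof.
move=> [Y1 [dY1 Y10 Y1v]] [Y2 [dY2 Y20 Y2v]].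
exists (fun s => c * Y1 s + d * Y2 s); split.
- move=> s s0; apply: cder_eq (cderD (cderZ c (dY1 s s0)) (cderZ d (dY2 s s0))) _.
  by ring.
- by rewrite Y10 Y20 !mulr0 addr0.
- move=> e e0; pose K := cabs c + cabs d + 1.
  have K0 : 0 < K by rewrite ltr_wpDl// addr_ge0.
  have eK := divr_gt0 e0 K0.
  have [S1 H1] := Y1v _ eK; have [S2 H2] := Y2v _ eK.
  exists (Num.max S1 S2) => S; rewrite ge_max => /andP[/H1 h1 /H2 h2].
  rewrite (_ : _ - _ = c * (Y1 S - v1) + d * (Y2 S - v2)); last by ring.
  rewrite (le_trans (cabsD _ _))// !cabsM.
  apply: (@le_trans _ _ ((cabs c + cabs d) * (e / K))).
    by rewrite mulrDl lerD// ler_wpM2l.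
  by rewrite mulrCA ler_piMr ?(ltW e0)// ler_pdivrMr// mul1r lerDl.
Qed.

Lemma exp_decay (K a e : R) : 0 < a -> 0 < e -> exists S0, 0 <= S0 /\
  forall S, S0 <= S -> K * expR (- (a * S)) <= e.
Proof.
move=> a0 e0; exists (`|K| / e / a); split; first by rewrite !divr_ge0// ltW.
move=> S; rewrite ler_pdivrMr// ler_pdivrMr// => HS.
rewrite (le_trans (ler_wpM2r (expR_ge0 _) (ler_norm K)))//.
rewrite expRN ler_pdivrMr ?expR_gt0//.
rewrite (le_trans HS)// mulrC ler_wpM2l ?(ltW e0)//.
by rewrite mulrC (le_trans _ (expR_ge1Dx _))// lerDr.
Qed.

Lemma cabs_cexpN (p : C) s : cabs (cexp (- (p * ofR s))) = expR (- (re p * s)).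
Proof. by rewrite cabs_cexp !reimE mulr0 subr0. Qed.

Lemma cder_cexpN (p : C) s : cder (fun s => cexp (- (p * ofR s))) s (- p * cexp (- (p * ofR s))).
Proof.
apply: cder_cexp.
apply: cder_ext (cder_eq (cderZ (- p) (cder_ofR (is_derive_id s (1 : R)))) _).
  by move=> t; rewrite mulNr.
by rewrite ofR1 mulr1.
Qed.

(** Integration by parts: the growth bound with [c < re p] kills the boundary term at infinity, and
    [b 0 = 0] the one at 0. *)
Lemma LT_prim p b b1 v (K c : R) : c < re p -> p != 0 ->
  (forall s, 0 <= s -> cder b s (b1 s)) -> b 0 = 0 ->
  (forall s, 0 <= s -> cabs (b s) <= K * expR (c * s)) ->
  LT p b1 v -> LT p b (v / p).
Proof.
move=> cp p0 db b0 bK [Y [dY Y0 Yv]].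
exists (fun s => p^-1 * (Y s - b s * cexp (- (p * ofR s)))); split.
- move=> s s0.
  apply: cder_eq (cderZ p^-1 (cderB (dY s s0) (cderM (db s s0) (cder_cexpN p s)))) _.
  by field.
- by rewrite Y0 b0 mul0r subr0 mulr0.
move=> e e0; have q0 : 0 < cabs p by rewrite cabs_gt0.
have e1 : 0 < e * cabs p / 2 by rewrite divr_gt0 ?mulr_gt0.
have [S1 H1] := Yv _ e1.
have pc : 0 < re p - c by rewrite subr_gt0.
have [S2 [S20 H2]] := exp_decay K pc e1.
exists (Num.max S1 S2) => S; rewrite ge_max => /andP[/H1 h1 S2S].
have S0 : 0 <= S by exact: le_trans S2S.
rewrite (_ : _ - _ = p^-1 * ((Y S - v) - b S * cexp (- (p * ofR S)))); last by ring.
rewrite cabsM cabsV ler_pdivrMl// (mulrC (cabs p)) (le_trans (cabsB _ _))//.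
rewrite (splitr (e * cabs p)) lerD// cabsM cabs_cexpN.
apply: le_trans (H2 _ S2S).
apply: le_trans (ler_wpM2r (expR_ge0 _) (bK _ S0)) _.
by rewrite -mulrA -expRD le_eqVlt; apply/orP; left; apply/eqP; congr (_ * expR _); ring.
Qed.

Lemma LT_one p : 0 < re p -> LT p (fun=> 1) p^-1.
Proof.
move=> p0; have pn0 : p != 0 by apply/eqP => E; rewrite E re0 ltxx in p0.
have q0 : 0 < cabs p by rewrite cabs_gt0.
exists (fun s => p^-1 * (1 - cexp (- (p * ofR s)))); split.
- move=> s s0; apply: cder_eq (cderZ p^-1 (cderB (cder_cst 1 s) (cder_cexpN p s))) _.
  by field.
- by rewrite ofR0 mulr0 oppr0 cexp0 subrr mulr0.
move=> e e0; have [S0 [S00 H]] := exp_decay 1 p0 (mulr_gt0 e0 q0).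
exists S0 => S /H; rewrite mul1r => h.
rewrite (_ : _ - _ = - (p^-1 * cexp (- (p * ofR S)))); last by ring.
by rewrite cabsN cabsM cabsV cabs_cexpN ler_pdivrMl// (mulrC (cabs p)).
Qed.

Lemma expR_ge_pow (x : R) n : 0 <= x -> x ^+ n / n`!%:R <= expR x.
Proof.
case: n => [|n] x0.
  by rewrite expr0 fact0 divr1 -expR0 ler_expR.
by rewrite (le_trans _ (expR_ge1Dxn n x0))// lerDr.
Qed.

Lemma LT_la kap p n m : 0 < re p ->
  LT p (fun s => ofR (la kap n m s)) (p^-1 ^+ m.+1 * (ofR kap / p - 1) ^+ n).
Proof.
move=> p0; have pn0 : p != 0 by apply/eqP => E; rewrite E re0 ltxx in p0.
elim: n m => [|n ih] m; last first.
  apply: LT_ext (LT_lin (ofR kap) (-1) (ih m.+1) (ih m)).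
    by move=> s _; rewrite /= ofRB ofRM mulN1r.
  by rewrite !exprS; ring.
rewrite expr0 mulr1; elim: m => [|m ih].
  apply: LT_ext (LT_one p0); last by rewrite expr1.
  by move=> s _; rewrite /= expr0 fact0 divr1.
rewrite [_ ^+ m.+2]exprSr.
have a0 : 0 < re p / 2 by rewrite divr_gt0.
apply: (@LT_prim p _ (fun s => ofR (la kap 0 m s)) _ ((re p / 2)^-1 ^+ m.+1) (re p / 2)) => //.
- by rewrite ltr_pdivrMr// ltr_pMr// ltr1n.
- by move=> s _; apply: cder_ofR; exact: la_derive.
- by rewrite la_at0.
move=> s s0; rewrite cabs_ofR /= ger0_norm; last by rewrite divr_ge0// exprn_ge0.
have as0 : 0 <= re p / 2 * s by rewrite mulr_ge0// ltW.
have := expR_ge_pow m.+1 as0; rewrite exprMn => H.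
by rewrite exprVn ler_pdivlMl ?exprn_gt0// mulrA.
Qed.

(** The error [A B e^(kap s) / (N + 1)] of the partial sums, against [e^(- p s)] with [kap < re p],
    has a primitive bounded by [K / (N + 1)] uniformly in [s]; so the limits in [N] and in [s] can
    be exchanged. *)
Lemma LT_lser (kap : R) (w : nat -> C) (A : R) (p v : C) : 0 < kap -> kap < re p ->
  (forall n, cabs (w n) <= A) ->
  ccvg (fun N => \sum_(n < N) w n * (p^-1 ^+ 8 * (ofR kap / p - 1) ^+ n)) v ->
  LT p (lser kap w 7) v.
Proof.
move=> k0 kp wA wv.
have p0 : 0 < re p by exact: lt_trans kp.
have [B B0 HB] := @lser_rate _ _ k0 7 isT.
have A0 : 0 <= A by apply: le_trans (wA 0%N).
have db s := lser_derive k0 s wA.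
pose g s := lser kap w 7 s * cexp (- (p * ofR s)).
have dg s : exists l, cder g s l.
  by eexists; exact: cderM (db s) (cder_cexpN p s).
(* Starting at -1 makes 0 an interior point, where the primitive has a two-sided derivative; [lser]
   makes sense for negative [s] thanks to [lap]. *)
have [|s _|Y0 dY0] := @antiderivative_ray (-1) g.
- by move=> s _; have [l /cder_continuous[]] := dg s.
- by have [l /cder_continuous[]] := dg s.
pose Y s := Y0 s - Y0 0.
have dY (s : R) : 0 <= s -> cder Y s (g s).
  move=> s0; apply: cder_eq (cderB (dY0 s _) (cder_cst _ s)) _; last by rewrite subr0.
  by apply: lt_le_trans s0; rewrite ltrN10.
exists Y; split; first exact: dY; first by rewrite /Y subrr.
have [Z HZ] := choice (fun n => LT_la kap n 7 p0).
pose ZN N s := \sum_(n < N) w n * Z n s.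
have dZ N (s : R) : 0 <= s -> cder (ZN N) s (lpart kap w 7 N s * cexp (- (p * ofR s))).
  move=> s0.
  have h := @cder_sum _ N (fun n s => w n * Z n s) s
    (fun n => w n * (ofR (la kap n 7 s) * cexp (- (p * ofR s)))).
  apply: cder_eq (h _) _.
    by move=> n _; apply: cderZ; have [d _ _] := HZ n; exact: d.
  by rewrite /lpart mulr_suml; apply: eq_bigr => n _; rewrite lap_ge0// mulrA.
have ZN0 N : ZN N 0 = 0.
  by rewrite /ZN big1// => n _; have [_ -> _] := HZ n; rewrite mulr0.
have pk : 0 < re p - kap by rewrite subr_gt0.
pose K := A * B / (re p - kap).
have K0 : 0 <= K by rewrite divr_ge0 ?mulr_ge0// ltW.
have dist N (s : R) : 0 <= s -> cabs (ZN N s - Y s) <= K / N.+1%:R.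
  move=> s0.
  pose D := re p - kap.
  pose E u := - (A * B / N.+1%:R / D) * expR (- (D * u)).
  have dE (u : R) : is_derive u 1 E (A * B / N.+1%:R * expR (- (D * u))).
    have H : is_derive u 1 (fun u => - (D * u)) (- D).
      have := is_deriveZ (- D) (is_derive_id u (1 : R)).
      rewrite /GRing.scale /= mulr1 => H.
      by have -> : (fun u => - (D * u)) = - D \*: id; [apply/funext => t; rewrite /= /GRing.scale /= mulNr|].
    have H' := @is_derive1_comp _ expR (fun u => - (D * u)) u _ _ (is_derive_expR _) H.
    have H'' := is_deriveZ (- (A * B / N.+1%:R / D)) H'.
    apply: (is_derive_eq H''); rewrite /GRing.scale /=.
    have D0 : D != 0 by rewrite gt_eqF.
    have N0 : N.+1%:R != 0 :> R by rewrite pnatr_eq0.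
    move: (expR _) (N.+1%:R) N0 => x y y0; field.
    by rewrite ?D0 ?y0.
  have := @cder_le _ 0 s (fun u => ZN N u - Y u) _ E _ s0
    (fun x xP => cderB (dZ N x (andP xP).1) (dY x (andP xP).1)) (fun x _ => dE x).
  rewrite ZN0 /Y subrr subr0 subr0 => H; apply: le_trans (H _) _.
    move=> x /andP[x0 _] /=; rewrite /g -mulrBl cabsM cabs_cexpN.
    apply: le_trans (ler_wpM2r (expR_ge0 _) (HB w A wA x N)) _.
    rewrite le_eqVlt; apply/orP; left; apply/eqP.
    have -> : expR (- (D * x)) = expR (kap * x) * expR (- (re p * x)).
      by rewrite -expRD /D; congr expR; ring.
    by ring.
  rewrite /E mulr0 oppr0 expR0 mulr1 opprK addrC mulNr.
  rewrite -[leRHS]subr0 lerB//; first by rewrite /K /D mulrAC.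
  by rewrite !mulr_ge0 ?expR_ge0 ?invr_ge0 ?(ltW pk).
move=> e e0; have e3 : 0 < e / 3 by rewrite divr_gt0.
have [N1 H1] := rcvg0Z K0 (@rcvg0_harmonic R) e3.
have [N2 H2] := wv _ e3.
pose N := maxn N1 N2.
have h1 := H1 _ (leq_maxl N1 N2); have h2 := H2 _ (leq_maxr N1 N2).
have [S0 HS0] : exists S0, forall S, S0 <= S ->
    cabs (ZN N S - \sum_(n < N) w n * (p^-1 ^+ 8 * (ofR kap / p - 1) ^+ n)) <= e / 3.
  have aux M : forall e, 0 < e -> exists S0, forall S, S0 <= S ->
    cabs (ZN M S - \sum_(n < M) w n * (p^-1 ^+ 8 * (ofR kap / p - 1) ^+ n)) <= e.
    elim: M => [|M ih] eps eps0.
      by exists 0 => S _; rewrite /ZN !big_ord0 subrr cabs0 ltW.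
    have [S1 HS1] := ih _ (divr_gt0 eps0 (ltr0n _ 2)).
    have wp : 0 < cabs (w M) + 1 by rewrite ltr_wpDl.
    have [_ _ HM] := HZ M; have [S2 HS2] := HM _ (divr_gt0 (divr_gt0 eps0 (ltr0n _ 2)) wp).
    exists (Num.max S1 S2) => S; rewrite ge_max => /andP[/HS1 k1 /HS2 k2].
    rewrite /ZN !big_ord_recr /= -/(ZN M S) opprD addrACA -mulrBr.
    rewrite (le_trans (cabsD _ _))// (splitr eps) lerD// cabsM.
    apply: le_trans (ler_wpM2l (cabs_ge0 _) k2) _.
    by rewrite mulrCA ler_piMr ?divr_ge0 ?(ltW eps0)// ler_pdivrMr// mul1r lerDl.
  exact: aux.
exists (Num.max 0 S0) => S; rewrite ge_max => /andP[Sge0 /HS0 h3].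
have h4 := dist N S Sge0.
have h5 := cabs_tri (ZN N S) (Y S) v; rewrite (cabsBC (Y S) (ZN N S)) in h5.
have h6 := cabs_tri (\sum_(n < N) w n * (p^-1 ^+ 8 * (ofR kap / p - 1) ^+ n)) (ZN N S) v.
have h7 : cabs (ZN N S - Y S) <= e / 3 by exact: le_trans h1.
lra.
Qed.

End LaplaceTransform.

(** * From primitives to Lebesgue integrals *)

Section LaplaceIntegral.
Variable R : realType.
Local Notation C := (CC R).
Local Notation mu := lebesgue_measure.

Lemma ge0_integral_ray (f Y : R -> R) (l : R) :
  (forall x, 0 <= x -> {for x, continuous f}) -> (forall x, 0 <= x -> 0 <= f x) ->
  (forall x : R, 0 <= x -> is_derive x 1 Y (f x)) ->
  (forall e, 0 < e -> exists S0, forall S, S0 <= S -> `|Y S - l| <= e) ->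
  lebesgue_measure.-integrable `[0, +oo[ (fun x => (f x)%:E) /\
  (\int[lebesgue_measure]_(x in `[0%R, +oo[) (f x)%:E = (l - Y 0)%:E)%E.
Proof.
move=> cf f0 dY Yl.
have wf : {within `[0, +oo[, continuous f}.
  by apply: continuous_in_subspaceT => x; rewrite inE /= in_itv /= andbT; exact: cf.
have E : (\int[lebesgue_measure]_(x in `[0%R, +oo[) (f x)%:E = l%:E - (Y 0)%:E)%E.
  apply: ge0_continuous_FTC2y => //.
  - apply/cvgrPdist_le => e /Yl[S0 HS0]; near=> x.
    by rewrite distrC; apply: HS0; near: x; apply: nbhs_pinfty_ge; exact: num_real.
  - by move=> x x0; case: (dY x (ltW x0)).
  - apply: cvg_at_right_filter; apply: differentiable_continuous.
    by apply/derivable1_diffP; case: (dY 0 (lexx _)).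
  - move=> x; rewrite in_itv /= andbT => x0; rewrite derive1E.
    by have [] := dY x (ltW x0).
split; last by rewrite E -EFinB.
apply/integrableP; split.
  apply/measurable_realfun.measurable_EFinP.
  by apply: measurable_realfun.subspace_continuous_measurable_fun => //; exact: measurable_itv.
rewrite [X in (X < _)%E](_ : _ = (l%:E - (Y 0)%:E)%E) -?EFinB ?ltry//.
rewrite EFinB -E; apply: eq_integral => x; rewrite inE /= in_itv /= andbT => x0.
by rewrite ger0_norm ?f0.
Unshelve. all: by end_near. Qed.

(** Adding the majorant [K e^(- d x)], whose primitive is explicit, makes the integrand nonnegative,
    so that [ge0_integral_ray] applies; the majorant is then subtracted. *)
Lemma integral_ray (f Y : R -> R) (K d l : R) : 0 < d ->
  (forall x, 0 <= x -> {for x, continuous f}) ->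
  (forall x, 0 <= x -> `|f x| <= K * expR (- (d * x))) ->
  (forall x : R, 0 <= x -> is_derive x 1 Y (f x)) ->
  Y 0 = 0 ->
  (forall e, 0 < e -> exists S0, forall S, S0 <= S -> `|Y S - l| <= e) ->
  lebesgue_measure.-integrable `[0, +oo[ (fun x => (f x)%:E) /\
  \int[lebesgue_measure]_(x in `[0, +oo[) f x = l.
Proof.
move=> d0 cf fK dY Y0 Yl.
have K0 : 0 <= K.
  by have := fK 0 (lexx _); rewrite mulr0 oppr0 expR0 mulr1; apply: le_trans.
pose g x := K * expR (- d * x).
pose G x := - (K / d) * expR (- d * x).
have dexp (u : R) : is_derive u 1 (fun u => expR (- d * u)) (- d * expR (- d * u)).
  have := is_deriveZ (- d) (is_derive_id u (1 : R)).
  rewrite /GRing.scale /= mulr1 => H.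
  have := @is_derive1_comp _ expR (fun u => - d * u) u _ _ (is_derive_expR _) H.
  by move=> H'; apply: (is_derive_eq H'); rewrite mulrC.
have dG (u : R) : is_derive u 1 G (g u).
  apply: (is_derive_eq (is_deriveZ (- (K / d)) (dexp u))).
  by rewrite /GRing.scale /= /g; field; rewrite gt_eqF.
have cg (u : R) : {for u, continuous g}.
  apply: differentiable_continuous; apply/derivable1_diffP.
  by case: (is_deriveZ K (dexp u)).
have g0 x : 0 <= g x by rewrite mulr_ge0 ?expR_ge0.
have Glim e : 0 < e -> exists S0, forall S, S0 <= S -> `|G S - 0| <= e.
  move=> e0; have [S0 [_ H]] := exp_decay (K / d) d0 e0; exists S0 => S /H.
  by rewrite subr0 /G mulNr normrN ger0_norm ?mulNr// mulr_ge0 ?expR_ge0// divr_ge0// ltW.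
have [ig Ig] := ge0_integral_ray (fun x _ => cg x) (fun x _ => g0 x) (fun x _ => dG x) Glim.
have [||||ifg Ifg] := @ge0_integral_ray (fun x => f x + g x) (fun x => Y x + G x) l.
- by move=> x x0; apply: continuousD; [exact: cf|exact: cg].
- move=> x x0; have := fK x x0; rewrite ler_norml /g mulNr => /andP[h _]; lra.
- by move=> x x0; exact: (is_deriveD (dY x x0) (dG x)).
- move=> e e0; have e20 : 0 < e / 2 by rewrite divr_gt0.
  have [S1 H1] := Yl _ e20; have [S2 H2] := Glim _ e20.
  exists (Num.max S1 S2) => S; rewrite ge_max => /andP[/H1 h1 /H2]; rewrite subr0 => h2.
  by rewrite addrAC (le_trans (ler_normD _ _))// (splitr e) lerD.
have mI : measurable (`[0, +oo[%classic : set R) by exact: measurable_itv.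
have fE : (fun x => (f x)%:E) = ((fun x => (f x + g x)%:E) \- (fun x => (g x)%:E))%E.
  by apply/funext => x /=; rewrite -EFinB addrK.
split; first by rewrite fE; exact: integrableB.
have -> : f = (fun x => (f x + g x) - g x) by apply/funext => x; rewrite addrK.
rewrite RintegralB// /Rintegral Ifg Ig /= Y0; ring.
Qed.

Lemma LT_is_laplace t (phi : C -> C) (h v : C) (b : R -> C) (K c : R) :
  (forall r, 0 <= r -> phi (ofR r * dir t) * dir t = b r) ->
  (forall r, 0 <= r -> exists l, cder b r l) ->
  (forall r, 0 <= r -> cabs (b r) <= K * expR (c * r)) ->
  c < re (dir t / h) -> LT (dir t / h) b v -> is_laplace t phi h v.
Proof.
move=> phib db bK cp [Y [dY Y0 Yv]].
set p := dir t / h in cp dY.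
pose g r := b r * cexp (- (p * ofR r)).
have gE r : 0 <= r -> laplace_integrand t phi h r = g r.
  move=> r0; rewrite /laplace_integrand /g -(phib r r0).
  have -> : - (ofR r * dir t) / h = - (p * ofR r) by rewrite /p; ring.
  by ring.
have p0 : 0 < re p - c by rewrite subr_gt0.
have gK r : 0 <= r -> cabs (g r) <= K * expR (- ((re p - c) * r)).
  move=> r0; rewrite cabsM cabs_cexpN (le_trans (ler_wpM2r (expR_ge0 _) (bK r r0)))//.
  rewrite -mulrA -expRD le_eqVlt; apply/orP; left; apply/eqP.
  by congr (_ * expR _); ring.
have cg r : 0 <= r -> {for r, continuous (fun u => re (g u))} /\ {for r, continuous (fun u => im (g u))}.
  by move=> r0; have [l dl] := db r r0; exact: cder_continuous (cderM dl (cder_cexpN p r)).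
have Yre e : 0 < e -> exists S0, forall S, S0 <= S -> `|re (Y S) - re v| <= e.
  by move=> /Yv[S0 H]; exists S0 => S /H; apply: le_trans; rewrite -reB re_le_cabs.
have Yim e : 0 < e -> exists S0, forall S, S0 <= S -> `|im (Y S) - im v| <= e.
  by move=> /Yv[S0 H]; exists S0 => S /H; apply: le_trans; rewrite -imB im_le_cabs.
have [ir Ir] := integral_ray p0 (fun r r0 => (cg r r0).1)
  (fun r r0 => le_trans (re_le_cabs _) (gK r r0)) (fun r r0 => (dY r r0).1) (congr1 (@re R) Y0) Yre.
have [ii Ii] := integral_ray p0 (fun r r0 => (cg r r0).2)
  (fun r r0 => le_trans (im_le_cabs _) (gK r r0)) (fun r r0 => (dY r r0).2) (congr1 (@im R) Y0) Yim.
have mI : measurable (`[0, +oo[%classic : set R) by exact: measurable_itv.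
split.
- apply: (eq_integrable _ _ _ _ ir); [exact: measurable_itv|move=> r]; rewrite inE /= in_itv /= andbT => r0.
  by rewrite gE.
- apply: (eq_integrable _ _ _ _ ii); [exact: measurable_itv|move=> r]; rewrite inE /= in_itv /= andbT => r0.
  by rewrite gE.
rewrite [X in Complex X _](_ : _ = re v); last first.
  by rewrite -Ir; apply: eq_Rintegral => r; rewrite inE /= in_itv /= andbT => /gE ->.
rewrite [X in Complex _ X](_ : _ = im v); last first.
  by rewrite -Ii; apply: eq_Rintegral => r; rewrite inE /= in_itv /= andbT => /gE ->.
exact: complexP.
Qed.

End LaplaceIntegral.

(** * Nevanlinna's theorem *)

Lemma open_setX (T U : topologicalType) (A : set T) (B : set U) :
  open A -> open B -> open (A `*` B).
Proof.
move=> oA oB; rewrite openE => -[x y] [/= Ax By].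
exists (A, B) => //=; split; exact: open_nbhs_nbhs.
Qed.

(** * Analytic continuation from a ray to a tube *)

Section TubeExtension.
Variable R : realType.
Local Notation C := (CC R).
Variables (V : normedModType C) (X : set V) (b : nat -> V -> R -> C) (A N L : R).
Hypothesis oX : open X.
Hypothesis hb : forall j s, 0 <= s -> holomorphic X (fun x => b j x s).
Hypothesis db : forall j x s, X x -> 0 <= s -> cder (b j x) s (b j.+1 x s).
Hypothesis A0 : 0 <= A.
Hypothesis N0 : 0 < N.
Hypothesis L0 : 0 <= L.
Hypothesis bb : forall j x s, X x -> 0 <= s -> cabs (b j x s) <= A * N ^+ j * j`!%:R * expR (L * s).

Definition tpoly x (u : C) n (s : R) : C :=
  \sum_(j < n) b j x s * (j`!%:R^-1 * (u - ofR s) ^+ j).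

Definition tsum x (u : C) (s : R) : C := xget 0 [set l | ccvg (fun n => tpoly x u n s) l].

(** At distance less than [eps] the Taylor terms decay like [4^-n]; the margin absorbs the factor
    [n + 1] that appears when the base point moves, as [(n + 1) 4^-n <= 2 * 2^-n]. *)
Let eps := (4 * N)^-1.

Let eps0 : 0 < eps. Proof. by rewrite invr_gt0 mulr_gt0. Qed.

Let Neps : N * eps = 4^-1.
Proof. by rewrite /eps invfM mulrCA divff ?mulr1// gt_eqF. Qed.

Lemma tpoly_dist x u s n k : X x -> 0 <= s -> cabs (u - ofR s) < eps ->
  cabs (tpoly x u (n + k) s - tpoly x u n s) <= A * expR (L * s) * 2 * 2^-1 ^+ n.
Proof.
move=> Xx s0 us.
have P0 : 0 <= A * expR (L * s) by rewrite mulr_ge0 ?expR_ge0.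
have term j : cabs (b j x s * (j`!%:R^-1 * (u - ofR s) ^+ j)) <= A * expR (L * s) * 2^-1 ^+ j.
  have f0 : 0 < j`!%:R :> R by rewrite ltr0n fact_gt0.
  rewrite !cabsM cabsV cabs_nat cabsX.
  have h1 : cabs (u - ofR s) ^+ j <= eps ^+ j by rewrite lerXn2r ?nnegrE// ltW.
  apply: (@le_trans _ _ (A * N ^+ j * j`!%:R * expR (L * s) * (j`!%:R^-1 * eps ^+ j))).
    apply: ler_pM => //; first by rewrite mulr_ge0 ?invr_ge0 ?(ltW f0)// exprn_ge0.
      exact: bb.
    by rewrite ler_wpM2l// invr_ge0 ltW.
  have -> : A * N ^+ j * j`!%:R * expR (L * s) * (j`!%:R^-1 * eps ^+ j) =
    A * expR (L * s) * (N * eps) ^+ j by rewrite exprMn; field; rewrite gt_eqF.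
  rewrite Neps ler_wpM2l// lerXn2r ?nnegrE//.
  by rewrite lef_pV2 ?posrE// ler_nat.
elim: k => [|k ih]; first by rewrite addn0 subrr cabs0 !mulr_ge0 ?exprn_ge0.
have gen : cabs (tpoly x u (n + k.+1) s - tpoly x u n s) <=
    A * expR (L * s) * \sum_(n <= j < n + k.+1) 2^-1 ^+ j.
  have -> : tpoly x u (n + k.+1) s - tpoly x u n s =
      \sum_(n <= j < n + k.+1) b j x s * (j`!%:R^-1 * (u - ofR s) ^+ j).
    rewrite /tpoly -!(big_mkord xpredT (fun j => b j x s * (j`!%:R^-1 * (u - ofR s) ^+ j))).
    by rewrite (@big_cat_nat _ _ _ n 0 (n + k.+1))//= ?leq_addr// [LHS]addrC addKr.
  rewrite mulr_sumr (le_trans (cabs_sum _ _ _))// ler_sum// => j _; exact: term.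
apply: (le_trans gen); rewrite -!mulrA; apply: ler_wpM2l => //.
apply: ler_wpM2l; first exact: expR_ge0.
have : \sum_(n <= j < n + k.+1) 2^-1 ^+ j = 2 * 2^-1 ^+ n - 2 * 2^-1 ^+ (n + k.+1) :> R.
  elim: (k.+1) => [|m ihm]; first by rewrite addn0 big_geq// subrr.
  rewrite addnS big_nat_recr ?leq_addr//= ihm exprS; by field.
by move=> ->; rewrite gerBl mulr_ge0// exprn_ge0.
Qed.

Lemma tsum_rate x u s n : X x -> 0 <= s -> cabs (u - ofR s) < eps ->
  cabs (tpoly x u n s - tsum x u s) <= A * expR (L * s) * 2 * 2^-1 ^+ n.
Proof.
move=> Xx s0 us.
have P0 : 0 <= A * expR (L * s) * 2 by rewrite !mulr_ge0 ?expR_ge0.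
have h2 : (2^-1 : R) < 1 by rewrite invf_lt1// ltr1n.
have h2' : 0 <= (2^-1 : R) by rewrite invr_ge0.
have [l Hl] : exists l, ccvg (fun n => tpoly x u n s) l.
  apply: ccauchy => e e0.
  have [M HM] := rcvg0Z P0 (rcvg0_geometric h2' h2) (divr_gt0 e0 (ltr0n _ 2)).
  exists M => m k Mm Mk.
  rewrite (le_trans (cabs_tri (tpoly x u M s) _ _))// (splitr e) lerD//.
    by rewrite -(subnKC Mm) (le_trans (tpoly_dist M _ Xx s0 us))// HM.
  by rewrite cabsBC -(subnKC Mk) (le_trans (tpoly_dist M _ Xx s0 us))// HM.
have Hser : ccvg (fun n => tpoly x u n s) (tsum x u s).
  by rewrite /tsum; case: xgetP => [y _ //|/(_ l)].
rewrite cabsBC.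
apply: (ccvg_le (ccvgD Hser (ccvg_cst (- tpoly x u n s)))).
by exists n => m nm; rewrite -(subnKC nm); exact: tpoly_dist.
Qed.

Lemma tsum_cvg x u s : X x -> 0 <= s -> cabs (u - ofR s) < eps ->
  ccvg (fun n => tpoly x u n s) (tsum x u s).
Proof.
move=> Xx s0 us.
have P0 : 0 <= A * expR (L * s) * 2 by rewrite !mulr_ge0 ?expR_ge0.
have h2 : (2^-1 : R) < 1 by rewrite invf_lt1// ltr1n.
have h2' : 0 <= (2^-1 : R) by rewrite invr_ge0.
exact: (ccvg_rate (rcvg0Z P0 (rcvg0_geometric h2' h2)) (fun n => tsum_rate n Xx s0 us)).
Qed.

(* The derivative of a Taylor polynomial with respect to its base point
   telescopes. *)
Lemma tpoly_derive x u n s : X x -> 0 <= s ->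
  cder (tpoly x u n.+1) s (b n.+1 x s * (n`!%:R^-1 * (u - ofR s) ^+ n)).
Proof.
move=> Xx s0.
have d0 : cder (fun s => u - ofR s) s (- 1).
  by apply: cder_eq (cderB (cder_cst u s) (cder_ofR (is_derive_id s (1 : R)))) _; rewrite ofR1 sub0r.
have dp k : cder (fun s => (u - ofR s) ^+ k.+1) s (- k.+1%:R * (u - ofR s) ^+ k).
  elim: k => [|k ih].
    by apply: cder_eq d0 _; rewrite expr0 mulr1.
  under eq_fun do rewrite exprS.
  apply: cder_eq (cderM d0 ih) _.
  by rewrite [in RHS]exprS -[in RHS]natr1 exprS; ring.
elim: n => [|n ih].
  apply: cder_ext (cder_eq (db 0 Xx s0) _).
    by move=> t; rewrite /tpoly big_ord1 fact0 invr1 expr0 !mulr1.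
  by rewrite fact0 invr1 expr0 !mulr1.
have H := cderD ih (cderM (db n.+1 Xx s0) (cderZ (n.+1)`!%:R^-1 (dp n))).
apply: cder_ext (cder_eq H _).
  by move=> t; rewrite [RHS]/tpoly big_ord_recr.
rewrite factS natrM invfM.
have n0 : n.+1%:R != 0 :> C by rewrite pnatr_eq0.
have f0 : n`!%:R != 0 :> C by rewrite pnatr_eq0 -lt0n fact_gt0.
move: (n.+1%:R) n0 (n`!%:R) f0 => a a0 c c0; move: (_ ^+ n) (_ ^+ n.+1) => y z.
by field; rewrite a0 c0.
Qed.

(** All base points between [s] and [s'] are closer to [u] than one of these two, hence within
    [eps]. On this segment the derivative [tpoly_derive] of the Taylor polynomial tends to 0
    uniformly as the degree grows, so the two sums agree. *)
Lemma tsum_indep x u s s' : X x -> 0 <= s -> s <= s' ->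
  cabs (u - ofR s) < eps -> cabs (u - ofR s') < eps -> tsum x u s = tsum x u s'.
Proof.
move=> Xx s0 ss us us'; have s'0 : 0 <= s' by exact: le_trans ss.
have mid v : s <= v <= s' -> cabs (u - ofR v) < eps.
  move=> vP; rewrite -(@ltr_pXn2r _ 2)// ?nnegrE ?(ltW eps0)//.
  have h1 : cabs (u - ofR s) ^+ 2 < eps ^+ 2 by rewrite ltr_pXn2r// ?nnegrE ?(ltW eps0).
  have h2 : cabs (u - ofR s') ^+ 2 < eps ^+ 2 by rewrite ltr_pXn2r// ?nnegrE ?(ltW eps0).
  move: h1 h2; rewrite !cabs2 !reimE subr0.
  have [|] := leP (re u) v => h; nra.
apply: (ccvg_uniq (tsum_cvg Xx s0 us)).
have P0 : 0 <= A * N * expR (L * s') * (s' - s) * 2.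
  by rewrite !mulr_ge0 ?expR_ge0 ?(ltW N0)// subr_ge0.
have h2 : (2^-1 : R) < 1 by rewrite invf_lt1// ltr1n.
have h2' : 0 <= (2^-1 : R) by rewrite invr_ge0.
have dist n : cabs (tpoly x u n.+1 s' - tpoly x u n.+1 s) <= A * N * expR (L * s') * (s' - s) * 2 * 2^-1 ^+ n.
  apply: le_trans (cder_le_cst (M := A * N * expR (L * s') * 2 * 2^-1 ^+ n) ss
    (fun v vP => tpoly_derive u n Xx (le_trans s0 (andP vP).1)) _) _; last first.
    by rewrite le_eqVlt; apply/orP; left; apply/eqP; ring.
  move=> v vP; have v0 : 0 <= v by case/andP: vP => h _; exact: le_trans h.
  have f0 : 0 < n`!%:R :> R by rewrite ltr0n fact_gt0.
  rewrite !cabsM cabsV cabs_nat cabsX.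
  have h1 : cabs (u - ofR v) ^+ n <= eps ^+ n.
    by rewrite lerXn2r ?nnegrE ?(ltW eps0)// ltW// mid.
  apply: (@le_trans _ _ (A * N ^+ n.+1 * (n.+1)`!%:R * expR (L * s') * (n`!%:R^-1 * eps ^+ n))).
    apply: ler_pM => //; first by rewrite mulr_ge0 ?invr_ge0 ?(ltW f0)// exprn_ge0.
      apply: (le_trans (bb n.+1 Xx v0)); rewrite ler_wpM2l ?mulr_ge0 ?exprn_ge0 ?(ltW N0)//.
      by rewrite ler_expR ler_wpM2l//; case/andP: vP.
    by rewrite ler_wpM2l// invr_ge0 ltW.
  have -> : A * N ^+ n.+1 * (n.+1)`!%:R * expR (L * s') * (n`!%:R^-1 * eps ^+ n) =
    A * N * expR (L * s') * (n.+1%:R * (N * eps) ^+ n).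
    rewrite factS natrM exprMn exprS; move: (n.+1%:R) => y; field.
    by rewrite gt_eqF.
  rewrite Neps -[leRHS]mulrA; apply: ler_wpM2l; first by rewrite !mulr_ge0 ?expR_ge0 ?(ltW N0).
  have -> : (4^-1 : R) = 2^-1 * 2^-1 by field.
  rewrite exprMn mulrA ler_wpM2r ?exprn_ge0//.
  rewrite exprVn ler_pdivrMr ?exprn_gt0// -exprS -natrX ler_nat.
  exact: ltnW (ltn_expl _ _).
move=> e e0; have e20 : 0 < e / 2 by rewrite divr_gt0.
have [M1 H1] := rcvg0Z P0 (rcvg0_geometric h2' h2) e20.
have [M2 H2] := tsum_cvg Xx s'0 us' e20.
exists (maxn M1.+1 M2) => -[|n]; first by rewrite geq_max.
rewrite geq_max ltnS => /andP[n1 n2].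
rewrite (le_trans (cabs_tri (tpoly x u n.+1 s') _ _))// (splitr e) lerD ?H2//.
by rewrite cabsBC (le_trans (dist n))// H1.
Qed.

(** The point of the half-line closest to [u]. It is a canonical base point, within [eps] of [u] as
    soon as some point of the half-line is. *)
Definition base (u : C) : R := Num.max (re u) 0.

Lemma base_ge0 u : 0 <= base u. Proof. by rewrite le_max lexx orbT. Qed.

Lemma base_le u : base u <= cabs u.
Proof. by rewrite ge_max cabs_ge0 ge_re_cabs. Qed.

Lemma base_closest u r : 0 <= r -> cabs (u - ofR (base u)) <= cabs (u - ofR r).
Proof.
move=> r0; rewrite -(@ler_pXn2r _ 2)// ?nnegrE// !cabs2 !reimE subr0 lerD2r.
rewrite /base; case: (leP (re u) 0) => h; last by rewrite subrr expr0n /= sqr_ge0.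
rewrite -subr_ge0 (_ : _ - _ = r * r + 2 * (r * - re u)); last by ring.
by rewrite addr_ge0 ?mulr_ge0// oppr_ge0.
Qed.

Lemma tsum_base x u r : X x -> 0 <= r -> cabs (u - ofR r) < eps ->
  tsum x u (base u) = tsum x u r.
Proof.
move=> Xx r0 ur; have ub := le_lt_trans (base_closest u r0) ur.
have [h|/ltW h] := leP (base u) r; first exact: tsum_indep (base_ge0 u) h ub ur.
by apply/esym; exact: tsum_indep r0 h ur ub.
Qed.

Lemma tube_extension (t : R) : exists phi : V -> C -> C,
  [/\ holomorphic (X `*` tube t eps) (fun p => phi p.1 p.2),
      forall x r, X x -> 0 <= r -> phi x (ofR r * dir t) * dir t = b 0%N x r,
      forall x xi, X x -> tube t eps xi -> cabs (phi x xi) <= A * 2 * expR (L * cabs xi) &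
      forall x xi, X x -> cabs xi < eps ->
        ccvg (fun n => \sum_(j < n) (dir t)^-1 * (b j x 0 * (j`!%:R^-1 * (xi / dir t) ^+ j))) (phi x xi)].
Proof.
pose e : C := dir t.
have e0 : e != 0 := dir_neq0 t.
have ce : cabs e = 1 := cabs_dir t.
(* The tube is rotated onto the positive half-line. The factor [e^-1] is there because [b 0]
   includes the factor [dir t] of [laplace_integrand]. *)
pose phi x xi := e^-1 * tsum x (xi / e) (base (xi / e)).
have tubeP xi : tube t eps xi -> exists2 r, 0 <= r & cabs (xi / e - ofR r) < eps.
  move=> [r r0 H]; exists r => //; move: H; rewrite -[dir t]/e.
  have -> : xi - ofR r * e = (xi / e - ofR r) * e by field.
  by rewrite cabsM ce mulr1.
exists phi; split.
- move=> [x0 xi0] [/= Xx0 /tubeP[r r0 Hr]].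
  (* The canonical base point moves with [xi]; near [xi0] it is traded for the fixed [r], for which
     the Taylor polynomials are holomorphic and converge uniformly on [X] times [W]. *)
  pose W := [set xi : C | cabs (xi / e - ofR r) < eps].
  have oW : open W.
    rewrite openE => xi Wxi.
    have d0 : 0 < eps - cabs (xi / e - ofR r) by rewrite subr_gt0.
    rewrite /interior -[nbhs xi W]/(\forall z \near xi, W z) (near_shift (0 : C^o) (xi : C^o)).
    apply/near0P; exists (eps - cabs (xi / e - ofR r)) => // v; rewrite nrmC => vd.
    rewrite /W /= subr0; have -> : (v + xi) / e - ofR r = (xi / e - ofR r) + v / e by field.
    by rewrite (le_lt_trans (cabsD _ _))// cabsM cabsV ce invr1 mulr1 -ltrBrDl.
  have oXW : open (X `*` W) by exact: open_setX.
  apply: (@holo_lim _ _ (X `*` W) (fun n p => e^-1 * tpoly p.1 (p.2 / e) n r) _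
    (fun n => A * expR (L * r) * 2 * 2^-1 ^+ n) oXW _ _ _ (x0, xi0)) => //.
  + move=> n; apply: holoZ; apply: holo_sum => j; apply: holoM.
      by apply: (holo_fst (f := fun x => b j x r)); exact: hb.
    apply: holoZ; apply: holoX; apply: holoB; last exact: holo_cst.
    by apply: holoM; [by apply: (holo_snd (f := id)); exact: holo_id|exact: holo_cst].
  + apply: rcvg0Z; first by rewrite !mulr_ge0 ?expR_ge0.
    by apply: rcvg0_geometric; rewrite ?invr_ge0// invf_lt1// ltr1n.
  + move=> n [x xi] [/= Xx Wxi]; rewrite /phi -mulrBr cabsM cabsV ce invr1 mul1r.
    by rewrite (tsum_base Xx r0 Wxi); exact: tsum_rate.
- move=> x r Xx r0; rewrite /phi -/e mulfK// mulrAC mulVf// mul1r.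
  have rr : cabs (ofR r - ofR r : C) < eps by rewrite subrr cabs0.
  rewrite (tsum_base Xx r0 rr).
  apply: (ccvg_uniq (tsum_cvg Xx r0 rr)) => d d0; exists 1%N => -[//|n] _.
  rewrite /tpoly big_ord_recl big1; last first.
    by move=> i _; rewrite subrr /bump /= exprS mul0r !mulr0.
  by rewrite fact0 invr1 expr0 !mulr1 addr0 subrr cabs0 ltW.
- move=> x xi Xx /tubeP[r r0 Hr]; rewrite /phi cabsM cabsV ce invr1 mul1r.
  have ub := le_lt_trans (base_closest (xi / e) r0) Hr.
  have := tsum_rate 0 Xx (base_ge0 (xi / e)) ub.
  rewrite /tpoly big_ord0 sub0r cabsN expr0 mulr1 => H; apply: (le_trans H).
  rewrite mulrAC ler_wpM2l ?mulr_ge0// ler_expR ler_wpM2l//.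
  by rewrite (le_trans (base_le _))// cabsM cabsV ce invr1 mulr1.
- move=> x xi Xx xieps; rewrite /phi -/e.
  have u0 : cabs (xi / e - ofR 0) < eps by rewrite subr0 cabsM cabsV ce invr1 mulr1.
  rewrite (tsum_base Xx (lexx 0) u0).
  apply: ccvg_ext (ccvgZ e^-1 (tsum_cvg Xx (lexx 0) u0)) => n.
  by rewrite mulr_sumr; apply: eq_bigr => j _; rewrite subr0.
Qed.

End TubeExtension.

(** * Borel discs, coefficient bounds and factorials *)

Section NevanlinnaPrelim.
Variable R : realType.
Local Notation C := (CC R).

Lemma borel_discP (t rho : R) (h : C) : borel_disc t rho h <-> rho^-1 < re (dir t / h).
Proof. by []. Qed.

Lemma borel_disc_neq0 (t rho : R) (h : C) : 0 < rho -> borel_disc t rho h -> h != 0.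
Proof.
move=> r0 /borel_discP H; apply/eqP => E; move: H.
by rewrite E invr0 mulr0 re0 ltNge invr_ge0 (ltW r0).
Qed.

Lemma reV (z : C) : re z^-1 = re z / cabs z ^+ 2.
Proof.
have [->|z0] := eqVneq z 0; first by rewrite invr0 re0 mul0r.
have c0 : cabs z ^+ 2 != 0 by rewrite expf_neq0// cabs_eq0.
have E : z^-1 = Complex (re z) (- im z) * ofR (cabs z ^+ 2)^-1.
  apply: (mulfI z0); rewrite divff// mulrA.
  have -> : z * Complex (re z) (- im z) = ofR (cabs z ^+ 2).
    by apply: complexP; rewrite cabs2 !reimE /re /im /=; case: (z) => a b /=; ring.
  by rewrite -ofRM divff.
by rewrite E !reimE /re /im /=; ring.
Qed.

Lemma cabs_mul_dir (z : C) t : cabs (z * dir t) = cabs z.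
Proof. by rewrite cabsM cabs_dir mulr1. Qed.

Lemma borel_disc_cabs (t rho : R) (h : C) : 0 < rho -> borel_disc t rho h -> cabs h < rho.
Proof.
move=> r0 Bh; have h0 := borel_disc_neq0 r0 Bh; move/borel_discP: Bh => H.
have := lt_le_trans H (ge_re_cabs _); rewrite cabsM cabs_dir mul1r cabsV.
by rewrite ltf_pV2 ?posrE// cabs_gt0.
Qed.

Lemma borel_disc_ray (t rho r : R) : 0 < r -> r < rho -> borel_disc t rho (ofR r * dir t : C).
Proof.
move=> r0 rr; apply/borel_discP.
have -> : dir t / (ofR r * dir t) = ofR r^-1 :> C.
  by rewrite ofRV; field; rewrite dir_neq0 ofR_eq0 gt_eqF.
by rewrite re_ofR ltf_pV2// posrE// (lt_trans r0).
Qed.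

Lemma borel_disc_le (t rho rho' : R) : 0 < rho -> rho <= rho' ->
  borel_disc t rho `<=` (borel_disc t rho' : set C).
Proof.
move=> r0 rr h /borel_discP H; apply/borel_discP; apply: le_lt_trans H.
by rewrite lef_pV2// posrE// (lt_le_trans r0).
Qed.

(** [c n * h ^+ n] is the difference of two consecutive remainders. For [h] small enough on the ray,
    the estimate of order [n + 1] does not exceed the one of order [n], which gives the factor 2. *)
Lemma gevrey_coef (t rho K M : R) (f : C -> C) (c : nat -> C) n : 0 < rho -> 0 <= K -> 0 <= M ->
  (forall m h, (m <= n.+1)%N -> borel_disc t rho h ->
    cabs (f h - \sum_(k < m) c k * h ^+ k) <= K * M ^+ m * m`!%:R * cabs h ^+ m) ->
  cabs (c n) <= 2 * K * M ^+ n * n`!%:R.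
Proof.
move=> r0 K0 M0 H.
have D0 : 0 < M * n.+1%:R + 1 by rewrite ltr_wpDl// mulr_ge0.
pose r := Num.min (rho / 2) (M * n.+1%:R + 1)^-1.
have rp : 0 < r by rewrite lt_min divr_gt0// invr_gt0.
have rr : r < rho by rewrite gt_min [rho / 2 < rho]gtr_pMr// invf_lt1// ltr1n.
have rM : r * (M * n.+1%:R) <= 1.
  have : r * (M * n.+1%:R + 1) <= 1 by rewrite -ler_pdivlMr// div1r ge_min lexx orbT.
  by rewrite mulrDr mulr1; lra.
pose h : C := ofR r * dir t.
have ch : cabs h = r by rewrite cabs_mul_dir cabs_ofR gtr0_norm.
have Bh : borel_disc t rho h by exact: borel_disc_ray.
have h1 := H n h (leqnSn n) Bh; have h2 := H n.+1 h (leqnn _) Bh.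
rewrite ch in h1 h2.
have rn : 0 < r ^+ n by rewrite exprn_gt0.
rewrite -(ler_pM2r rn) -{1}ch -cabsX -cabsM.
have -> : c n * h ^+ n = (f h - \sum_(k < n) c k * h ^+ k) - (f h - \sum_(k < n.+1) c k * h ^+ k).
  by rewrite big_ord_recr /=; ring.
rewrite (le_trans (cabsB _ _))// (le_trans (lerD h1 h2))//.
rewrite exprSr factS natrM exprSr.
have E : K * (M ^+ n * M) * (n.+1%:R * n`!%:R) * (r ^+ n * r) =
  K * M ^+ n * n`!%:R * r ^+ n * (r * (M * n.+1%:R)) by ring.
rewrite E.
have P0 : 0 <= K * M ^+ n * n`!%:R * r ^+ n by rewrite !mulr_ge0 ?exprn_ge0// ltW.
have := ler_wpM2l P0 rM; rewrite mulr1 => HH.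
have -> : 2 * K * M ^+ n * n`!%:R * r ^+ n = K * M ^+ n * n`!%:R * r ^+ n + K * M ^+ n * n`!%:R * r ^+ n by ring.
by rewrite lerD2l.
Qed.

Lemma bin_le_exp2 (n k : nat) : ('C(n, k) <= 2 ^ n)%N.
Proof.
elim: n k => [|n ih] [|k]; rewrite ?bin0 ?bin0n ?expn_gt0//.
by rewrite binS expnS mul2n -addnn leq_add.
Qed.

Lemma fact_add_le (j m : nat) : ((j + m)`! <= 2 ^ (j + m) * (m`! * j`!))%N.
Proof.
rewrite -(@bin_fact (j + m) m) ?leq_addl// addnK.
by rewrite leq_mul2r bin_le_exp2 orbT.
Qed.

Lemma LT_sum (p : C) (n : nat) (b : nat -> R -> C) (v : nat -> C) (c : nat -> C) :
  (forall k, LT p (b k) (v k)) ->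
  LT p (fun s => \sum_(k < n) c k * b k s) (\sum_(k < n) c k * v k).
Proof.
move=> H; elim: n => [|n ih].
  apply: LT_ext (LT_lin 0 0 (H 0%N) (H 0%N)) => [s _|]; by rewrite big_ord0 !mul0r addr0.
apply: LT_ext (LT_lin 1 (c n) ih (H n)) => [s _|]; by rewrite big_ord_recr /= mul1r.
Qed.

Lemma ccvgP (u : nat -> C) (l : C) : ccvg u l -> u @ \oo --> l.
Proof.
move=> h; apply/cvgrPdist_le => e e0; have [-> r0] := gt0C e0.
have [N HN] := h _ r0; exists N => // n Nn /=.
by rewrite normC_cabs leC_ofR cabsBC; exact: HN.
Qed.

(* The relation [f = g + (1 + z) / kap * f'] between functions on the unit disc,
   on Taylor coefficients. *)
Lemma is_taylor_rec (kap : R) (A B : R) (g : C) (f f' : C -> C) u w : 0 < kap ->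
  0 <= A -> 0 <= B -> is_taylor A f u -> is_taylor B f' w ->
  (forall z, cabs z < 1 -> f z = g + (1 + z) * ofR kap^-1 * f' z) ->
  forall n, u n = (if n == 0%N then g else 0) + ofR kap^-1 * (w n + (if n is k.+1 then w k else 0)).
Proof.
move=> k0 A0 B0 tf tf' E.
pose v n := (if n == 0%N then g else 0) + ofR kap^-1 * (w n + (if n is k.+1 then w k else 0)).
pose D := cabs g + 2 * B / kap.
have D0 : 0 <= D by rewrite addr_ge0// divr_ge0 ?mulr_ge0// ltW.
suff tv : is_taylor D f v by move=> n; exact: (taylor_uniq A0 D0 tf tv (fun _ _ => erefl)).
have kV0 : 0 <= kap^-1 by rewrite invr_ge0 ltW.
move=> z N z1; rewrite E//.
have z10 : 0 < 1 - cabs z by rewrite subr_gt0.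
have ineq N' : cabs (ofR kap^-1 * (f' z - \sum_(k < N') w k * z ^+ k)) <= kap^-1 * (B * cabs z ^+ N' / (1 - cabs z)).
  by rewrite cabsM cabs_ofR ger0_norm// ler_wpM2l// tf'.
have DE y : D * y / (1 - cabs z) = cabs g * y / (1 - cabs z) + (kap^-1 * (B * y / (1 - cabs z)) + kap^-1 * (B * y / (1 - cabs z))).
  by rewrite /D; field; rewrite !gt_eqF.
case: N => [|N].
  have h := ineq 0%N; rewrite big_ord0 subr0 expr0 in h.
  rewrite big_ord0 subr0 expr0 DE (le_trans (cabsD _ _))// lerD//.
    rewrite mulr1 ler_pdivlMr// ler_piMr//; have := cabs_ge0 z; lra.
  rewrite (_ : (1 + z) * _ * _ = ofR kap^-1 * f' z + z * (ofR kap^-1 * f' z)); last by ring.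
  rewrite (le_trans (cabsD _ _))// lerD// cabsM.
  by rewrite (le_trans _ h)// ler_piMl// ltW.
have -> : g + (1 + z) * ofR kap^-1 * f' z - \sum_(k < N.+1) v k * z ^+ k =
   ofR kap^-1 * (f' z - \sum_(k < N.+1) w k * z ^+ k) + z * (ofR kap^-1 * (f' z - \sum_(k < N) w k * z ^+ k)).
  rewrite [\sum_(k < N.+1) v k * _]big_ord_recl /= /v eqxx addr0 expr0.
  rewrite (eq_bigr (fun k : 'I_N => ofR kap^-1 * (w (bump 0 k) * z ^+ bump 0 k) + z * ofR kap^-1 * (w k * z ^+ k))).
    rewrite big_split /= -!mulr_sumr [\sum_(k < N.+1) w k * _]big_ord_recl /= expr0.
    by move: (\sum_(i < N) _) (\sum_(i < N) _) => a b; ring.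
  by move=> k _; rewrite /bump /= add0r exprS; ring.
have h2 : cabs (z * (ofR kap^-1 * (f' z - \sum_(k < N) w k * z ^+ k))) <=
    kap^-1 * (B * cabs z ^+ N.+1 / (1 - cabs z)).
  rewrite cabsM exprS; apply: (le_trans (ler_wpM2l (cabs_ge0 z) (ineq N))).
  by rewrite le_eqVlt; apply/orP; left; apply/eqP; ring.
rewrite DE; apply: (le_trans (cabsD _ _)); apply: (le_trans (lerD (ineq N.+1) h2)).
by rewrite lerDr divr_ge0 ?mulr_ge0 ?exprn_ge0// ltW.
Qed.

End NevanlinnaPrelim.

(** * The Borel transform and its derivatives along the ray *)

Section Nevanlinna.
Variable R : realType.
Local Notation C := (CC R).
Variables (d : nat) (X : set 'rV[C]_d) (t rho K M : R).
Variables (f : 'rV[C]_d -> C -> C) (fk : nat -> 'rV[C]_d -> C).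
Hypothesis oX : open X.
Hypothesis rho0 : 0 < rho.
Hypothesis K0 : 0 < K.
Hypothesis M0 : 0 < M.
Hypothesis hf : holomorphic (X `*` borel_disc t rho) (fun p => f p.1 p.2).
Hypothesis hfk : forall k, holomorphic X (fk k).
Hypothesis bf : forall n x h, X x -> borel_disc t rho h ->
  cabs (f x h - \sum_(k < n) fk k x * h ^+ k) <= K * M ^+ n * n`!%:R * cabs h ^+ n.

Let e : C := dir t.
(** With [p = e / h] the Borel disc is [Re p > 1 / rho = kap / 2], the set of points closer to [kap]
    than to 0, that is [|kap / p - 1| < 1]. *)
Let kap := 2 / rho.
Let e0 : e != 0. Proof. exact: dir_neq0. Qed.
Let ce : cabs e = 1. Proof. exact: cabs_dir. Qed.
Let kap0 : 0 < kap. Proof. by rewrite divr_gt0. Qed.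

Definition to_borel_disc (z : C) : C := e * ofR kap^-1 * (1 + z).

Lemma to_borel_discP z : cabs z < 1 -> borel_disc t rho (to_borel_disc z).
Proof.
move=> z1; apply/borel_discP.
have w0 : 1 + z != 0.
  apply/eqP => E; have := cabsD (1 + z) (- z); rewrite addrK E cabs0 cabsN cabs1; lra.
have -> : dir t / to_borel_disc z = ofR kap * (1 + z)^-1.
  by rewrite /to_borel_disc -/e ofRV; field; rewrite w0 e0 ofR_eq0 gt_eqF.
rewrite !reimE mul0r subr0 reV.
have c0 : 0 < cabs (1 + z) ^+ 2 by rewrite exprn_gt0// cabs_gt0.
rewrite mulrA ltr_pdivlMr// /kap -mulrA (mulrCA 2) ltr_pM2l ?invr_gt0//.
have : cabs z ^+ 2 < 1 by rewrite expr_lt1.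
by rewrite !cabs2 !reimE add0r sqrrD expr1n; lra.
Qed.

(** With [p = e / h] this is [p^n] times the remainder of order [n], which the Gevrey estimate
    bounds on the Borel disc. In these terms [rem_rec] reads [rem n = e^n f_n + rem n.+1 / p]. *)
Definition rem n x (h : C) : C :=
  e ^+ n * (f x h - \sum_(k < n) fk k x * h ^+ k) * (h ^+ n)^-1.

Lemma rem_le n x h : X x -> borel_disc t rho h -> cabs (rem n x h) <= K * M ^+ n * n`!%:R.
Proof.
move=> Xx Bh; have h0 := borel_disc_neq0 rho0 Bh.
rewrite /rem !cabsM cabsV !cabsX ce expr1n mul1r ler_pdivrMr ?exprn_gt0 ?cabs_gt0//.
exact: bf.
Qed.

Lemma rem_rec n x h : h != 0 -> rem n x h = e ^+ n * fk n x + h / e * rem n.+1 x h.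
Proof.
move=> h0; rewrite /rem big_ord_recr /= !exprS.
have hn : h ^+ n != 0 by rewrite expf_neq0.
move: (\sum_(k < n) _) (h ^+ n) hn => s y y0.
by field; rewrite y0 h0 e0.
Qed.

Let B n := K * M ^+ n * n`!%:R.
Let B0 n : 0 <= B n. Proof. by rewrite !mulr_ge0 ?exprn_ge0 ?(ltW K0) ?(ltW M0). Qed.
Let BB0 n : 0 <= 2 * B n. Proof. by rewrite mulr_ge0. Qed.

Lemma rem_taylor : exists tau : nat -> 'rV[C]_d -> nat -> C, forall n x, X x ->
  (forall i, cabs (tau n x i) <= B n) /\
  is_taylor (2 * B n) (fun z => rem n x (to_borel_disc z)) (tau n x).
Proof.
suff H : forall nx : nat * 'rV[C]_d, exists v : nat -> C, X nx.2 ->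
    (forall i, cabs (v i) <= B nx.1) /\
    is_taylor (2 * B nx.1) (fun z => rem nx.1 nx.2 (to_borel_disc z)) v.
  have [tau Htau] := choice H.
  by exists (fun n x => tau (n, x)) => n x Xx; exact: (Htau (n, x)).
move=> [n x] /=; case: (pselect (X x)) => [Xx|nX]; last by exists (fun=> 0).
have [|z z1|v [v1 v2]] := @taylor R (fun z => rem n x (to_borel_disc z)) (B n).
- move=> z z1; have Bz := to_borel_discP z1.
  have hr : holomorphic (borel_disc t rho) (rem n x).
    apply: holoM; first apply: holoM.
    + exact: holo_cst.
    + apply: holoB; first exact: (holo_slice2 hf Xx).
      by apply: holo_sum => k; apply: holoZ; apply: holoX; exact: holo_id.
    + apply: holoV; first by apply: holoX; exact: holo_id.
      by move=> h Bh; rewrite expf_neq0//; exact: borel_disc_neq0 Bh.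
  have [l dl] := holo_cdiff hr Bz.
  have dz : cdiff to_borel_disc z (e * ofR kap^-1 * 1 + (1 + z) * 0).
    have d1 : cdiff (fun z : C => 1 + z) z 1.
      have := cdiffB (cdiff_id z) (cdiff_cst (-1) z); rewrite subr0.
      by under eq_fun do rewrite /= opprK addrC.
    exact: cdiffM (cdiff_cst _ z) d1.
  by eexists; exact: cdiff_comp dz dl.
- by apply: rem_le => //; exact: to_borel_discP.
by exists v => _; split.
Qed.

Lemma fk_le n x : X x -> cabs (fk n x) <= 2 * B n.
Proof.
move=> Xx; have := @gevrey_coef R t rho K M (f x) (fk ^~ x) n rho0 (ltW K0) (ltW M0).
by rewrite /B !mulrA; apply => m h _ Bh; exact: bf.
Qed.

Lemma nevanlinna : exists2 rho', 0 < rho' & forall S0 : set C,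
  S0 `<=` borel_disc t rho' -> S0 `<=` borel_disc t rho ->
  uniform_borel_resummation X S0 t f fk.
Proof.
have [tau Htau] := rem_taylor.
have tau_le n x i : X x -> cabs (tau n x i) <= B n by move=> /(Htau n)[h _]; exact: h.
have tauT n x : X x -> is_taylor (2 * B n) (fun z => rem n x (to_borel_disc z)) (tau n x).
  by move=> /(Htau n)[_ h]; exact: h.
have htau n i : holomorphic X (fun x => tau n x i).
  apply: (@holo_coef _ _ X (2 * B n) (fun x z => rem n x (to_borel_disc z)) (tau n) oX) => //.
  - exact: tauT.
  move=> z /to_borel_discP Bz; apply: holoM; last exact: holo_cst.
  apply: holoZ; apply: holoB; first exact: (holo_slice1 hf Bz).
  by apply: holo_sum => k; apply: holoM; [exact: hfk|exact: holo_cst].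
have tau_rec n x : X x -> forall i, tau n x i = (if i == 0%N then e ^+ n * fk n x else 0) +
    ofR kap^-1 * (tau n.+1 x i + (if i is k.+1 then tau n.+1 x k else 0)).
  move=> Xx; apply: (is_taylor_rec kap0 (BB0 n) (BB0 n.+1) (tauT n x Xx) (tauT n.+1 x Xx)).
  move=> z /to_borel_discP Bz; rewrite (rem_rec n x (borel_disc_neq0 rho0 Bz)); congr (_ + _ * _).
  by rewrite /to_borel_disc; field.
pose g j x := e ^+ j * fk j x.
have g_le j x : X x -> cabs (g j x) <= 2 * B j.
  by move=> Xx; rewrite /g cabsM cabsX ce expr1n mul1r; exact: fk_le.
(* Formally the inverse Laplace transform of [p^j] times the remainder of order [j + 1], which is
   the [j]-th derivative along the ray of [e] times the Borel transform. Seven more terms of the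
   expansion give a polynomial in [s], and what is left, [p^-8 * rem (j + 8)], a Laguerre series. *)
pose b j x s : C := \sum_(k < 7) g (j + k).+1 x * ofR (la kap 0 k s) + lser kap (tau (j + 8)%N x) 7 s.
have db j x s : X x -> 0 <= s -> cder (b j x) s (b j.+1 x s).
  move=> Xx s0.
  have dl k : cder (fun s => ofR (la kap 0 k s)) s (if k is k'.+1 then ofR (la kap 0 k' s) else 0).
    case: k => [|k]; last by apply: cder_ofR; exact: la_derive.
    apply: cder_ext (cder_cst (ofR 1) s) => u.
    by rewrite /= expr0 fact0 divr1.
  have H1 := @cder_sum _ 7 (fun k s => g (j + k).+1 x * ofR (la kap 0 k s)) s _
    (fun k _ => cderZ (g (j + k).+1 x) (dl k)).
  have H2 := lser_derive kap0 s (tau_le (j + 8)%N x ^~ Xx).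
  apply: cder_eq (cderD H1 H2) _.
  have bd i : cabs (tau (j + 8)%N x i) <= B (j + 8)%N + B (j.+1 + 8)%N.
    by rewrite (le_trans (tau_le _ _ _ Xx))// lerDl.
  have bd' i : cabs (tau (j.+1 + 8)%N x i) <= B (j + 8)%N + B (j.+1 + 8)%N.
    by rewrite (le_trans (tau_le _ _ _ Xx))// lerDr.
  (* Differentiation lowers the index of the series to 6; [lser_rec] rewrites it as a monomial of
     index 6 plus the series of index 7 built on the next remainder, as in [b j.+1]. *)
  rewrite (@lser_rec _ _ kap0 (tau (j + 8)%N x) (tau (j.+1 + 8)%N x) (g (j + 8)%N x) _ s bd' bd); last first.
    by move=> n; rewrite (tau_rec _ _ Xx) addSn.
  rewrite addrA; congr (_ + _); rewrite lap_ge0//.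
  rewrite big_ord_recl /= mulr0 add0r [RHS]big_ord_recr /=; congr (_ + _); last first.
    by have -> : (j + 8 = (j.+1 + 6).+1)%N by lia.
  by apply: eq_bigr => k _; rewrite /bump /= add1n add0n addSn addnS.
have [D D0 HD] := @lser_bound _ _ kap0 7 isT.
pose M1 := M + 1.
have M11 : 1 <= M1 by rewrite /M1 lerDr ltW.
have M10 : 0 < M1 by rewrite (lt_le_trans ltr01).
(* [M1 >= 1] makes the powers with exponents up to [j + 8] comparable, and the factor 2 absorbs
   [(j + 8)! <= 2^(j+8) 8! j!]. *)
pose N := M1 * 2.
have N0 : 0 < N by rewrite mulr_gt0.
have [q8 q80 fact8] : exists2 q : R, 0 <= q & forall j, (j + 8)`!%:R <= 2 ^+ (j + 8) * (q * j`!%:R).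
  exists (8`!%:R) => [|j]; first exact: ler0n.
  by rewrite -natrX -!natrM ler_nat; exact: fact_add_le.
pose E8 := K * N ^+ 8 * q8.
have E80 : 0 <= E8 by apply: mulr_ge0 q80; rewrite mulr_ge0 ?exprn_ge0 ?(ltW K0) ?(ltW N0).
have B_le j m : (m <= 8)%N -> B (j + m)%N <= E8 * (N ^+ j * j`!%:R).
  move=> m8.
  have h1 : M ^+ (j + m) <= M1 ^+ (j + 8).
    apply: (@le_trans _ _ (M1 ^+ (j + m))).
      by rewrite lerXn2r ?nnegrE ?(ltW M0) ?(ltW M10)// lerDl.
    by rewrite ler_weXn2l// leq_add2l.
  have h2 : (j + m)`!%:R <= (2 ^+ (j + 8) * (q8 * j`!%:R) : R).
    by rewrite (le_trans _ (fact8 j))// ler_nat leq_fact// leq_add2l.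
  apply: (@le_trans _ _ (K * M1 ^+ (j + 8) * (2 ^+ (j + 8) * (q8 * j`!%:R)))).
    apply: ler_pM => //; first by rewrite mulr_ge0 ?exprn_ge0 ?(ltW K0) ?(ltW M0).
    by rewrite ler_wpM2l// ltW.
  rewrite le_eqVlt; apply/orP; left; apply/eqP.
  by rewrite /E8 /N !exprMn !exprD; ring.
(* Seven polynomial terms whose coefficients are bounded by [2 B], then the Laguerre series. *)
pose A := 14 * E8 + E8 * D.
have A0 : 0 <= A by rewrite addr_ge0// mulr_ge0// ?(ltW D0).
(* [kap] serves for the Laguerre series and 1 for [s^k / k! <= e^s]. *)
pose L := kap + 1.
have L0 : 0 < L by rewrite addr_gt0.
have bb j x s : X x -> 0 <= s -> cabs (b j x s) <= A * N ^+ j * j`!%:R * expR (L * s).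
  move=> Xx s0; rewrite (le_trans (cabsD _ _))//.
  have q0 : 0 <= N ^+ j * j`!%:R by rewrite mulr_ge0// exprn_ge0// ltW.
  have -> : A * N ^+ j * j`!%:R * expR (L * s) =
    7 * (2 * (E8 * (N ^+ j * j`!%:R)) * expR (L * s)) + E8 * (N ^+ j * j`!%:R) * (D * expR (L * s)).
    by rewrite /A; ring.
  apply: lerD.
    rewrite (le_trans (cabs_sum _ _ _))//.
    have -> : 7 * (2 * (E8 * (N ^+ j * j`!%:R)) * expR (L * s)) =
      \sum_(k < 7) (2 * (E8 * (N ^+ j * j`!%:R)) * expR (L * s)).
      by rewrite sumr_const card_ord mulr_natl.
    apply: ler_sum => k _; rewrite cabsM cabs_ofR; apply: ler_pM => //.
      rewrite (le_trans (g_le _ _ Xx))// ler_wpM2l// -addnS B_le//.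
      by rewrite ltnS ltnW.
    rewrite ger0_norm /=; last by rewrite divr_ge0// exprn_ge0.
    rewrite (le_trans (expR_ge_pow k s0))// ler_expR /L mulrDl mul1r lerDr.
    by rewrite mulr_ge0// ltW.
  rewrite (le_trans (HD (tau (j + 8)%N x) (B (j + 8)%N) (tau_le _ _ ^~ Xx) s))//.
  apply: ler_pM => //; first by rewrite mulr_ge0 ?expR_ge0.
    exact: B_le.
  by rewrite ler_wpM2l// ler_expR ler_wpM2r// lerDl.
have hb j s : 0 <= s -> holomorphic X (fun x => b j x s).
  move=> s0; apply: holoD.
    apply: holo_sum => k; apply: holoM; last exact: holo_cst.
    by apply: holoZ; exact: hfk.
  have [D' D'0 HD'] := @lser_rate _ _ kap0 7 isT.
  apply: (@holo_lim _ _ X (fun n x => lpart kap (tau (j + 8)%N x) 7 n s) _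
    (fun n => B (j + 8)%N * (D' * expR (kap * s)) * n.+1%:R^-1)) => //.
  - by move=> n; apply: holo_sum => k; apply: holoM; [exact: htau|exact: holo_cst].
  - by apply: rcvg0Z (@rcvg0_harmonic R); apply: mulr_ge0 (B0 _) _; rewrite mulr_ge0 ?expR_ge0.
  - by move=> n x Xx; apply: HD' => i; exact: tau_le.
have [phi [hphi phib phiK phi0]] := tube_extension oX hb db A0 N0 (ltW L0) bb t.
(* The Borel disc of diameter [1 / L] is [Re p > L], where [e^(- p s)] beats the growth [e^(L s)]
   and the Laplace integral converges. *)
exists L^-1; first by rewrite invr_gt0.
move=> S0 S0L S0rho; exists (4 * N)^-1, (A * 2 + 1), L; split.
- by rewrite invr_gt0 mulr_gt0.
- by rewrite ltr_wpDl// mulr_ge0.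
- exact: L0.
exists phi; split => //.
- move=> x Xx; rewrite -[\forall xi \near _, _]/(\forall xi \near (0 : C^o), _).
  apply/near0P; exists (4 * N)^-1; first by rewrite invr_gt0 mulr_gt0.
  move=> xi; rewrite nrmC => xieps.
  have lap0 n : lap kap n 7 0 = 0 by rewrite lap_ge0// la_at0.
  have ls0 (w : nat -> C) : lser kap w 7 0 = 0.
    rewrite /lser; case: xgetP => [l _ Hl|//].
    apply: (ccvg_uniq Hl); apply: ccvg_ext (ccvg_cst 0) => n.
    by rewrite /lpart big1// => i _; rewrite lap0 mulr0.
  have b0 j : b j x 0 = g j.+1 x.
    rewrite /b ls0 addr0 big_ord_recl big1; last by move=> i _; rewrite la_at0 mulr0.
    by rewrite /= expr0 fact0 divr1 mulr1 !addr0 addn0.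
  apply: ccvgP; apply: ccvg_ext (phi0 x xi Xx xieps) => n.
  rewrite /series /= big_mkord; apply: eq_bigr => j _; rewrite b0 /g -/e exprS.
  have ej : e ^+ j != 0 by rewrite expf_neq0.
  rewrite exprMn exprVn; move: (xi ^+ j) (e ^+ j) ej (j`!%:R^-1) => a c c0 q.
  by field; rewrite c0 e0.
- move=> x xi Xx Txi; rewrite (le_trans (phiK x xi Xx Txi))// ler_wpM2r ?expR_ge0//.
  by rewrite lerDl.
move=> x h Xx Sh; have Bh := S0rho h Sh; have h0 := borel_disc_neq0 rho0 Bh.
have /borel_discP := S0L h Sh; rewrite invrK => pL.
have /borel_discP pk := Bh.
set p := dir t / h in pL pk.
have p0 : p != 0 by rewrite mulf_neq0 ?invr_eq0.
have hE : h = e / p by rewrite /p -/e; field; rewrite e0 h0.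
have kp : kap < re p by rewrite (lt_trans _ pL)// /L ltrDl.
apply: (@LT_is_laplace _ t (phi x) h _ (b 0%N x) A L) => //.
- by move=> r r0; exact: phib.
- by move=> r r0; exists (b 1%N x r); exact: db.
- by move=> r r0; have := bb 0%N x r Xx r0; rewrite expr0 fact0 !mulr1.
rewrite -/p; pose z := ofR kap / p - 1.
have aux (q : C) : kap < re q -> cabs (ofR kap - q) < cabs q.
  move=> kq; rewrite -(@ltr_pXn2r _ 2)// ?nnegrE// !cabs2 !reimE.
  rewrite -subr_gt0 (_ : _ - _ = kap * (2 * re q - kap)); last by ring.
  by rewrite mulr_gt0//; have := kap0; lra.
have z1 : cabs z < 1.
  have cp : 0 < cabs p by rewrite cabs_gt0.
  rewrite -(ltr_pM2r cp) mul1r -cabsM mulrBl mul1r divfK//.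
  exact: aux.
have hz : to_borel_disc z = h.
  rewrite hE /to_borel_disc /z ofRV; move: p0; move: (p) => q q0; field.
  by rewrite q0 ofR_eq0 gt_eqF.
have T8 := LT_lser kap0 kp (tau_le 8%N x ^~ Xx).
have cv : ccvg (fun n => \sum_(i < n) tau 8%N x i * (p^-1 ^+ 8 * (ofR kap / p - 1) ^+ i)) (p^-1 ^+ 8 * rem 8 x h).
  rewrite -/z -hz.
  have z10 : 0 < 1 - cabs z by rewrite subr_gt0.
  have c1 : ccvg (fun n => \sum_(i < n) tau 8%N x i * z ^+ i) (rem 8 x (to_borel_disc z)).
    have P0 : 0 <= 2 * B 8 / (1 - cabs z) by rewrite divr_ge0 ?mulr_ge0 ?ltW.
    apply: (ccvg_rate (rcvg0Z P0 (rcvg0_geometric (cabs_ge0 z) z1))) => n.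
    by rewrite cabsBC mulrAC; exact: tauT.
  apply: ccvg_ext (ccvgZ (p^-1 ^+ 8) c1) => n.
  by rewrite mulr_sumr; apply: eq_bigr => i _; rewrite mulrCA.
have p00 : 0 < re p by exact: lt_trans kp.
have T7 := LT_sum 7 (fun k => g k.+1 x) (fun k => LT_la kap 0 k p00).
apply: LT_ext (LT_lin 1 1 T7 (T8 _ cv)) => [s _|].
  by rewrite /b !mul1r.
rewrite !mul1r.
have E : \sum_(k < 7) g k.+1 x * (p^-1 ^+ k.+1 * (ofR kap / p - 1) ^+ 0) = \sum_(k < 7) fk k.+1 x * h ^+ k.+1.
  apply: eq_bigr => k _; rewrite expr0 mulr1 /g hE exprMn; ring.
rewrite E /rem [\sum_(k < 8) _]big_ord_recl /= expr0 mulr1.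
rewrite (eq_bigr (fun k : 'I_7 => fk k.+1 x * h ^+ k.+1)); last by [].
have -> : p^-1 ^+ 8 * (e ^+ 8 * (f x h - (fk 0%N x + \sum_(k < 7) fk k.+1 x * h ^+ k.+1)) / h ^+ 8) =
   f x h - (fk 0%N x + \sum_(k < 7) fk k.+1 x * h ^+ k.+1).
  move: (f x h - _) => y; rewrite hE exprMn.
  have p8 : p^-1 ^+ 8 != 0 by rewrite expf_neq0// invr_eq0.
  have e8 : e ^+ 8 != 0 by rewrite expf_neq0.
  move: (p^-1 ^+ 8) p8 (e ^+ 8) e8 => u u0 v v0.
  by field; rewrite u0 v0.
by move: (\sum_(k < 7) _) => y; ring.
Qed.

End Nevanlinna.

(** * The root and its Gevrey expansion *)

Section SimpleRoot.
Variable K : fieldType.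

Lemma pol_horner n (a : 'I_n.+1 -> K) z : (pol a).[z] = \sum_(i < n.+1) a i * z ^+ i.
Proof. by rewrite /pol horner_sum; apply: eq_bigr => i _; rewrite hornerZ hornerXn. Qed.

Lemma pol_deriv_horner n (a : 'I_n.+1 -> K) z :
  (pol a)^`().[z] = \sum_(i < n.+1) a i * (z ^+ i.-1 *+ i).
Proof.
rewrite /pol raddf_sum horner_sum; apply: eq_bigr => j _.
by rewrite /= derivZ derivXn hornerZ hornerMn hornerXn.
Qed.

Lemma size_pol n (a : 'I_n.+1 -> K) : (size (pol a) <= n.+1)%N.
Proof.
rewrite /pol; apply: (leq_trans (size_sum _ _ _)); apply/bigmax_leqP => i _.
by rewrite (leq_trans (size_scale_leq _ _))// size_polyXn ltn_ord.
Qed.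

(* At a double root z, the vector of the z^j, with its last entry multiplied by
   the leading coefficient, is in the kernel of the matrix of [disc]. *)
Lemma disc_simple_root n (p : {poly K}) z : (size p <= n.+1)%N -> disc n p != 0 -> root p z ->
  p^`().[z] != 0.
Proof.
move=> sp; rewrite /disc; case: (eqVneq p 0) => [->|p0]; first by rewrite eqxx.
rewrite mulf_eq0 signr_eq0 /= => dA /rootP pz; apply/eqP => dz.
(* For [n <= 1] the determinant is 1 and the conclusion rests on [p != 0]: a polynomial of degree at
   most 1 with a double root is 0. *)
case: (leqP n 1) => [n1|n1].
  have sp2 : (size p <= 2)%N by rewrite (leq_trans sp)// ltnS.
  have d1 : p^`() = (p`_1)%:P.
    apply/polyP => i; rewrite coef_deriv coefC; case: i => [|i] /=; first by rewrite mulr1n.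
    by rewrite nth_default ?mul0rn// (leq_trans sp2).
  have p1 : p`_1 = 0 by move: dz; rewrite d1 hornerC.
  have pc : p = (p`_0)%:P.
    apply/polyP => i; rewrite coefC; case: i => [|[|i]] //=.
    by rewrite nth_default// (leq_trans sp2).
  move: pz p0; rewrite pc hornerC => ->; by rewrite polyC0 eqxx.
move: dA; set A := \matrix_(_, _) _ => dA.
pose N := (n.-1 + n)%N.
pose w : 'cV[K]_N := \col_(j < N) ((if j.+1 == N then p`_n else 1) * z ^+ j).
have horner_widen (q : {poly K}) : (size q <= N)%N -> q.[z] = \sum_(j < N) q`_j * z ^+ j.
  move=> sq; rewrite horner_coef (big_ord_widen N (fun j => q`_j * z ^+ j) sq) big_mkcond /=.
  by apply: eq_bigr => j _; case: ltnP => // h; rewrite nth_default// mul0r.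
have col (q r : {poly K}) (j : 'I_N) : (j.+1 == N -> r`_j * p`_n = q`_j) ->
    (if j.+1 == N then r else q)`_j * ((if j.+1 == N then p`_n else 1) * z ^+ j) = q`_j * z ^+ j.
  by case: eqP => _ h; rewrite ?mul1r// mulrA h.
have Aw : A *m w = 0.
  apply/matrixP => i j; rewrite !mxE.
  under eq_bigr do rewrite !mxE.
  case: (fintype.split i) => k.
    have sk : (size (p * 'X^k)%R <= N)%N.
      rewrite (leq_trans (size_polyMleq _ _))// size_polyXn addnS /=.
      by rewrite (leq_trans (leq_add sp (leqnn k)))//; have := ltn_ord k; rewrite /N; lia.
    transitivity (p * 'X^k).[z]; last by rewrite hornerM pz mul0r.
    rewrite (horner_widen _ sk); apply: eq_bigr => l _.
    rewrite -(col (p * 'X^k) ('X^n * 'X^k)) => [|/eqP lN]; first by case: ifP.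
    have kl : (k <= l)%N by have := ltn_ord k; move: lN; rewrite /N; lia.
    rewrite !coefMXn ltnNge kl /= coefXn; case: eqP => [->|ne]; rewrite ?mul1r// mul0r.
    rewrite nth_default// (leq_trans sp)//; have := ltn_ord k; move: lN ne; rewrite /N; lia.
  have sk : (size (p^`() * 'X^k)%R <= N)%N.
    rewrite (leq_trans (size_polyMleq _ _))// size_polyXn addnS /=.
    have s' : (size p^`() <= n)%N by rewrite (leq_trans (size_poly _ _))// -ltnS prednK// size_poly_gt0.
    by rewrite (leq_trans (leq_add s' (leqnn k)))//; have := ltn_ord k; rewrite /N; lia.
  transitivity (p^`() * 'X^k).[z]; last by rewrite hornerM dz mul0r.
  rewrite (horner_widen _ sk); apply: eq_bigr => l _.
  rewrite -(col (p^`() * 'X^k) ('X^n^`() * 'X^k)) => [|/eqP lN]; first by case: ifP.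
  have kl : (k <= l)%N by have := ltn_ord k; move: lN; rewrite /N; lia.
  rewrite !coefMXn ltnNge kl /= !coef_deriv coefXn mulrnAl; congr (_ *+ _).
  case: eqP => [->|ne]; rewrite ?mul1r// mul0r.
  rewrite nth_default// (leq_trans sp)//; have := ltn_ord k; move: lN ne; rewrite /N; lia.
have uA : A \in unitmx by rewrite unitmxE unitfE.
have w0 : w = 0 by rewrite -(mulKmx uA w) Aw mulmx0.
have N0 : (0 < N)%N by rewrite /N; lia.
(* The first entry of [w] is [z^0 = 1], without the weight of the last entry since [N >= 3]. *)
move/matrixP/(_ (Ordinal N0) ord0): w0; rewrite !mxE /= expr0 mulr1 ifF => [/eqP|]; first by rewrite oner_eq0.
by apply/eqP; rewrite /N; lia.
Qed.

End SimpleRoot.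

(** * The algebra of Gevrey functions on a Borel disc *)

Section GevreyAlgebra.
Variable R : realType.
Local Notation C := (CC R).
Variables t rho : R.
Hypothesis rho0 : 0 < rho.

(** The truncation at order [N] makes the estimates an induction hypothesis on [N], in which [K] and
    [M] must not depend on [N]. *)
Definition gev (N : nat) (K M : R) (f : C -> C) (c : nat -> C) :=
  forall n h, (n <= N)%N -> borel_disc t rho h ->
    cabs (f h - \sum_(k < n) c k * h ^+ k) <= K * M ^+ n * n`!%:R * cabs h ^+ n.

Lemma gev_le N K M K' M' f c : 0 <= K -> K <= K' -> 0 <= M -> M <= M' ->
  gev N K M f c -> gev N K' M' f c.
Proof.
move=> K0 KK M0 MM H n h nN Bh; rewrite (le_trans (H n h nN Bh))//.
rewrite ler_wpM2r ?exprn_ge0// ler_wpM2r//; apply: ler_pM => //; first by rewrite exprn_ge0.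
by rewrite lerXn2r ?nnegrE// (le_trans M0).
Qed.

Lemma gev_bound N K M f c h : gev N K M f c -> borel_disc t rho h -> cabs (f h) <= K.
Proof. by move=> H Bh; have := H 0%N h (leq0n _) Bh; rewrite big_ord0 subr0 !expr0 fact0 !mulr1. Qed.

Lemma gev_coef N K M f c n : 0 <= K -> 0 <= M -> gev N K M f c -> (n < N)%N ->
  cabs (c n) <= 2 * K * M ^+ n * n`!%:R.
Proof.
move=> K0 M0 H nN; apply: (@gevrey_coef R t rho K M f c n rho0 K0 M0) => m h mn Bh.
exact: H (leq_trans mn nN) Bh.
Qed.

Lemma gev_ext N K M f g c : (forall h, borel_disc t rho h -> f h = g h) -> gev N K M f c -> gev N K M g c.
Proof. by move=> fg H n h nN Bh; rewrite -fg//; exact: H. Qed.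

Lemma gevD N K L M f g c e : gev N K M f c -> gev N L M g e ->
  gev N (K + L) M (fun h => f h + g h) (fun k => c k + e k).
Proof.
move=> Hf Hg n h nN Bh.
have -> : f h + g h - \sum_(k < n) (c k + e k) * h ^+ k =
  (f h - \sum_(k < n) c k * h ^+ k) + (g h - \sum_(k < n) e k * h ^+ k).
  under eq_bigr do rewrite mulrDl.
  by rewrite big_split /= opprD addrACA.
by rewrite (le_trans (cabsD _ _))// !mulrDl lerD// ?Hf// Hg.
Qed.

Lemma gevZ N K M f c (a : C) : gev N K M f c -> gev N (cabs a * K) M (fun h => a * f h) (fun k => a * c k).
Proof.
move=> Hf n h nN Bh; under eq_bigr do rewrite -mulrA.
rewrite -mulr_sumr -mulrBr cabsM -!mulrA ler_wpM2l// !mulrA.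
exact: Hf.
Qed.

Lemma gev_sum N M n (K : 'I_n -> R) (f : 'I_n -> C -> C) (c : 'I_n -> nat -> C) :
  (forall i, gev N (K i) M (f i) (c i)) ->
  gev N (\sum_(i < n) K i) M (fun h => \sum_(i < n) f i h) (fun k => \sum_(i < n) c i k).
Proof.
move=> H m h mN Bh; under [\sum_(k < m) _]eq_bigr do rewrite mulr_suml.
rewrite exchange_big /= -sumrB (le_trans (cabs_sum _ _ _))// !mulr_suml ler_sum// => i _.
exact: H.
Qed.

Lemma gev_cst N M (a : C) : 0 <= M -> gev N (cabs a) M (fun=> a) (fun k => if k == 0%N then a else 0).
Proof.
move=> M0 [|n] h nN Bh; first by rewrite big_ord0 subr0 !expr0 fact0 !mulr1.
rewrite big_ord_recl big1; last by move=> i _; rewrite mul0r.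
by rewrite /= expr0 mulr1 addr0 subrr cabs0 !mulr_ge0 ?exprn_ge0.
Qed.

Definition cconv (c e : nat -> C) k := \sum_(i < k.+1) c i * e (k - i)%N.

Lemma cconv_psum c e n (h : C) : \sum_(k < n) cconv c e k * h ^+ k =
  \sum_(i < n) c i * h ^+ i * (\sum_(j < n - i) e j * h ^+ j).
Proof.
elim: n => [|n ih]; first by rewrite !big_ord0.
rewrite big_ord_recr /= ih [RHS]big_ord_recr /= subSnn big_ord1 expr0 mulr1.
rewrite /cconv big_ord_recr /= subnn mulrDl addrA; congr (_ + _); last by rewrite mulrAC.
rewrite mulr_suml -big_split /=; apply: eq_bigr => i _.
have i_n : (i <= n)%N by exact: ltnW.
rewrite subSn// big_ord_recr /= mulrDr; congr (_ + _).
have -> : h ^+ n = h ^+ i * h ^+ (n - i) by rewrite -exprD subnKC.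
by ring.
Qed.

Lemma fact_mul_le m k : (m.+1`! * k.+1`! <= (m + k).+1`!)%N.
Proof.
elim: k => [|k ih]; first by rewrite mulnC mul1n addn0.
rewrite factS mulnCA addnS [X in (_ <= X)%N]factS; apply: leq_mul => //.
by rewrite !ltnS leq_addl.
Qed.

(** The first term is [n!] and each of the [n - 1] others is at most [(n - 1)!]. This is what keeps
    the constant of a product independent of the order. *)
Lemma sum_fact_le n : (\sum_(i < n) i`! * (n - i)`! <= 2 * n`!)%N.
Proof.
case: n => [|n]; first by rewrite big_ord0.
rewrite big_ord_recl /= fact0 mul1n subn0 mul2n -addnn leq_add2l.
apply: (@leq_trans (\sum_(i < n) n`!)%N).
  apply: leq_sum => i _; rewrite /bump /= add1n subSS.
  have [k nk] : exists k, (n - i = k.+1)%N by exists (n - i).-1; have := ltn_ord i; lia.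
  rewrite nk; apply: (leq_trans (fact_mul_le i k)).
  by rewrite leq_fact//; lia.
by rewrite sum_nat_const card_ord factS leq_mul2r leqnSn orbT.
Qed.

(** The remainder of [f] times [g] contributes 1; the coefficients of [f] times the remainders of
    [g] contribute [2 * 2], by [gev_coef] and [sum_fact_le]; 6 is a rounding up. *)
Lemma gevM N K L M f g c e : 0 <= K -> 0 <= L -> 0 <= M -> gev N K M f c -> gev N L M g e ->
  gev N (6 * (K * L)) M (fun h => f h * g h) (cconv c e).
Proof.
move=> K0 L0 M0 Hf Hg n h nN Bh; rewrite cconv_psum.
set s := \sum_(i < n) _.
have -> : f h * g h - s = (f h - \sum_(k < n) c k * h ^+ k) * g h +
   \sum_(i < n) c i * h ^+ i * (g h - \sum_(j < n - i) e j * h ^+ j).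
  under [X in _ = _ + X]eq_bigr do rewrite mulrBr.
  by rewrite sumrB -mulr_suml mulrBl -/s; ring.
pose P := K * L * M ^+ n * cabs h ^+ n.
have P0 : 0 <= P by rewrite !mulr_ge0 ?exprn_ge0.
have h1 : cabs ((f h - \sum_(k < n) c k * h ^+ k) * g h) <= P * n`!%:R.
  rewrite cabsM (le_trans (ler_pM _ _ (Hf n h nN Bh) (gev_bound Hg Bh)))//.
  by rewrite le_eqVlt; apply/orP; left; apply/eqP; rewrite /P; ring.
have h2 : cabs (\sum_(i < n) c i * h ^+ i * (g h - \sum_(j < n - i) e j * h ^+ j)) <=
    2 * P * (2 * n`!%:R).
  apply: (@le_trans _ _ (2 * P * (\sum_(i < n) i`! * (n - i)`!)%:R)); last first.
    apply: ler_wpM2l; first by rewrite mulr_ge0.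
    by rewrite -natrM ler_nat sum_fact_le.
  rewrite (le_trans (cabs_sum _ _ _))// natr_sum mulr_sumr; apply: ler_sum => i _.
  rewrite !cabsM cabsX.
  have ci := gev_coef K0 M0 Hf (leq_trans (ltn_ord i) nN).
  have ri := Hg (n - i)%N h (leq_trans (leq_subr _ _) nN) Bh.
  have ch0 : 0 <= cabs h ^+ i by rewrite exprn_ge0.
  rewrite (le_trans (ler_pM _ _ (ler_wpM2r ch0 ci) ri)) ?mulr_ge0//.
  have i_n : (i <= n)%N by exact: ltnW.
  rewrite /P; have -> : M ^+ n = M ^+ i * M ^+ (n - i) by rewrite -exprD subnKC.
  have -> : cabs h ^+ n = cabs h ^+ i * cabs h ^+ (n - i) by rewrite -exprD subnKC.
  by rewrite natrM le_eqVlt; apply/orP; left; apply/eqP; ring.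
rewrite (le_trans (cabsD _ _))// (le_trans (lerD h1 h2))//.
have -> : 6 * (K * L) * M ^+ n * n`!%:R * cabs h ^+ n = P * n`!%:R + 2 * P * (2 * n`!%:R) + P * n`!%:R.
  by rewrite /P; ring.
by rewrite lerDl mulr_ge0.
Qed.

Fixpoint cpow (c : nat -> C) i : nat -> C :=
  if i is j.+1 then cconv c (cpow c j) else fun k => if k == 0%N then 1 else 0.

Lemma gevX N K M f c i : 0 <= K -> 0 <= M -> gev N K M f c ->
  gev N ((6 * K) ^+ i) M (fun h => f h ^+ i) (cpow c i).
Proof.
move=> K0 M0 Hf; elim: i => [|i ih] /=.
  by have := @gev_cst N M 1 M0; rewrite cabs1; under [X in _ -> gev _ _ _ X _]eq_fun do rewrite expr0.
have K60 : 0 <= (6 * K) ^+ i by rewrite exprn_ge0// mulr_ge0.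
have := gevM K0 K60 M0 Hf ih; rewrite exprS mulrA.
by under [X in _ -> gev _ _ _ X _]eq_fun do rewrite exprS.
Qed.

(** Multiplication by [h] turns the estimate of order [n] into one of order [n + 1], and the extra
    factor [M] so gained absorbs [K] into [A]. Order 0 has to be supplied separately, by the bound
    on [h * f h]. *)
Lemma gev_mulh N K A M f c : 0 <= K -> 0 <= A -> 0 <= M -> K <= A * M ->
  (forall h, borel_disc t rho h -> cabs (h * f h) <= A) ->
  gev N K M f c -> gev N.+1 A M (fun h => h * f h) (fun k => if k is j.+1 then c j else 0).
Proof.
move=> K0 A0 M0 KA bA H [|n] h nN Bh.
  by rewrite big_ord0 subr0 !expr0 fact0 !mulr1; exact: bA.
rewrite big_ord_recl mul0r add0r (eq_bigr (fun i : 'I_n => h * (c i * h ^+ i))); last first.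
  by move=> i _; rewrite exprS mulrCA.
rewrite -mulr_sumr -mulrBr cabsM (le_trans (ler_wpM2l (cabs_ge0 h) (H n h nN Bh)))//.
have -> : A * M ^+ n.+1 * n.+1`!%:R * cabs h ^+ n.+1 =
  A * M * (M ^+ n * cabs h ^+ n.+1 * n.+1`!%:R) by rewrite !exprS; ring.
have -> : cabs h * (K * M ^+ n * n`!%:R * cabs h ^+ n) = K * (M ^+ n * cabs h ^+ n.+1 * n`!%:R).
  by rewrite exprS; ring.
apply: ler_pM => //; first by rewrite !mulr_ge0 ?exprn_ge0.
apply: ler_wpM2l; first by rewrite !mulr_ge0 ?exprn_ge0.
by rewrite ler_nat leq_fact.
Qed.

(** Division by [h] shifts the order, and [(n + 1)! <= 2^n n!] is absorbed by doubling [M]. *)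
Lemma gev_divh N K M f c : 0 <= K -> 0 <= M -> gev N.+1 K M f c ->
  gev N (K * M) (2 * M) (fun h => (f h - c 0%N) / h) (fun k => c k.+1).
Proof.
move=> K0 M0 H n h nN Bh; have h0 := borel_disc_neq0 rho0 Bh.
have -> : (f h - c 0%N) / h - \sum_(k < n) c k.+1 * h ^+ k = (f h - \sum_(k < n.+1) c k * h ^+ k) / h.
  rewrite big_ord_recl expr0 mulr1 opprD addrA [RHS]mulrBl; congr (_ - _).
  rewrite mulr_suml; apply: eq_bigr => i _; rewrite exprS.
  by field.
rewrite cabsM cabsV ler_pdivrMr ?cabs_gt0// (le_trans (H n.+1 h nN Bh))//.
have -> : K * M * (2 * M) ^+ n * n`!%:R * cabs h ^+ n * cabs h =
  K * M ^+ n.+1 * cabs h ^+ n.+1 * (2 ^+ n * n`!%:R) by rewrite exprMn !exprS; ring.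
rewrite mulrAC; apply: ler_wpM2l; first by rewrite !mulr_ge0 ?exprn_ge0.
by rewrite factS natrM ler_wpM2r// -natrX ler_nat ltn_expl.
Qed.

End GevreyAlgebra.

Section BorelDiscBall.
Variable R : realType.
Local Notation C := (CC R).

Lemma borel_disc_ball (t rho : R) (h : C) : 0 < rho ->
  borel_disc t rho h <-> cabs (h - ofR (rho / 2) * dir t) < rho / 2.
Proof.
move=> r0; have [->|h0] := eqVneq h 0.
  rewrite borel_discP invr0 mulr0 re0 sub0r cabsN cabs_mul_dir cabs_ofR ger0_norm ?divr_ge0 ?ltW//.
  by rewrite ltxx ltNge invr_ge0 (ltW r0).
have r20 : 0 < rho / 2 by rewrite divr_gt0.
rewrite borel_discP -[cabs _ < _](@ltr_pXn2r _ 2)// ?nnegrE ?(ltW r20)// cabs2.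
have c0 : 0 < cabs h ^+ 2 by rewrite exprn_gt0// cabs_gt0.
have -> : re (dir t / h) = (cos t * re h + sin t * im h) / cabs h ^+ 2.
  have qh : dir t = dir t / h * h by rewrite divfK.
  have ct : cos t = re (dir t / h * h) by rewrite -qh.
  have st : sin t = im (dir t / h * h) by rewrite -qh.
  rewrite ct st; move: (dir t / h) => q; rewrite !reimE.
  by apply: (mulIf (lt0r_neq0 c0)); rewrite divfK ?gt_eqF// cabs2; ring.
rewrite ltr_pdivlMr// mulrC ltr_pdivrMr// cabs2 !reimE.
have cs := cos2Dsin2 t.
have -> : (re h - (rho / 2 * cos t - 0 * sin t)) ^+ 2 + (im h - (rho / 2 * sin t + 0 * cos t)) ^+ 2 =
   re h ^+ 2 + im h ^+ 2 - (cos t * re h + sin t * im h) * rho + (rho / 2) ^+ 2 * (cos t ^+ 2 + sin t ^+ 2).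
  by field.
rewrite cs mulr1; split; lra.
Qed.

Lemma open_cball (c : C) (r : R) : open [set h : C | cabs (h - c) < r].
Proof.
rewrite openE => h /= hr.
have e0 : 0 < r - cabs (h - c) by rewrite subr_gt0.
apply/nbhs_ballP; exists (ofR (r - cabs (h - c))) => /=; first by rewrite -ofR0 ltC_ofR.
move=> y; rewrite /ball /= normC_cabs ltC_ofR => hy.
rewrite (le_lt_trans (cabs_tri h _ _))// cabsBC; lra.
Qed.

Lemma open_borel_disc (t rho : R) : 0 < rho -> open (borel_disc t rho : set C).
Proof.
move=> r0; have -> : borel_disc t rho = [set h : C | cabs (h - ofR (rho / 2) * dir t) < rho / 2].
  by apply/seteqP; split => h /(borel_disc_ball t h r0).
exact: open_cball.
Qed.

End BorelDiscBall.

(** * The fixed-point equation, formal and analytic *)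

Section FixedPoint.
Variable R : realType.
Local Notation C := (CC R).

Section Causal.
Implicit Types (c w v : nat -> C).

Lemma cconv_causal c c' v w k : (forall l, (l <= k)%N -> c l = c' l) ->
  (forall l, (l <= k)%N -> v l = w l) -> cconv c v k = cconv c' w k.
Proof.
by move=> cc vw; apply: eq_bigr => i _; rewrite cc -1?ltnS// vw// leq_subr.
Qed.

Lemma cpow_causal v w i k : (forall l, (l <= k)%N -> v l = w l) -> cpow v i k = cpow w i k.
Proof.
elim: i k => [//|i ih] k vw /=; apply: cconv_causal => // l lk.
by apply: ih => m ml; apply: vw; exact: leq_trans lk.
Qed.

(** Contraction in formal power series: the coefficient of order [k] depends on lower ones only,
    hence is stationary from the iterate [k + 1] on. *)
Lemma causal_fixpoint (F : (nat -> C) -> nat -> C) :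
  (forall v w k, (forall l, (l < k)%N -> v l = w l) -> F v k = F w k) ->
  exists w, forall k, F w k = w k.
Proof.
move=> cF; pose U n := iter n F (fun=> 0).
have stab n k : (k < n)%N -> U n k = U n.+1 k.
  elim: n k => [//|n ih] k kn; rewrite /= -/(U n) -/(U n.+1).
  by apply: cF => l lk; apply: ih; exact: (leq_trans lk kn).
have stab' n k : (k < n)%N -> U n k = U k.+1 k.
  elim: n => [//|n ih]; rewrite ltnS leq_eqVlt => /predU1P[->//|kn].
  by rewrite -stab// ih.
exists (fun k => U k.+1 k) => k.
by rewrite /= -/(U k); apply: cF => l lk; rewrite stab'.
Qed.

End Causal.

Lemma cabs_powB (x y : C) (A : R) i : cabs x <= A -> cabs y <= A ->
  cabs (x ^+ i.+1 - y ^+ i.+1) <= i.+1%:R * A ^+ i * cabs (x - y).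
Proof.
move=> xA yA; have A0 : 0 <= A by exact: le_trans xA.
elim: i => [|i ih]; first by rewrite !expr1 mul1r expr0 mul1r.
have -> : x ^+ i.+2 - y ^+ i.+2 = x * (x ^+ i.+1 - y ^+ i.+1) + (x - y) * y ^+ i.+1.
  by rewrite !(exprS _ i.+1); ring.
rewrite (le_trans (cabsD _ _))// !cabsM.
have h1 := ler_pM (cabs_ge0 _) (cabs_ge0 _) xA ih.
have h2 : cabs (x - y) * cabs (y ^+ i.+1) <= cabs (x - y) * A ^+ i.+1.
  by rewrite ler_wpM2l// cabsX lerXn2r ?nnegrE.
rewrite (le_trans (lerD h1 h2))// -[i.+2%:R]natr1 exprS le_eqVlt; apply/orP; left; apply/eqP; ring.
Qed.

Variables (d n : nat) (X : set 'rV[C]_d) (t rho K M : R).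
Variables (G0 : 'rV[C]_d -> C -> C) (g0 : 'rV[C]_d -> nat -> C).
Variables (G : 'I_n -> 'rV[C]_d -> C -> C) (g : 'I_n -> 'rV[C]_d -> nat -> C).
Hypotheses (oX : open X) (rho0 : 0 < rho) (K0 : 0 < K) (M0 : 0 < M).
Hypothesis hG0 : holomorphic (X `*` borel_disc t rho) (fun p => G0 p.1 p.2).
Hypothesis hG : forall i, holomorphic (X `*` borel_disc t rho) (fun p => G i p.1 p.2).
Hypothesis hg0 : forall k, holomorphic X (g0 ^~ k).
Hypothesis hg : forall i k, holomorphic X (g i ^~ k).
Hypothesis gev0 : forall N x, X x -> gev t rho N K M (G0 x) (g0 x).
Hypothesis gevG : forall N i x, X x -> gev t rho N K M (G i x) (g i x).

Let A := 2 * K.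
Let step x h w := G0 x h + h * \sum_(i < n) G i x h * w ^+ i.+1.

Lemma formal_fixpoint : exists w : nat -> 'rV[C]_d -> C,
  (forall k, holomorphic X (w k)) /\
  forall x k, w k x = g0 x k +
    (if k is j.+1 then \sum_(i < n) cconv (g i x) (cpow (w ^~ x) i.+1) j else 0).
Proof.
pose F x (v : nat -> C) k := g0 x k +
  (if k is j.+1 then \sum_(i < n) cconv (g i x) (cpow v i.+1) j else 0).
have fix_F x : exists w, forall k, F x w k = w k.
  apply: causal_fixpoint => v w [//|j] vw; rewrite /F; congr (_ + _).
  by apply: eq_bigr => i _; apply: cconv_causal => // l lj; apply: cpow_causal => m ml;
    apply: vw; rewrite ltnS (leq_trans ml).
have [w Hw] := choice fix_F.
exists (fun k x => w x k); split; last by move=> x k; rewrite -{1}Hw.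
have hconv (a b : 'rV[C]_d -> nat -> C) k : (forall l, (l <= k)%N -> holomorphic X (a ^~ l)) ->
    (forall l, (l <= k)%N -> holomorphic X (b ^~ l)) -> holomorphic X (fun x => cconv (a x) (b x) k).
  move=> ha hb; apply: holo_sum => i.
  by apply: holoM; [apply: ha; rewrite -ltnS|apply: hb; exact: leq_subr].
elim/ltn_ind => k ih; under eq_fun do rewrite -Hw /F.
apply: holoD; first exact: hg0.
case: k ih => [|k] ih; first exact: holo_cst.
apply: holo_sum => i; apply: (hconv) => [l _|]; first exact: hg.
elim: {i}(i.+1) => [|i ihi] l lk; first exact: holo_cst.
by apply: (@hconv (fun x => w x) (fun x => cpow (w x) i)) => m ml; [apply: ih; rewrite ltnS (leq_trans ml)|apply: ihi; exact: leq_trans lk].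
Qed.

(** [P] bounds the sum in [step] on the ball [|w| <= A], and [L] its Lipschitz constant. [rho1]
    makes [|h| P <= K] and [|h| L <= 1 / 2], so [step] maps the ball to itself, as [K + K = A], and
    contracts by 1/2. *)
Let P := \sum_(i < n) K * A ^+ i.+1.
Let L := \sum_(i < n) K * (i.+1%:R * A ^+ i).
Let rho1 := Num.min rho (Num.min (K / (P + 1)) (1 / (2 * (L + 1)))).
Let A0 : 0 <= A. Proof. by rewrite mulr_ge0// ltW. Qed.
Let P0 : 0 <= P. Proof. by apply: sumr_ge0 => i _; rewrite mulr_ge0 ?exprn_ge0// ltW. Qed.
Let L0 : 0 <= L.
Proof. by apply: sumr_ge0 => i _; rewrite !mulr_ge0 ?exprn_ge0// ltW. Qed.
Let rho10 : 0 < rho1.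
Proof. by rewrite !lt_min rho0 !divr_gt0 ?mulr_gt0 ?ltr_wpDl. Qed.
Let sub1 : borel_disc t rho1 `<=` (borel_disc t rho : set C).
Proof. by apply: borel_disc_le => //; rewrite ge_min lexx. Qed.

Let sum_le x h w : X x -> borel_disc t rho1 h -> cabs w <= A ->
  cabs (h * \sum_(i < n) G i x h * w ^+ i.+1) <= K.
Proof.
move=> Xx Bh wA; rewrite cabsM.
have s : cabs (\sum_(i < n) G i x h * w ^+ i.+1) <= P.
  rewrite (le_trans (cabs_sum _ _ _))// ler_sum// => i _; rewrite cabsM cabsX.
  apply: ler_pM; rewrite ?exprn_ge0//; first exact: (gev_bound (@gevG 0%N i x Xx) (sub1 Bh)).
  by rewrite lerXn2r ?nnegrE.
have hb : cabs h * (P + 1) <= K.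
  rewrite -ler_pdivlMr ?ltr_wpDl//; apply: (le_trans (ltW (borel_disc_cabs rho10 Bh))).
  by rewrite !ge_min lexx !orbT.
rewrite (le_trans _ hb)//; apply: ler_wpM2l => //.
by rewrite (le_trans s)// lerDl.
Qed.

Let step_le x h w : X x -> borel_disc t rho1 h -> cabs w <= A -> cabs (step x h w) <= A.
Proof.
move=> Xx Bh wA; rewrite (le_trans (cabsD _ _))// /A mulr2n mulrDl mul1r lerD//.
  exact: (gev_bound (@gev0 0%N x Xx) (sub1 Bh)).
exact: sum_le.
Qed.

Let step_lip x h w v : X x -> borel_disc t rho1 h -> cabs w <= A -> cabs v <= A ->
  cabs (step x h w - step x h v) <= 2^-1 * cabs (w - v).
Proof.
move=> Xx Bh wA vA; have -> : step x h w - step x h v = h * \sum_(i < n) G i x h * (w ^+ i.+1 - v ^+ i.+1).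
  under [in RHS]eq_bigr do rewrite mulrBr.
  by rewrite sumrB /step; ring.
rewrite cabsM.
have s : cabs (\sum_(i < n) G i x h * (w ^+ i.+1 - v ^+ i.+1)) <= L * cabs (w - v).
  rewrite (le_trans (cabs_sum _ _ _))// /L mulr_suml ler_sum// => i _; rewrite cabsM -mulrA.
  by apply: ler_pM => //; [exact: (gev_bound (@gevG 0%N i x Xx) (sub1 Bh))|exact: cabs_powB].
have hb : cabs h * (L + 1) <= 2^-1.
  have l0 : 0 < L + 1 by rewrite ltr_wpDl.
  rewrite -ler_pdivlMr//; apply: (le_trans (ltW (borel_disc_cabs rho10 Bh))).
  by rewrite !ge_min -invfM div1r lexx !orbT.
apply: (le_trans (ler_wpM2l (cabs_ge0 _) s)); rewrite mulrA; apply: ler_wpM2r => //.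
by rewrite (le_trans _ hb)//; apply: ler_wpM2l => //; rewrite lerDl.
Qed.

Lemma gevrey_fixpoint : exists rho2 M2 (u : 'rV[C]_d -> C -> C) (w : nat -> 'rV[C]_d -> C),
  [/\ 0 < rho2 <= rho, 0 < M2, holomorphic (X `*` borel_disc t rho2) (fun p => u p.1 p.2),
      forall k, holomorphic X (w k) &
      forall x, X x ->
        (forall h, borel_disc t rho2 h ->
          u x h = G0 x h + h * \sum_(i < n) G i x h * u x h ^+ i.+1) /\
        forall N, gev t rho2 N (2 * K) M2 (u x) (w ^~ x)].
Proof.
pose W k x h := iter k (step x h) 0.
have W_le k x h : X x -> borel_disc t rho1 h -> cabs (W k x h) <= A.
  by move=> Xx Bh; elim: k => [|k ih]; rewrite /W ?cabs0//=; exact: step_le.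
have W_lip k x h : X x -> borel_disc t rho1 h -> cabs (W k.+1 x h - W k x h) <= A * 2^-1 ^+ k.
  move=> Xx Bh; elim: k => [|k ih].
    by rewrite expr0 mulr1 {2}/W /= subr0; exact: (W_le 1%N).
  apply: (le_trans (step_lip Xx Bh (W_le k.+1 _ _ Xx Bh) (W_le k _ _ Xx Bh))).
  by rewrite exprS mulrCA ler_wpM2l.
have W_dist k m x h : X x -> borel_disc t rho1 h -> cabs (W (k + m)%N x h - W k x h) <= 2 * A * 2^-1 ^+ k.
  move=> Xx Bh.
  suff : cabs (W (k + m)%N x h - W k x h) <= 2 * A * (2^-1 ^+ k - 2^-1 ^+ (k + m)).
    move/le_trans; apply; apply: ler_wpM2l; first by rewrite mulr_ge0.
    by rewrite gerBl exprn_ge0.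
  elim: m => [|m ih]; first by rewrite addn0 !subrr cabs0 mulr0.
  rewrite addnS (le_trans (cabs_tri (W (k + m)%N x h) _ _))//.
  rewrite (le_trans (lerD (W_lip _ _ _ Xx Bh) ih))// exprS le_eqVlt; apply/orP; left; apply/eqP.
  by move: (2^-1 ^+ (k + m)) (2^-1 ^+ k) => a b; field.
have lim_ex (p : 'rV[C]_d * C) : exists l, X p.1 -> borel_disc t rho1 p.2 -> ccvg (fun k => W k p.1 p.2) l.
  case: (pselect (X p.1 /\ borel_disc t rho1 p.2)) => [[Xx Bh]|nXB]; last first.
    by exists 0 => X1 B1; case: nXB.
  have q1 : (2^-1 : R) < 1 by rewrite invf_lt1// ltr1n.
  have q0 : 0 <= (2^-1 : R) by rewrite invr_ge0.
  have rc := rcvg0Z (mulr_ge0 (ler0n _ 2) (mulr_ge0 (ler0n _ 2) A0)) (rcvg0_geometric q0 q1).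
  have [l Hl] : exists l, ccvg (fun k => W k p.1 p.2) l.
    apply: ccauchy => e /rc[N HN]; exists N => i j Ni Nj.
    rewrite (le_trans (cabs_tri (W N p.1 p.2) _ _))// (le_trans _ (HN N (leqnn _)))//.
    have -> : 2 * (2 * A) * 2^-1 ^+ N = 2 * A * 2^-1 ^+ N + 2 * A * 2^-1 ^+ N.
      by move: (2^-1 ^+ N) => a; ring.
    apply: lerD.
      by rewrite -(subnKC Ni); exact: W_dist.
    by rewrite cabsBC -(subnKC Nj); exact: W_dist.
  by exists l.
have [u' Hu'] := choice lim_ex.
pose u x h := u' (x, h).
have Hu x h : X x -> borel_disc t rho1 h -> ccvg (fun k => W k x h) (u x h).
  exact: (Hu' (x, h)).
have u_dist k x h : X x -> borel_disc t rho1 h -> cabs (W k x h - u x h) <= 2 * A * 2^-1 ^+ k.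
  move=> Xx Bh; rewrite cabsBC; apply/ler_addgt0Pl => e /(Hu x h Xx Bh)[N HN].
  rewrite (le_trans (cabs_tri (W (k + N)%N x h) _ _))// lerD ?W_dist//.
  by rewrite cabsBC HN// leq_addl.
have rc : @rcvg0 R (fun k => 2 * A * 2^-1 ^+ k).
  by apply: rcvg0Z; [rewrite mulr_ge0|apply: rcvg0_geometric; rewrite ?invr_ge0// invf_lt1// ltr1n].
have u_le x h : X x -> borel_disc t rho1 h -> cabs (u x h) <= A.
  move=> Xx Bh; apply: (ccvg_le (Hu x h Xx Bh)); exists 0%N => k _; exact: W_le.
have u_fix x h : X x -> borel_disc t rho1 h -> u x h = step x h (u x h).
  move=> Xx Bh; apply: (ccvg_uniq (u := fun k => W k.+1 x h)).
    by move=> e /(Hu x h Xx Bh)[N HN]; exists N => k Nk; apply: HN; exact: leqW.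
  apply: (ccvg_rate rc) => k.
  apply: (le_trans (step_lip Xx Bh (W_le k _ _ Xx Bh) (u_le _ _ Xx Bh))).
  by rewrite (le_trans _ (u_dist k x h Xx Bh))// ler_piMl// invf_le1// ler1n.
have oXB : open (X `*` (borel_disc t rho1 : set C)) by apply: open_setX => //; exact: open_borel_disc.
have [w [hw wE]] := formal_fixpoint.
(* [Av] is the constant that [gevX], [gevM] and [gev_sum] give for the bracket when [u] has constant
   [A = 2 K]. As [Av <= K * M2], [gev_mulh] brings it down to [K], and adding the [K] of [G0]
   restores [A]: the constants are the same at every order. *)
pose Av := \sum_(i < n) 6 * (K * (6 * A) ^+ i.+1).
have Av0 : 0 <= Av by apply: sumr_ge0 => i _; rewrite !mulr_ge0 ?exprn_ge0 ?mulr_ge0// ltW.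
pose M2 := M + Av / K.
have MM2 : M <= M2 by rewrite lerDl divr_ge0// ltW.
have M20 : 0 < M2 by exact: lt_le_trans MM2.
have rr : rho1 <= rho by rewrite ge_min lexx.
exists rho1, M2, u, w; split => //; first by rewrite rho10.
  apply: (@holo_lim _ _ (X `*` borel_disc t rho1) (fun k p => W k p.1 p.2) _ _ oXB _ rc).
    elim=> [|k ih]; first exact: holo_cst.
    have sub : X `*` borel_disc t rho1 `<=` X `*` (borel_disc t rho : set C).
      by move=> [x h] [/= Xx Bh]; split => //; exact: sub1.
    apply: holoD; first exact: holo_sub hG0.
    apply: holoM; first exact: (holo_snd (f := fun z => z) (@holo_id _ _)).
    apply: holo_sum => i; apply: holoM; first exact: holo_sub (hG i).
    exact: holoX.
  by move=> k [x h] [/= Xx Bh]; exact: u_dist.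
move=> x Xx; split; first by move=> h; exact: u_fix.
have sub N f c : gev t rho N K M f c -> gev t rho1 N K M2 f c.
  move=> H; apply: (@gev_le _ _ _ _ K M) => //; try exact: ltW.
  by move=> k h kN Bh; apply: H => //; exact: sub1.
elim=> [|N ih].
  by move=> [|//] h _ Bh; rewrite big_ord0 subr0 !expr0 fact0 !mulr1; exact: u_le.
have M20' := ltW M20; have K0' := ltW K0.
have S1 := gev_sum (fun i => gevM rho10 K0' (exprn_ge0 i.+1 (mulr_ge0 (ler0n _ 6) A0)) M20'
  (sub _ _ _ (@gevG N i x Xx)) (gevX rho10 i.+1 A0 M20' ih)).
have KA : Av <= K * M2.
  by rewrite /M2 mulrDr (mulrC K (Av / K)) divfK ?gt_eqF// lerDr mulr_ge0// ltW.
have bA h : borel_disc t rho1 h -> cabs (h * \sum_(i < n) G i x h * u x h ^+ i.+1) <= K.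
  by move=> Bh; apply: sum_le => //; exact: u_le.
have S2 := gev_mulh Av0 K0' M20' KA bA S1.
have S3 := gevD (sub _ _ _ (@gev0 N.+1 x Xx)) S2.
rewrite /A mulr2n mulrDl mul1r.
have -> : w^~ x = (fun k => g0 x k + (if k is j.+1 then \sum_(i < n) cconv (g i x) (cpow (w ^~ x) i.+1) j else 0)).
  by apply/funext => k; exact: wE.
by apply: gev_ext S3 => h Bh; rewrite -[LHS]/(step x h (u x h)) -u_fix.
Qed.

End FixedPoint.

(** * Recentring the polynomial at the leading-order root *)

Section Root.
Variable R : realType.
Local Notation C := (CC R).
Variables (d m : nat) (X : set 'rV[C]_d) (t rho K M Cf Cb : R).
Variables (a : 'I_m.+2 -> 'rV[C]_d -> C -> C) (ahat : 'I_m.+2 -> nat -> 'rV[C]_d -> C).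
Variable f0 : 'rV[C]_d -> C.
Hypotheses (oX : open X) (rho0 : 0 < rho) (rho1 : rho <= 1) (K0 : 0 < K) (M1 : 1 <= M).
Hypotheses (Cf1 : 1 <= Cf) (Cb0 : 0 < Cb).
Hypothesis ha : forall i, holomorphic (X `*` borel_disc t rho) (fun p => a i p.1 p.2).
Hypothesis hahat : forall i k, holomorphic X (ahat i k).
Hypothesis gev_a : forall i N x, X x -> gev t rho N K M (a i x) (fun k => ahat i k x).
Hypothesis hf0 : holomorphic X f0.
Hypothesis f0_le : forall x, X x -> cabs (f0 x) <= Cf.
Hypothesis f0_root : forall x, X x -> root (pol (fun i => ahat i 0%N x)) (f0 x).
Let b x := (pol (fun i => ahat i 0%N x))^`().[f0 x].
Hypothesis b0 : forall x, X x -> b x != 0.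
Hypothesis b_le : forall x, X x -> cabs (b x)^-1 <= Cb.

Let M0 : 0 <= M. Proof. exact: le_trans M1. Qed.

(* [c i x h] is the coefficient of w^i in the polynomial at f0 x + w. *)
Let q i x (j : 'I_m.+2) : C := 'C(j, i)%:R * f0 x ^+ (j - i).
Let c i x h := \sum_(j < m.+2) q i x j * a j x h.
Let chat i x k := \sum_(j < m.+2) q i x j * ahat j k x.

Let D := \sum_(j < m.+2) (2 ^+ m.+1 * Cf ^+ m.+1) * K.
Let D0 : 0 < D.
Proof.
rewrite /D sumr_const card_ord pmulrn_lgt0// !mulr_gt0// exprn_gt0//.
exact: lt_le_trans Cf1.
Qed.

Let q_le i x j : X x -> cabs (q i x j) <= 2 ^+ m.+1 * Cf ^+ m.+1.
Proof.
move=> Xx; have jm : (j <= m.+1)%N by rewrite -ltnS.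
rewrite /q cabsM cabsX cabs_nat; apply: ler_pM => //; first by rewrite exprn_ge0.
  by rewrite -natrX ler_nat (leq_trans (bin_le_exp2 _ _))// leq_exp2l.
apply: (@le_trans _ _ (Cf ^+ (j - i))).
  by rewrite lerXn2r ?nnegrE// ?f0_le//; exact: le_trans Cf1.
by rewrite ler_weXn2l// (leq_trans (leq_subr _ _)).
Qed.

Let gev_c i N x : X x -> gev t rho N D M (c i x) (chat i x).
Proof.
move=> Xx; apply: gev_sum => j; apply: (gev_le _ _ _ _ (gevZ _ (@gev_a j N x Xx))) => //.
  by rewrite mulr_ge0// ltW.
by rewrite ler_wpM2r ?q_le// ltW.
Qed.

Let chat00 x : X x -> chat 0 x 0%N = 0.
Proof.
move=> /f0_root/rootP; rewrite pol_horner => <-; apply: eq_bigr => j _.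
by rewrite /q bin0 mul1r subn0 mulrC.
Qed.

Let chat10 x : chat 1 x 0%N = b x.
Proof.
rewrite /b pol_deriv_horner; apply: eq_bigr => j _.
by rewrite /q bin1 subn1 mulrC mulr_natl.
Qed.

Let pol_taylor x h w : (pol (fun i => a i x h)).[f0 x + w] = \sum_(i < m.+2) c i x h * w ^+ i.
Proof.
rewrite pol_horner; under [RHS]eq_bigr do rewrite mulr_suml.
rewrite exchange_big /=; apply: eq_bigr => j _; rewrite exprDn.
rewrite (big_ord_widen m.+2 (fun i => (f0 x ^+ (j - i) * w ^+ i) *+ 'C(j, i)) (ltn_ord j)).
rewrite big_mkcond mulr_sumr /=; apply: eq_bigr => i _.
case: ltnP => ij; last by rewrite /q bin_small// !mul0r mulr0.
by rewrite /q -mulr_natl; ring.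
Qed.

(** In the difference of the equations at two roots the constant term cancels, the linear
    coefficient is close to [b x], and the higher terms carry a factor [delta]; dividing by [b x]
    gives [|w - w'| <= |w - w'| / 2]. *)
Lemma root_unique : exists delta rho3, [/\ 0 < delta, 0 < rho3 &
  forall x h z z', X x -> borel_disc t rho h -> cabs h <= rho3 ->
    cabs (z - f0 x) <= delta -> cabs (z' - f0 x) <= delta ->
    root (pol (fun i => a i x h)) z -> root (pol (fun i => a i x h)) z' -> z = z'].
Proof.
pose E := \sum_(i < m) D * i.+2%:R.
have E0 : 0 <= E by apply: sumr_ge0 => i _; rewrite mulr_ge0// ltW.
have DM0 : 0 <= D * M by rewrite mulr_ge0// ltW.
(* After division by [b x], bounded through [Cb], each of the two perturbations contributes at most
   1/4; [delta <= 1] allows all powers of [w] above the first to be replaced by one factor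
   [delta]. *)
pose delta := Num.min 1 ((4 * Cb * (E + 1))^-1).
pose rho3 := (4 * Cb * (D * M + 1))^-1.
have delta0 : 0 < delta by rewrite lt_min ltr01 invr_gt0 !mulr_gt0// ltr_wpDl.
exists delta, rho3; split => //; first by rewrite invr_gt0 !mulr_gt0// ltr_wpDl.
move=> x h z z' Xx Bh hr zd zd'.
rewrite -{1}(subrK (f0 x) z) -{1}(subrK (f0 x) z') !(addrC _ (f0 x)) => /rootP + /rootP.
rewrite !pol_taylor; move: (z - f0 x) (z' - f0 x) zd zd' (subrK (f0 x) z) (subrK (f0 x) z').
move=> w w' wd wd' <- <- rw rw'; congr (_ + _); apply/eqP; rewrite -subr_eq0 -cabs_eq0; apply/eqP.
have d1 : delta <= 1 by rewrite ge_min lexx.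
have H : \sum_(i < m.+2) c i x h * w ^+ i - \sum_(i < m.+2) c i x h * w' ^+ i = 0.
  by rewrite rw rw' subrr.
move: H; rewrite -sumrB big_ord_recl big_ord_recl /= !expr0 subrr add0r /bump /= addn0 !expr1 -mulrBr.
set s := \sum_(i < m) _ => H.
have sE : cabs s <= E * delta * cabs (w - w').
  rewrite (le_trans (cabs_sum _ _ _))// /E !mulr_suml; apply: ler_sum => i _.
  rewrite -mulrBr cabsM -!mulrA; apply: ler_pM => //.
    exact: (gev_bound (@gev_c _ 0%N x Xx) Bh).
  rewrite (le_trans (cabs_powB _ wd wd'))// -mulrA ler_wpM2l//.
  rewrite exprS -mulrA; apply: ler_wpM2l; first exact: ltW.
  by rewrite ler_piMl// exprn_ile1// ltW.
have c1 : cabs (c 1 x h - b x) <= D * M * cabs h.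
  have := @gev_c 1%N 1%N x Xx 1%N h (leqnn _) Bh.
  by rewrite big_ord1 expr0 mulr1 chat10 !expr1 factS fact0 muln1 mulr1.
have bw : cabs (b x) * cabs (w - w') <= (D * M * cabs h + E * delta) * cabs (w - w').
  rewrite -cabsM mulrDl.
  have -> : b x * (w - w') = - ((c 1%N x h - b x) * (w - w') + s).
    by move: H => /eqP; rewrite addr_eq0 => /eqP Hs; rewrite mulrBl Hs; ring.
  rewrite cabsN (le_trans (cabsD _ _))// cabsM lerD// ler_wpM2r//.
have bC : 1 <= Cb * cabs (b x).
  have bx := b0 Xx; have := ler_wpM2r (cabs_ge0 (b x)) (b_le Xx).
  by rewrite -cabsM mulVf// cabs1.
have small : Cb * (D * M * cabs h + E * delta) <= 1 / 2.
  have p1 : 0 < 4 * Cb * (D * M + 1) by rewrite !mulr_gt0// ltr_wpDl.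
  have p2 : 0 < 4 * Cb * (E + 1) by rewrite !mulr_gt0// ltr_wpDl.
  have e1 : 4 * Cb * (D * M + 1) * cabs h <= 1.
    by rewrite mulrC -ler_pdivlMr// div1r.
  have e2 : 4 * Cb * (E + 1) * delta <= 1.
    by rewrite mulrC -ler_pdivlMr// div1r ge_min lexx orbT.
  have e3 : 0 <= Cb * cabs h by rewrite mulr_ge0// ltW.
  have e4 : 0 <= Cb * delta by rewrite mulr_ge0 ?ltW.
  nra.
have y0 := cabs_ge0 (w - w').
apply/eqP; rewrite eq_le y0 andbT.
have l1 : cabs (w - w') <= Cb * cabs (b x) * cabs (w - w') by rewrite ler_peMl.
have l2 := ler_wpM2l (ltW Cb0) bw; rewrite !mulrA in l2.
have l3 := ler_wpM2r y0 small.
lra.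
Qed.

Let hq i j : holomorphic X (fun x => q i x j).
Proof. by apply: holoZ; exact: holoX. Qed.

Let hchat i k : holomorphic X (chat i ^~ k).
Proof. by apply: holo_sum => j; apply: holoM. Qed.

Let hbV : holomorphic X (fun x => (b x)^-1).
Proof.
apply: holoV => //; apply: (holo_eq oX _ (@hchat 1%N 0%N)) => x _; exact: chat10.
Qed.

Let hc i : holomorphic (X `*` borel_disc t rho) (fun p => c i p.1 p.2).
Proof. by apply: holo_sum => j; apply: holoM => //; apply: (@holo_fst _ _ _ X _ (fun x => q i x j)). Qed.

Let h_neq0 h : borel_disc t rho h -> h != 0. Proof. exact: borel_disc_neq0. Qed.

Let hsnd : holomorphic (X `*` borel_disc t rho) (fun p : 'rV[C]_d * C => p.2).
Proof. exact: (holo_snd (f := fun z => z) (@holo_id _ _)). Qed.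

Let hdiv i : holomorphic (X `*` borel_disc t rho)
  (fun p => - (b p.1)^-1 * ((c i p.1 p.2 - chat i p.1 0%N) / p.2)).
Proof.
apply: holoM.
  under eq_fun do rewrite -mulN1r; apply: holoZ.
  exact: (@holo_fst _ _ _ X _ (fun x => (b x)^-1)).
apply: holoM; last by apply: holoV => // -[x h] [/= _]; exact: h_neq0.
by apply: holoB => //; apply: (@holo_fst _ _ _ X _ (chat i ^~ 0%N)).
Qed.

Let shift (v : nat -> C) k := if k is j.+1 then v j else 0.

Let gev_mulhX N L f v k : 0 <= L -> gev t rho N L (2 * M) f v ->
  gev t rho N L (2 * M) (fun h => h ^+ k * f h) (iter k shift v).
Proof.
move=> L0 Hf; elim: k => [|k ih] /=; first by under eq_fun do rewrite expr0 mul1r.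
have M2 : 1 <= 2 * M by have := M1; lra.
have H := gev_mulh L0 L0 (le_trans ler01 M2) (ler_peMr L0 M2) _ ih.
have {}H := H _; move=> n h nN Bh; rewrite exprS -mulrA; apply: H => //; last exact: leqW.
move=> {n h nN Bh} h Bh; rewrite cabsM (le_trans _ (gev_bound ih Bh))// ler_piMl//.
exact: le_trans (ltW (borel_disc_cabs rho0 Bh)) rho1.
Qed.

(** [G i] multiplies [u^(i+1)]. For [i = 0] the part [b x * u] of the linear term has gone to the
    left-hand side, so that the rest is divisible by [h]. For [i = k + 1] the factor [h^(k+2)] that
    comes with [u^(k+2)], divided by [h] and by the [h] before the bracket, leaves [h^k]. *)
Let G i x h := if i is k.+1 then h ^+ k * (- (b x)^-1 * c k.+2 x h)
  else - (b x)^-1 * ((c 1%N x h - chat 1%N x 0%N) / h).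
Let g i x := if i is k.+1 then iter k shift (fun l => - (b x)^-1 * chat k.+2 x l)
  else fun l => - (b x)^-1 * chat 1%N x l.+1.
Let Kg := Cb * (D * M).

Let gevK N x (e : C -> C) v : X x -> gev t rho N (D * M) (2 * M) e v ->
  gev t rho N Kg (2 * M) (fun h => - (b x)^-1 * e h) (fun k => - (b x)^-1 * v k).
Proof.
have DM0 : 0 <= D * M by rewrite mulr_ge0// ltW.
move=> Xx H; apply: (gev_le _ _ _ _ (gevZ _ H)) => //; rewrite ?mulr_ge0 ?(ltW D0)//.
by rewrite cabsN ler_wpM2r// b_le.
Qed.

Let gev_div i N x : X x -> gev t rho N Kg (2 * M)
  (fun h => - (b x)^-1 * ((c i x h - chat i x 0%N) / h)) (fun l => - (b x)^-1 * chat i x l.+1).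
Proof. by move=> Xx; apply: gevK => //; apply: (gev_divh rho0 (ltW D0) M0); exact: gev_c. Qed.

Let Kg0 : 0 < Kg.
Proof. by rewrite !mulr_gt0// (lt_le_trans ltr01). Qed.

Let gev_G i N x : X x -> gev t rho N Kg (2 * M) (G i x) (g i x).
Proof.
move=> Xx; case: i => [|k] /=; first exact: gev_div.
apply: gev_mulhX; first exact: ltW.
apply: gevK => //; apply: (gev_le _ _ _ _ (@gev_c k.+2 N x Xx)) => //; first exact: ltW.
  by rewrite ler_peMr// ltW.
by have := M1; lra.
Qed.

Let hG i : holomorphic (X `*` borel_disc t rho) (fun p => G i p.1 p.2).
Proof.
case: i => [|k] /=; first exact: hdiv.
apply: holoM; first exact: holoX.
apply: holoM => //; under eq_fun do rewrite -mulN1r; apply: holoZ.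
exact: (@holo_fst _ _ _ X _ (fun x => (b x)^-1)).
Qed.

Let hbN : holomorphic X (fun x => - (b x)^-1).
Proof. by under eq_fun do rewrite -mulN1r; apply: holoZ. Qed.

Let hg i k : holomorphic X (g i ^~ k).
Proof.
case: i => [|i] /=; first by apply: holoM.
have hshift l (v : 'rV[C]_d -> nat -> C) : (forall k, holomorphic X (v ^~ k)) ->
    forall k, holomorphic X (fun x => iter l shift (v x) k).
  move=> hv; elim: l => [//|l ih] [|k'] /=; [exact: holo_cst|exact: ih].
by apply: (hshift i (fun x l => - (b x)^-1 * chat i.+2 x l)) => l; apply: holoM.
Qed.

Let gev_G0 N x : X x -> gev t rho N Kg (2 * M)
  (fun h => - (b x)^-1 * ((c 0%N x h - chat 0%N x 0%N) / h)) (fun l => - (b x)^-1 * chat 0%N x l.+1).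
Proof. exact: gev_div. Qed.

Let root_of_fixpoint x h u : X x -> h != 0 ->
  u = - (b x)^-1 * ((c 0%N x h - chat 0%N x 0%N) / h) + h * \sum_(i < m.+1) G i x h * u ^+ i.+1 ->
  root (pol (fun i => a i x h)) (f0 x + h * u).
Proof.
move=> Xx h0 E; apply/rootP; rewrite pol_taylor 2!big_ord_recl /= expr0 mulr1 /bump /= addn0 expr1.
have bx := b0 Xx.
have S : h * (\sum_(i < m) G i.+1 x h * u ^+ i.+2) =
    - (b x)^-1 * (\sum_(i < m) c (1 + (1 + i)) x h * (h * u) ^+ (1 + (1 + i))) / h.
  rewrite !mulr_sumr mulr_suml; apply: eq_bigr => i _; rewrite /G !add1n exprMn !(exprS h).
  by move: (h ^+ i) (c _ x h) (u ^+ _) => p r s; field; rewrite h0 bx.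
move: E; rewrite big_ord_recl /= mulrDr (eq_bigr (fun i : 'I_m => G i.+1 x h * u ^+ i.+2)) // S.
rewrite chat10 (chat00 Xx) subr0 expr1.
move: (\sum_(i < m) _) (c 0%N x h) (c 1%N x h) => s c0 c1 E.
have E2 : - (b x) * h * u = c0 + h * (c1 - b x) * u + s.
  by rewrite {1}E; field; rewrite h0 bx.
have -> : c0 + (c1 * (h * u) + s) = (c0 + h * (c1 - b x) * u + s) + b x * h * u by ring.
by rewrite -E2; ring.
Qed.

Lemma root_expansion : exists rho2 K2 M2 (f : 'rV[C]_d -> C -> C) (fk : nat -> 'rV[C]_d -> C),
  [/\ [/\ 0 < rho2 <= rho, 0 < K2 & 0 < M2],
      holomorphic (X `*` borel_disc t rho2) (fun p => f p.1 p.2),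
      forall k, holomorphic X (fk k),
      forall x h, X x -> borel_disc t rho2 h -> root (pol (fun i => a i x h)) (f x h) &
      forall x, X x -> fk 0%N x = f0 x /\ forall N, gev t rho2 N K2 M2 (f x) (fk ^~ x)].
Proof.
have M20 : 0 < 2 * M by rewrite mulr_gt0// (lt_le_trans ltr01).
have hg0 k : holomorphic X (fun x => - (b x)^-1 * chat 0%N x k.+1) by apply: holoM.
have [r2 [M2 [u [w [/andP[r20 r2r] M2p hu hw H]]]]] :=
  @gevrey_fixpoint R d m.+1 X t rho Kg (2 * M) _ _ (fun i : 'I_m.+1 => G i) (fun i : 'I_m.+1 => g i)
  oX rho0 Kg0 M20 (@hdiv 0%N) (fun i => @hG i) hg0 (fun i => @hg i)
  (fun N => @gev_G0 N) (fun N i => @gev_G i N).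
have sub : borel_disc t r2 `<=` (borel_disc t rho : set C) by exact: borel_disc_le.
pose A := 2 * Kg.
have A0 : 0 <= A by rewrite mulr_ge0// ltW.
(* [Cf] bounds [f0], and [A] bounds [h * u] since [|h| <= 1]; the 1 added to [M2] ensures
   [A <= A * (M2 + 1)], as [gev_mulh] asks. *)
exists r2, (Cf + A), (M2 + 1), (fun x h => f0 x + h * u x h),
  (fun k x => (if k == 0%N then f0 x else 0) + (if k is j.+1 then w j x else 0)).
have M21 : 0 <= M2 + 1 by rewrite addr_ge0// ltW.
split.
- rewrite r20 r2r; split => //; last by rewrite ltr_wpDl// ltW.
  by rewrite ltr_wpDr// (lt_le_trans ltr01).
- apply: holoD; first exact: holo_fst hf0.
  by apply: holoM => //; exact: (holo_snd (f := fun z => z) (@holo_id _ _)).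
- move=> [|k] /=; apply: holoD => //; exact: holo_cst.
- move=> x h Xx Bh; have [Hu _] := H x Xx.
  by apply: root_of_fixpoint => //; [exact: h_neq0 (sub _ Bh)|exact: Hu].
move=> x Xx; split=> [|N]; first by rewrite /= addr0.
have [_ Hg] := H x Xx.
have M2M : M2 <= M2 + 1 by rewrite lerDl.
have HgN := gev_le A0 (lexx A) (ltW M2p) M2M (Hg N).
have AM : A <= A * (M2 + 1) by rewrite ler_peMr// lerDr ltW.
have bA h : borel_disc t r2 h -> cabs (h * u x h) <= A.
  move=> Bh; rewrite cabsM (le_trans _ (gev_bound (Hg 0%N) Bh))// ler_piMl//.
  exact: le_trans (ltW (borel_disc_cabs rho0 (sub _ Bh))) rho1.
have H1 := gev_mulh A0 A0 M21 AM bA HgN.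
have H2 := gev_le (cabs_ge0 _) (f0_le Xx) M21 (lexx _) (@gev_cst R t r2 N.+1 (M2 + 1) (f0 x) M21).
by move=> n h nN Bh; apply: (gevD H2 H1) => //; exact: leqW.
Qed.

End Root.

(** * Sectorial domains *)

Section Sectors.
Variable R : realType.
Local Notation C := (CC R).

Lemma cvg_reim (T : Type) (F : set_system T) (FF : Filter F) (f : T -> C) (l : C) :
  (fun x => re (f x)) @ F --> re l -> (fun x => im (f x)) @ F --> im l -> f @ F --> l.
Proof.
move=> /cvgrPdist_lt hr /cvgrPdist_lt hi; apply/cvgrPdist_lt => e e0; have [-> r0] := gt0C e0.
have r2 : 0 < re e / 2 by rewrite divr_gt0.
near=> x; rewrite normC_cabs ltC_ofR (le_lt_trans (cabs_le_reim _))// !reimE.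
have h1 : `|re l - re (f x)| < re e / 2 by near: x; exact: hr.
have h2 : `|im l - im (f x)| < re e / 2 by near: x; exact: hi.
lra.
Unshelve. all: by end_near. Qed.

Lemma cvg_ofR (T : Type) (F : set_system T) (FF : Filter F) (f : T -> R) (l : R) :
  f @ F --> l -> (fun x => ofR (f x) : C) @ F --> (ofR l : C).
Proof. by move=> h; apply: cvg_reim => //; exact: cvg_cst. Qed.

Lemma cder_cvg (F : R -> C) x l : cder F x l -> F @ x --> F x.
Proof. by move=> /cder_continuous[h1 h2]; apply: cvg_reim. Qed.

Lemma continuous_dir (x : R) : @dir R @ x --> @dir R x.
Proof. exact: (cder_cvg (cder_dir (is_derive_id x 1))). Qed.

Lemma openC (U : set C) : (forall h, U h -> exists2 e, 0 < e & forall y, cabs (y - h) < e -> U y) -> open U.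
Proof.
move=> H; rewrite openE => h /H[e e0 He].
apply/nbhs_ballP; exists (ofR e) => /=; first by rewrite -ofR0 ltC_ofR.
by move=> y; rewrite /ball /= normC_cabs ltC_ofR cabsBC => /He.
Qed.

Definition cconvex (U : set C) := forall x y s, U x -> U y -> 0 <= s -> s <= 1 ->
  U (ofR (1 - s) * x + ofR s * y).

Lemma cconvexI (U V : set C) : cconvex U -> cconvex V -> cconvex (U `&` V).
Proof. by move=> cU cV x y s [Ux Vx] [Uy Vy] s0 s1; split; [exact: cU|exact: cV]. Qed.

Lemma cconvex_ball (c : C) r : cconvex [set h | cabs (h - c) < r].
Proof.
move=> x y s /= hx hy s0 s1.
have -> : ofR (1 - s) * x + ofR s * y - c = ofR (1 - s) * (x - c) + ofR s * (y - c).
  by rewrite ofRB ofR1; ring.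
rewrite (le_lt_trans (cabsD _ _))// !cabsM !cabs_ofR !ger0_norm ?subr_ge0//.
have [s00|sp] := eqVneq s 0; first by rewrite s00 subr0 mul1r mul0r addr0.
have {}sp : 0 < s by rewrite lt_def sp.
have h1 : (1 - s) * cabs (x - c) <= (1 - s) * r by rewrite ler_wpM2l ?subr_ge0// ltW.
have h2 : s * cabs (y - c) < s * r by rewrite ltr_pM2l.
by rewrite (lt_le_trans (ler_ltD h1 h2))// -mulrDl subrK mul1r.
Qed.

Definition half_plane (u : C) : set C := [set h | 0 < im (h * u)].

Lemma cconvex_half_plane u : cconvex (half_plane u).
Proof.
move=> x y s; rewrite /half_plane /= => hx hy s0 s1.
have -> : im ((ofR (1 - s) * x + ofR s * y) * u) = (1 - s) * im (x * u) + s * im (y * u).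
  by rewrite !reimE; ring.
have [->|sp] := eqVneq s 0; first by rewrite subr0 mul1r mul0r addr0.
have {}sp : 0 < s by rewrite lt_def sp.
by rewrite ltr_wpDl ?mulr_gt0// mulr_ge0 ?subr_ge0// ltW.
Qed.

Lemma open_half_plane u : open (half_plane u).
Proof.
apply: openC => h; rewrite /half_plane /= => hu.
have d0 : 0 < cabs u + 1 by rewrite ltr_wpDl.
exists (im (h * u) / (cabs u + 1)); first by rewrite divr_gt0.
move=> y; rewrite ltr_pdivlMr// => yh.
have E : im (y * u) = im (h * u) + im ((y - h) * u) by rewrite !reimE; ring.
have := im_le_cabs ((y - h) * u); rewrite cabsM ler_norml => /andP[l _].
have := cabs_ge0 (y - h); have := cabs_ge0 u; rewrite E; nra.
Qed.

Lemma cconvex_connected (U : set C) : cconvex U -> connected U.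
Proof.
move=> cU; have [->|/set0P[x0 Ux0]] := eqVneq U set0; first exact: connected0.
have -> : U = \bigcup_(y in U) ((fun s : R => ofR (1 - s) * x0 + ofR s * y : C) @` `[0, 1]).
  apply/seteqP; split => [y Uy|z [y Uy [s]]].
    exists y => //; exists 1; first by rewrite /= in_itv /= ler01 lexx.
    by rewrite subrr ofR0 ofR1 mul0r mul1r add0r.
  by rewrite /= in_itv /= => /andP[s0 s1] <-; exact: cU.
apply: bigcup_connected => [|y _].
  exists x0 => y _; exists 0; first by rewrite /= in_itv /= ler01 lexx.
  by rewrite subr0 ofR0 ofR1 mul0r mul1r addr0.
apply: connected_continuous_connected; first exact: segment_connected.
apply: continuous_subspaceT => s; apply: cvgD; apply: cvgM; try exact: cvg_cst.
  by apply: cvg_ofR; apply: cvgB; [exact: cvg_cst|exact: cvg_id].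
by apply: cvg_ofR; exact: cvg_id.
Qed.

Lemma cconvex_simply_connected (U : set C) : cconvex U -> simply_connected U.
Proof.
move=> cU gamma /subspace_continuousP cg Ug g01.
exists (fun p => ofR (1 - p.1) * gamma p.2 + ofR p.1 * gamma 0).
have i01 : (0 : R) \in `[0, 1] by rewrite in_itv /= lexx ler01.
split.
- apply/subspace_continuousP => -[s t] [/= s01 t01].
  apply: (@cvgD _ C _ _ _ (fun p => ofR (1 - p.1) * gamma p.2) (fun p => ofR p.1 * gamma 0)).
    apply: (@cvgM C _ _ _ (fun p => ofR (1 - p.1)) (fun p => gamma p.2)).
  + apply: cvg_ofR; apply: cvgB; first exact: cvg_cst.
    by apply: cvg_within_filter; exact: cvg_fst.
  + have := cg t t01 => h.
    apply: (@cvg_comp _ _ _ snd gamma _ _ _ _ h) => Q.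
    rewrite /within /= => Qt.
    have : nbhs (s, t) (snd @^-1` [set y | `[0, 1]%classic y -> Q y]) by exact: cvg_snd Qt.
    by apply: filterS => -[a b] /= H [_ hb]; exact: H.
  + apply: (@cvgM C _ _ _ (fun p => ofR p.1) (fun p => gamma 0)); last exact: cvg_cst.
    by apply: cvg_ofR; apply: cvg_within_filter; exact: cvg_fst.
- move=> s t; rewrite !in_itv /= => /andP[s0 s1] t01; apply: cU => //; apply: Ug => //.
- by move=> t _; rewrite subr0 ofR0 ofR1 mul1r mul0r addr0.
- by move=> t _; rewrite subrr ofR0 ofR1 mul1r mul0r add0r.
move=> s _; have E : ofR (1 - s) * gamma 0 + ofR s * gamma 0 = gamma 0.
  by rewrite ofRB ofR1; ring.
by rewrite /= -g01 E.
Qed.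

End Sectors.

(** * Borel discs as sectorial domains *)

Section SectorialDomains.
Variable R : realType.
Local Notation C := (CC R).

Lemma im_ray (r tau u : R) : im (ofR r * dir tau * dir u) = r * sin (tau + u).
Proof. by rewrite -mulrA -dirD !reimE; ring. Qed.

(** This makes sectors of angle at most [pi] open and convex. A point of both half-planes is rotated
    by [- a0] into the upper half-plane, where [acos] yields its argument. *)
Lemma sectorE (a0 b0 : R) : a0 < b0 -> b0 <= a0 + pi ->
  sector a0 b0 = half_plane (dir (- a0)) `&` half_plane (- dir (- b0)) :> set C.
Proof.
move=> ab ba; apply/seteqP; split => [h [r [tau [r0 /andP[at_ tb] ->]]]|h].
  split.
    change (is_true (0 < im (ofR r * dir tau * dir (- a0) : C))); rewrite im_ray.
    by rewrite mulr_gt0// sin_gt0_pi//; lra.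
  change (is_true (0 < im (ofR r * dir tau * - dir (- b0) : C))); rewrite mulrN imN im_ray.
  by rewrite -mulrN -sinN mulr_gt0// sin_gt0_pi//; lra.
move=> -[h1']; have {h1'}h1 : 0 < im (h * dir (- a0)) := h1'.
move=> h2'; have {h2'} : 0 < im (h * - dir (- b0)) := h2'; rewrite mulrN imN => h2.
have h0 : h != 0 by apply/eqP => E; rewrite E mul0r ltxx in h1.
have [w w_def] : exists w, w = h * dir (- a0) by exists (h * dir (- a0)).
have [r r_def] : exists r, r = cabs h by exists (cabs h).
have r0 : 0 < r by rewrite r_def cabs_gt0.
have cw : cabs w = r by rewrite w_def r_def cabs_mul_dir.
pose tau := acos (re w / r).
have rw : -1 <= re w / r <= 1.
  have := re_le_cabs w; rewrite cw ler_norml => /andP[l1 l2].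
  by rewrite ler_pdivrMr// ler_pdivlMr// mulN1r mul1r l1.
have sq : (re w / r) ^+ 2 + (im w / r) ^+ 2 = 1.
  have := cabs2 w; rewrite cw => E; rewrite !exprMn -mulrDl -E -exprMn divff ?expr1n// gt_eqF//.
have wE : w = ofR r * dir tau.
  have ct : cos tau = re w / r by rewrite /tau acosK// in_itv.
  have st : sin tau = im w / r.
    rewrite /tau sin_acos// -sq addrAC subrr add0r sqrtr_sqr ger0_norm//.
    by rewrite divr_ge0// ltW// w_def.
  by apply: complexP; rewrite !reimE mul0r ?subr0 ?addr0 ?ct ?st mulrC divfK// gt_eqF.
have hE : h = ofR r * dir (a0 + tau).
  rewrite addrC dirD mulrA -wE w_def -mulrA -dirD addNr dir0 mulr1 //.
have t0 : 0 <= tau by exact: acos_ge0.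
have tpi : tau <= pi by exact: acos_lepi.
have tau0 : 0 < tau.
  rewrite lt_def t0 andbT; apply/eqP => E.
  by move: h1; rewrite -w_def wE E dir0 mulr1 im_ofR ltxx.
exists r, (a0 + tau); split => //.
rewrite ltrDl tau0 /=; rewrite ltNge; apply/negP => bt.
move: h2; rewrite hE im_ray oppr_gt0 pmulr_rlt0// ltNge => /negP; apply.
have [->|ne] := eqVneq (a0 + tau - b0) 0; first by rewrite sin0.
rewrite ltW// sin_gt0_pi// lt_def ne subr_ge0 bt /=; lra.
Qed.

Lemma borel_disc_rayP (t rho r tau : R) : 0 < r ->
  borel_disc t rho (ofR r * dir tau : C) <-> rho^-1 < cos (t - tau) / r.
Proof.
move=> r0; rewrite borel_discP.
have -> : dir t / (ofR r * dir tau) = ofR r^-1 * dir (t - tau) :> C.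
  by rewrite dirD dirN ofRV; field; rewrite dir_neq0 ofR_eq0 gt_eqF.
by rewrite !reimE mul0r subr0 mulrC.
Qed.

Variables (t rho a0 b0 : R).
Hypotheses (rho0 : 0 < rho) (ab : a0 < b0) (at0 : t - pi / 2 <= a0) (bt0 : b0 <= t + pi / 2).

Let D : set C := borel_disc t rho `&` sector a0 b0.

Let DE : D = [set h : C | cabs (h - ofR (rho / 2) * dir t) < rho / 2] `&`
  (half_plane (dir (- a0)) `&` half_plane (- dir (- b0))).
Proof.
rewrite /D sectorE//; last by have := at0; have := bt0; lra.
by congr (_ `&` _); apply/seteqP; split => h /(borel_disc_ball t h rho0).
Qed.

Let D_ray tau : a0 < tau -> tau < b0 -> exists2 r0, 0 < r0 & forall r, 0 < r -> r < r0 ->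
  D (ofR r * dir tau).
Proof.
move=> at_ tb; have c0 : 0 < cos (t - tau) by apply: cos_gt0_pihalf; have := at0; have := bt0; lra.
exists (rho * cos (t - tau)); first by rewrite mulr_gt0.
move=> r r0 rr; split; last by exists r, tau; split => //; rewrite at_.
by apply/borel_disc_rayP => //; rewrite ltr_pdivlMr// mulrC ltr_pdivrMr// mulrC.
Qed.

Lemma sectorial_borel_sector : sectorial_domain D a0 b0.
Proof.
have cD : cconvex D.
  rewrite DE; apply: cconvexI; first exact: cconvex_ball.
  by apply: cconvexI; exact: cconvex_half_plane.
have oD : open D.
  rewrite DE; apply: openI; first exact: open_cball.
  by apply: openI; exact: open_half_plane.
have pi0 := pi_gt0 R.
split.
- split => //; first exact: cconvex_connected.
  have [|//|r r0 Hr] := @D_ray ((a0 + b0) / 2); try (have := ab; lra).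
  by exists (ofR (r / 2) * dir ((a0 + b0) / 2)); apply: Hr; lra.
- exact: cconvex_simply_connected.
- by move=> [/borel_disc_neq0 h _]; move: (h rho0); rewrite eqxx.
- by rewrite ab/= mulr2n; have := at0; have := bt0; lra.
apply/seteqP; split => [u|u [tau]]; last first.
  rewrite /= in_itv /= => /andP[at_ tb] <-.
  move=> B [[A1 A2] [/= /nbhs_ballP[/= e1 e10 H1] nA2] sub].
  have /nbhs_ballP[/= e2 e20 H2] : nbhs tau (@dir R @^-1` A2) by exact: continuous_dir.
  (* An end of the closed arc is not a direction of the open sector, so [tau] is pulled towards the
     middle of the arc by a fraction [s], hence by less than [e2]. *)
  pose s := Num.min (1 / 2) (e2 / (2 * (b0 - a0))).
  have s0 : 0 < s by rewrite lt_min !divr_gt0// mulr_gt0// subr_gt0.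
  have s1 : s <= 1 / 2 by rewrite ge_min lexx.
  have se : s * (2 * (b0 - a0)) <= e2.
    by rewrite -ler_pdivlMr ?ge_min ?lexx ?orbT// mulr_gt0// subr_gt0.
  pose tau' := tau + s * ((a0 + b0) / 2 - tau).
  have [||r0 r00 Hr] := @D_ray tau'; try by rewrite /tau'; have := ab; nra.
  pose r := Num.min r0 e1 / 2.
  have m0 : 0 < Num.min r0 e1 by rewrite lt_min r00.
  have rp : 0 < r by rewrite divr_gt0.
  have rm : r < Num.min r0 e1 by rewrite /r; lra.
  have [rr0 re1] : r < r0 /\ r < e1 by move: rm; rewrite lt_min => /andP.
  exists (r, dir tau'); split.
    exists (ofR r * dir tau'); first exact: Hr.
    rewrite /polar cabs_mul_dir cabs_ofR gtr0_norm//; congr (_, _).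
    by field; rewrite ofR_eq0 gt_eqF.
  apply: sub; split => /=.
    by apply: H1; rewrite /ball /= sub0r normrN gtr0_norm.
  apply: H2; rewrite /ball /= /tau' opprD addNKr normrN ltr_norml; have := ab; nra.
rewrite /boundary_directions /= => cu.
pose K : set C := @dir R @` `[a0, b0].
have Kc : closed K.
  apply: compact_closed; first exact: norm_hausdorff.
  apply: continuous_compact; last exact: segment_compact.
  by apply: continuous_subspaceT => x; exact: continuous_dir.
(* The directions of the points of [D] stay in the compact arc [K], and so do their limits. *)
suff : closure [set p : R * C | K p.2] (0, u).
  have /closure_id <- // : closed [set p : R * C | K p.2].
  by apply: (@preimage_closed _ _ snd K) => // p _; exact: cvg_snd.
apply: closure_subset cu => _ [h [_ [r [tau [r0 /andP[at_ tb] ->]]]] <-] /=.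
exists tau; first by rewrite /= in_itv /= !ltW.
by rewrite cabs_mul_dir cabs_ofR gtr0_norm//; field; rewrite ofR_eq0 gt_eqF.
Qed.

End SectorialDomains.

(** * Uniform estimates on a disc, and compactness *)

Section Assembly.
Variable R : realType.
Local Notation C := (CC R).

Lemma borel_disc_scale (t rho rho' s : R) (h : C) : 0 < s -> 0 < rho' ->
  borel_disc t rho h -> s < rho' * re (dir t / h) -> borel_disc t rho' (ofR s * h).
Proof.
move=> s0 r0 Bh sr; apply/borel_discP.
have -> : dir t / (ofR s * h) = ofR s^-1 * (dir t / h).
  by rewrite invfM ofRV; ring.
rewrite !reimE mul0r subr0 mulrC ltr_pdivlMr// mulrC ltr_pdivrMr// mulrC.
by move: sr; rewrite !reimE.
Qed.

(** For an arc of length [pi] the two half-planes of [sectorE] coincide with [Re (h / dir t) > 0],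
    which is also [Re (dir t / h) > 0]. *)
Lemma borel_disc_sector (t rho : R) : 0 < rho ->
  borel_disc t rho `<=` (sector (t - pi / 2) (t + pi / 2) : set C).
Proof.
move=> r0 h Bh; have h0 := borel_disc_neq0 r0 Bh; have pi0 := pi_gt0 R.
have q0 : 0 < re (dir t / h).
  by move/borel_discP: Bh; apply: lt_trans; rewrite invr_gt0.
rewrite sectorE; [|lra|lra].
have half : 0 < im (h * dir (- (t - pi / 2))).
  rewrite opprB dirD.
  have -> : dir (pi / 2) = Complex 0 1 :> C by rewrite /dir cos_pihalf sin_pihalf.
  have -> : im (h * (Complex 0 1 * dir (- t))) = re (h / dir t).
    by rewrite dirN; move: (dir t)^-1 => u; rewrite !reimE /re /im /=; ring.
  have -> : h / dir t = (dir t / h)^-1 by rewrite invf_div.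
  have p0 : dir t / h != 0 by rewrite mulf_neq0 ?dir_neq0 ?invr_eq0.
  by rewrite reV divr_gt0// exprn_gt0// cabs_gt0.
split; first exact: half.
have E : - dir (- (t + pi / 2)) = dir (- (t - pi / 2)) :> C.
  have -> : - (t - pi / 2) = - (t + pi / 2) + pi :> R by field.
  by rewrite (dirD _ pi); apply: complexP; rewrite !reimE sinpi cospi; ring.
by rewrite E.
Qed.

(** A point of the Borel disc has its argument strictly inside the arc, so it lies over a smaller
    arc, here with ends halfway to [alpha] and [beta], whose subdomain covers it. Since [K], [M] and
    [rho] do not depend on the subarc, the estimates hold on the whole disc. *)
Lemma gevrey_extract d (X : set 'rV[C]_d) (S : set C) (alpha beta : R) f fk :
  beta - alpha = pi -> gevrey_expansion X S alpha beta f fk ->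
  exists K M rho : R, [/\ 0 < K, 0 < M & 0 < rho] /\
    forall h, borel_disc ((alpha + beta) / 2) rho h -> S h /\
    forall n x, X x ->
      cabs (f x h - \sum_(k < n) fk k x * h ^+ k) <= K * M ^+ n * n`!%:R * cabs h ^+ n.
Proof.
move=> ba [_ [K [M [rho [K0 M0 rho0 H]]]]]; exists K, M, rho; split=> // h Bh.
have := borel_disc_sector rho0 Bh.
have -> : (alpha + beta) / 2 - pi / 2 = alpha by rewrite -ba; field.
have -> : (alpha + beta) / 2 + pi / 2 = beta by rewrite -ba; field.
move=> [r [tau [r0 /andP[t1 t2] hE]]].
have [|||S' [SS' _ sub est]] := H ((alpha + tau) / 2) ((tau + beta) / 2); try lra.
have S'h : S' h by apply: sub; split => //; exists r, tau; split => //; apply/andP; split; lra.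
by split=> [|n x Xx]; [exact: SS'|exact: est].
Qed.

Lemma cvg_cabs (T : Type) (F : set_system T) (FF : Filter F) (f : T -> C) (l : C) :
  f @ F --> l -> (fun x => cabs (f x)) @ F --> cabs l.
Proof.
move=> h; apply/cvgrPdist_lt => e e0.
have eC : 0 < ofR e :> C by rewrite -ofR0 ltC_ofR.
move/cvgrPdist_lt: h => /(_ _ eC); apply: filterS => x; rewrite normC_cabs ltC_ofR.
exact: le_lt_trans (cabs_dist _ _).
Qed.

Lemma holo_cvg (V : normedModType C) (U : set V) (f : V -> C) x : holomorphic U f -> U x -> f @ x --> f x.
Proof. by move=> hf Ux; have := differentiable_continuous (hf x Ux). Qed.

(** Applied to [f0] and to the inverse of the derivative of the leading-order polynomial at [f0],
    this provides the constants [Cf] and [Cb] on [X0]. *)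
Lemma holo_bounded (V : normedModType C) (U A : set V) (f : V -> C) :
  compactly_contained A U -> holomorphic U f -> exists2 B : R, 1 <= B & forall x, A x -> cabs (f x) <= B.
Proof.
move=> [cA AU] hf.
have : compact ((fun x => cabs (f x)) @` closure A).
  apply: continuous_compact cA; apply/subspace_continuousP => x /AU Ux.
  apply: cvg_within_filter; apply: cvg_cabs; exact: holo_cvg Ux.
move/compact_bounded => [M [_ HM]]; exists (Num.max 1 (M + 1)); first by rewrite le_max lexx.
move=> x Ax; rewrite (le_trans (ler_norm _))// le_max (HM (M + 1)) ?ltrDl ?orbT//.
by exists x => //; exact: subset_closure.
Qed.

Lemma bounded_inv_sum (n : nat) (r : 'I_n.+1 -> R) : (forall i, 0 < r i) ->
  exists2 r0, 0 < r0 & forall i, r0 <= r i.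
Proof.
move=> r_gt0; pose s := \sum_i (r i)^-1.
have le_s i : (r i)^-1 <= s.
  by rewrite /s (bigD1 i)//= lerDl sumr_ge0// => j _; rewrite invr_ge0 ltW.
have s0 : 0 < s by apply: lt_le_trans (le_s ord0); rewrite invr_gt0.
by exists s^-1 => [|i]; [rewrite invr_gt0|rewrite -[r i]invrK lef_pV2// posrE// invr_gt0].
Qed.

End Assembly.

(** * Uniqueness of the root and conclusion *)

Section Uniqueness.
Variable R : realType.
Local Notation C := (CC R).

(* Along the ray through h, |g - f0| starts near 0 and avoids the value
   [delta / 2], at which g would be a root in the disc where f is the only one. *)
Lemma root_near_zeroth (t rho delta : R) (h : C) (f g : C -> C) (z0 : C) :
  0 < rho -> 0 < delta -> borel_disc t rho h ->
  holomorphic (borel_disc t rho) g ->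
  (exists rho' B : R, 0 < rho' /\ forall y, borel_disc t rho' y -> cabs (g y - z0) <= B * cabs y) ->
  (forall y, borel_disc t rho y -> cabs (f y - z0) < delta / 2) ->
  (forall y, borel_disc t rho y -> cabs (g y - z0) <= delta -> g y = f y) ->
  g h = f h.
Proof.
move=> rho0 d0 Bh hg [rho' [B [rho'0 gB]]] fz gf.
have h0 := borel_disc_neq0 rho0 Bh.
have q0 : 0 < re (dir t / h).
  by move/borel_discP: Bh; apply: lt_trans; rewrite invr_gt0.
pose psi (s : R) := cabs (g (ofR s * h) - z0).
have in_disc (s : R) : 0 < s -> s <= 1 -> borel_disc t rho (ofR s * h).
  move=> s0 s1; apply: (borel_disc_scale s0 rho0 Bh).
  by rewrite (le_lt_trans s1)// -ltr_pdivrMl// mulr1; move/borel_discP: Bh.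
have psi_cvg (s : R) : 0 < s -> s <= 1 -> psi @ s --> psi s.
  move=> s0 s1; apply: cvg_cabs; apply: cvgB; last exact: cvg_cst.
  apply: (@cvg_comp _ _ _ (fun s => ofR s * h) g); last exact: (holo_cvg hg (in_disc s s0 s1)).
  by apply: cvgM; [apply: cvg_ofR; exact: cvg_id|exact: cvg_cst].
(* The point of parameter [s0] is taken so close to 0 that it enters the disc of diameter [rho'] and
   that [B |y|] is below [delta / 2] there. *)
have [s0 [s00 s01 ps0]] : exists s0, [/\ 0 < s0, s0 <= 1 & psi s0 < delta / 2].
  pose B1 := `|B| + 1; have B10 : 0 < B1 by rewrite ltr_wpDl.
  have ch : 0 < cabs h by rewrite cabs_gt0.
  have p1 : 0 < rho' * re (dir t / h) by rewrite mulr_gt0.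
  have p2 : 0 < delta / 2 / (B1 * cabs h) by rewrite divr_gt0 ?mulr_gt0// divr_gt0.
  pose m := Num.min 1 (Num.min (rho' * re (dir t / h)) (delta / 2 / (B1 * cabs h))).
  have m0 : 0 < m by rewrite !lt_min ltr01 p1 p2.
  have mh : m / 2 < m by rewrite ltr_pdivrMr// mulr_natr mulr2n ltrDl.
  move: (mh); rewrite !lt_min => /and3P[m1 m2 m3].
  exists (m / 2); split; [by rewrite divr_gt0|exact: ltW|].
  have m20 : 0 < m / 2 by rewrite divr_gt0.
  apply: (le_lt_trans (gB _ (borel_disc_scale m20 rho'0 Bh m2))).
  rewrite cabsM cabs_ofR gtr0_norm//.
  apply: (@le_lt_trans _ _ (B1 * (m / 2 * cabs h))).
    apply: ler_wpM2r; first by rewrite mulr_ge0// ltW.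
    by rewrite /B1 (le_trans (ler_norm _))// lerDl.
  by rewrite mulrCA -ltr_pdivlMr// mulr_gt0.
have d2 : delta / 2 <= delta by lra.
have fin s : 0 < s -> s <= 1 -> psi s <= delta -> psi s < delta / 2.
  move=> s0' s1 le; rewrite /psi (gf _ (in_disc s s0' s1) le); exact: fz (in_disc s s0' s1).
have psi1 : psi 1 < delta / 2.
  rewrite ltNge; apply/negP => big.
  have [||s] := @IVT R psi s0 1 (delta / 2) s01.
  - apply/subspace_continuousP => s; rewrite /= in_itv /= => /andP[a1 a2].
    by apply: cvg_within_filter; apply: psi_cvg => //; exact: lt_le_trans a1.
  - by rewrite ge_min le_max big (ltW ps0) orbT.
  rewrite in_itv /= => /andP[a1 a2] E.
  by have := fin s (lt_le_trans s00 a1) a2; rewrite E ltxx => /(_ d2).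
move: psi1; rewrite /psi ofR1 mul1r => l1; apply: gf => //; lra.
Qed.

End Uniqueness.

Theorem corollary1p3 (R : realType) (d : nat) (X : set 'rV[CC R]_d)
    (S : set (CC R)) (alpha beta : R) (n : nat)
    (a : 'I_n.+1 -> 'rV[CC R]_d -> CC R -> CC R)
    (ahat : 'I_n.+1 -> nat -> 'rV[CC R]_d -> CC R)
    (f0 : 'rV[CC R]_d -> CC R) :
  domain X ->
  sectorial_domain S alpha beta ->
  beta - alpha = pi ->
  (forall i, holomorphic (X `*` S) (fun p => a i p.1 p.2)) ->
  (forall i, gevrey_expansion X S alpha beta (a i) (ahat i)) ->
  (forall x, X x -> disc n (pol (fun i => ahat i 0%N x)) != 0) ->
  holomorphic X f0 ->
  (forall x, X x -> root (pol (fun i => ahat i 0%N x)) (f0 x)) ->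
  forall X0 : set 'rV[CC R]_d, domain X0 -> compactly_contained X0 X ->
  exists S0 : set (CC R),
    [/\ S0 `<=` S,
        sectorial_domain S0 alpha beta &
        exists (f : 'rV[CC R]_d -> CC R -> CC R)
               (fk : nat -> 'rV[CC R]_d -> CC R),
          [/\ gevrey_root X0 S0 alpha beta a f0 f fk,
              forall g gk, gevrey_root X0 S0 alpha beta a f0 g gk ->
                forall x h, X0 x -> S0 h -> g x h = f x h &
              uniform_borel_resummation X0 S0 ((alpha + beta) / 2) f fk]].
Proof.
move=> [oX _ _] secS ba ha ga discX hf0 rootX X0 [oX0 _ [x0 X0x0]] cX0.
have X0X : X0 `<=` X by move=> x /subset_closure; exact: cX0.2.
have simple x : X x -> (pol (fun i => ahat i 0%N x))^`().[f0 x] != 0.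
  by move=> Xx; apply: disc_simple_root (rootX x Xx); [exact: size_pol|exact: discX].
case: n a ahat ha ga discX rootX simple => [|m] a ahat ha ga discX rootX simple.
  (* For [n = 0] the derivative of the polynomial vanishes identically, so that the hypotheses are
     contradictory at any point of [X0]. *)
  have := simple x0 (X0X _ X0x0); rewrite pol_deriv_horner big_ord1.
  by rewrite mulr0n mulr0 eqxx.
set t := (alpha + beta) / 2.
have tm : t - pi / 2 = alpha by rewrite /t -ba; field.
have tp : t + pi / 2 = beta by rewrite /t -ba; field.
have /choice[KMr HKMr] : forall i, exists v : R * R * R,
    [/\ 0 < v.1.1, 0 < v.1.2 & 0 < v.2] /\
    forall h, borel_disc t v.2 h -> S h /\ forall n x, X x ->
      cabs (a i x h - \sum_(k < n) ahat i k x * h ^+ k) <= v.1.1 * v.1.2 ^+ n * n`!%:R * cabs h ^+ n.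
  by move=> i; have [K [M [r H]]] := gevrey_extract ba (ga i); exists (K, M, r).
have Kp i : 0 < (KMr i).1.1 by case: (HKMr i) => -[].
have Mp i : 0 < (KMr i).1.2 by case: (HKMr i) => -[].
have rp i : 0 < (KMr i).2 by case: (HKMr i) => -[].
have [r0 r00 r0_le] := bounded_inv_sum rp.
pose rho := Num.min r0 1.
have rho0 : 0 < rho by rewrite lt_min r00 ltr01.
have rho1 : rho <= 1 by rewrite ge_min lexx orbT.
have sub_rho i : borel_disc t rho `<=` (borel_disc t (KMr i).2 : set (CC R)).
  by apply: borel_disc_le => //; rewrite ge_min r0_le.
have rhoS : borel_disc t rho `<=` S by move=> h /(sub_rho ord0) /(HKMr ord0).2[].
pose K := \sum_i (KMr i).1.1; pose M := 1 + \sum_i (KMr i).1.2.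
have le_sum (F : 'I_m.+2 -> R) i : (forall j, 0 < F j) -> F i <= \sum_j F j.
  by move=> F0; rewrite (bigD1 i)//= lerDl sumr_ge0// => j _; rewrite ltW.
have K0 : 0 < K by apply: lt_le_trans (Kp ord0) _; exact: le_sum.
have M1 : 1 <= M by rewrite lerDl sumr_ge0// => i _; rewrite ltW.
have gev_a i N x : X0 x -> gev t rho N K M (a i x) (fun k => ahat i k x).
  move=> X0x; apply: (@gev_le _ _ _ _ (KMr i).1.1 (KMr i).1.2); rewrite ?(ltW (Kp i)) ?(ltW (Mp i))//.
  - exact: le_sum.
  - by rewrite (le_trans (le_sum (fun i => (KMr i).1.2) i Mp))// lerDr.
  move=> k h _ /(sub_rho i) Bh; have [_ H] := (HKMr i).2 h Bh.
  by apply: H; exact: X0X.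
have hahat i k : holomorphic X (ahat i k) by exact: (ga i).1.
pose b x := (pol (fun i => ahat i 0%N x))^`().[f0 x].
have hb : holomorphic X b.
  have -> : b = fun x => \sum_(i < m.+2) ahat i 0%N x * ((i : nat)%:R * f0 x ^+ i.-1).
    by apply/funext => x; rewrite /b pol_deriv_horner; apply: eq_bigr => i _; rewrite mulr_natl.
  by apply: holo_sum => i; apply: holoM => //; apply: holoZ; exact: holoX.
have [Cf Cf1 f0_le] := holo_bounded cX0 hf0.
have [Cb Cb1 b_le] := holo_bounded cX0 (holoV hb simple).
have Cb0 : 0 < Cb by exact: lt_le_trans Cb1.
have ha0 i : holomorphic (X0 `*` borel_disc t rho) (fun p => a i p.1 p.2).
  by apply: holo_sub (ha i) => -[x h] [/= /X0X Xx /rhoS Sh].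
have hahat0 i k : holomorphic X0 (ahat i k) by exact: holo_sub (hahat i k).
have hf00 : holomorphic X0 f0 by exact: holo_sub hf0.
have rootX0 x (X0x : X0 x) := rootX x (X0X _ X0x).
have simple0 x (X0x : X0 x) := simple x (X0X _ X0x).
have [rho2 [K2 [M2 [f [fk [[/andP[rho20 rho2_le] K20 M20] hf hfk f_root f_gev]]]]]] :=
  root_expansion oX0 rho0 rho1 K0 M1 Cf1 Cb0 ha0 hahat0 gev_a hf00 f0_le rootX0 simple0 b_le.
have [delta [rho3 [delta0 rho30 f_uniq]]] :=
  root_unique K0 M1 Cf1 Cb0 gev_a f0_le simple0 b_le.
have f_est x n h : X0 x -> borel_disc t rho2 h ->
    cabs (f x h - \sum_(k < n) fk k x * h ^+ k) <= K2 * M2 ^+ n * n`!%:R * cabs h ^+ n.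
  by move=> X0x; have [_ H] := f_gev x X0x; exact: H (leqnn n).
have [rho4 rho40 f_borel] := nevanlinna oX0 rho20 K20 M20 hf hfk (fun n x h => @f_est x n h).
(* On the disc of diameter [rho5] the estimate of order 1 gives [|f - f0| <= K2 M2 |h| < delta / 2],
   the gap that [root_near_zeroth] needs. *)
pose rho5 := delta / 2 / (K2 * M2).
have KM0 : 0 < K2 * M2 by rewrite mulr_gt0.
have rho50 : 0 < rho5 by rewrite !divr_gt0.
pose r := Num.min rho2 (Num.min rho3 (Num.min rho4 rho5)).
have rgt0 : 0 < r by rewrite !lt_min rho20 rho30 rho40 rho50.
have [r2 r3 r4 r5] : [/\ r <= rho2, r <= rho3, r <= rho4 & r <= rho5].
  by rewrite /r !ge_min !lexx !orbT.
have sub2 : borel_disc t r `<=` (borel_disc t rho2 : set (CC R)) by exact: borel_disc_le.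
have sub : borel_disc t r `<=` (borel_disc t rho : set (CC R)) by apply: borel_disc_le => //; exact: le_trans rho2_le.
(* The Borel disc already lies in the sector with opening from [alpha] to [beta], so
   [sectorial_borel_sector] makes the disc itself an admissible [S0]. *)
have sector_r : borel_disc t r = borel_disc t r `&` sector alpha beta :> set (CC R).
  apply/seteqP; split => [h Bh|h []//]; split=> //.
  by have := borel_disc_sector rgt0 Bh; rewrite tm tp.
have pi0 := pi_gt0 R.
exists (borel_disc t r); split.
- by move=> h /sub; exact: rhoS.
- by rewrite sector_r; apply: sectorial_borel_sector => //; lra.
exists f, fk; split.
- split=> //.
  + by apply: holo_sub hf => -[x h] [/= X0x /sub2 Bh].
  + by move=> x h X0x /sub2; exact: f_root.
  + split=> //; exists K2, M2, r; split=> // a0 b0 a0l ab b0l.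
    (* [S'] is exactly the part of the disc over the subarc, so that the covering condition holds by
       construction. *)
    exists (borel_disc t r `&` sector a0 b0); split=> //.
    * by apply: sectorial_borel_sector => //; lra.
    * by move=> n x h X0x [/sub2 Bh _]; exact: f_est.
  + by move=> x /f_gev[].
(* The expansion of [g] comes with its own constants and its own disc, so it puts [g] near [f0] only
   close to the origin; [root_near_zeroth] carries this over to all of [S0]. *)
- move=> g gk [hg g_root g_exp gk0] x h X0x Bh.
  apply: (@root_near_zeroth R t r delta h (f x) (g x) (f0 x)) => //.
  + exact: (holo_slice2 hg X0x).
  + have [Kg [Mg [rg [[Kg0 Mg0 rg0] Hg]]]] := gevrey_extract ba g_exp.
    exists rg, (Kg * Mg); split=> // y /Hg[_ /(_ 1%N x X0x)].
    by rewrite big_ord1 expr0 mulr1 gk0// !expr1 factS fact0 muln1 mulr1.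
  + move=> y By; have y0 := borel_disc_cabs rgt0 By.
    have := f_est x 1%N y X0x (sub2 _ By).
    rewrite big_ord1 expr0 mulr1 (f_gev x X0x).1 !expr1 factS fact0 muln1 mulr1 => /le_lt_trans; apply.
    by rewrite mulrC -ltr_pdivlMr//; exact: lt_le_trans r5.
  move=> y By gd; have y0 := borel_disc_cabs rgt0 By.
  apply: (f_uniq x y) => //; [exact: sub|exact: le_trans (ltW y0) r3| |exact: g_root|exact: f_root (sub2 _ By)].
  have := f_est x 1%N y X0x (sub2 _ By).
  rewrite big_ord1 expr0 mulr1 (f_gev x X0x).1 !expr1 factS fact0 muln1 mulr1 => /le_trans; apply.
  rewrite mulrC -ler_pdivlMr//; apply: (le_trans (ltW y0)); apply: (le_trans r5).
  by rewrite ler_wpM2r ?invr_ge0 ?(ltW KM0)//; lra.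
by apply: f_borel => //; exact: borel_disc_le.
Qed.
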